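(* There is a dense subset $\mathcal{D}\subset\mathrm{Diff}^1(S^1)$ such that every $f\in\mathcal{D}$ commutes with the flow of a $C^\infty$ Morse-Smale vector field $X$ on $S^1$. More precisely, for every $f\in\mathcal{D}$, $f$ is Morse-Smale and $f^q$ is the time one map of the flow of $X$, where $q=2$ if $f$ is orientation reversing, and $q$ is the (common) period of the periodic orbits of $f$ if $f$ is orientation preserving. Furthermore, $C(f)$ is isomorphic to $\mathbb{R}\times(\mathbb{Z}/q\mathbb{Z})$.
   Context: $S^1=\mathbb{R}/\mathbb{Z}$ and $\mathrm{Diff}^1(S^1)$ is the space of $C^1$ diffeomorphisms of $S^1$ (orientation preserving or reversing) with the $C^1$-topology. A diffeomorphism of $S^1$ is Morse-Smale if its non-wandering set consists of finitely many hyperbolic periodic points, alternately attracting and repelling. The centralizer of $f$ is $C(f)=\{g\in\mathrm{Diff}^1(S^1): fg=gf\}$. *)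

(* Defs.v *)
From HB Require Import structures.
From mathcomp Require Import all_boot all_order all_algebra.
From mathcomp Require Import all_classical all_reals all_analysis.

Set Implicit Arguments.
Unset Strict Implicit.
Unset Printing Implicit Defensive.

Import Order.TTheory GRing.Theory Num.Theory.
Import numFieldNormedType.Exports.

Local Open Scope classical_set_scope.
Local Open Scope ring_scope.
Local Open Scope quotient_scope.

Definition integers (R : realType) : zmodClosed R :=
  GRing.ZmodClosed.clone R (@Num.int_num_subdef R) _.

(* Despite its name, the quotient below only needs an additive subgroup. *)
Definition circle (R : realType) : Type := {ideal_quot (integers R)}.

HB.instance Definition _ (R : realType) := Choice.on (circle R).
HB.instance Definition _ (R : realType) :=
  EqQuotient.on (circle R).

Section Circle.
Context {R : realType}.
Local Notation S1 := (circle R).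

Definition proj (a : R) : S1 := \pi_S1 a.

Lemma projP (a b : R) : proj a = proj b <-> a - b \is a Num.int.
Proof.
rewrite /proj; split => [/eqP|h]; first by rewrite eqmodE.
by apply/eqP; rewrite eqmodE.
Qed.

Lemma proj_repr (x : S1) : proj (repr x) = x.
Proof. exact: reprK. Qed.

Definition circle_ball (x : S1) (e : R) (y : S1) : Prop :=
  exists a b : R, [/\ proj a = x, proj b = y & `|a - b| < e].

Let circle_ball_center x (e : R) : 0 < e -> circle_ball x e x.
Proof.
by move=> e0; exists (repr x), (repr x); rewrite subrr normr0 !proj_repr.
Qed.

Let circle_ball_sym x y (e : R) : circle_ball x e y -> circle_ball y e x.
Proof. by move=> [a [b [ha hb h]]]; exists b, a; rewrite distrC. Qed.

Let circle_ball_triangle x y z (e1 e2 : R) :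
  circle_ball x e1 y -> circle_ball y e2 z -> circle_ball x (e1 + e2) z.
Proof.
move=> [a [b [ha hb h1]]] [b' [c [hb' hc h2]]].
exists a, (c + (b - b')); split => //.
- rewrite -hc; apply/projP.
  by rewrite addrAC subrr add0r; apply/projP; rewrite hb hb'.
- have -> : a - (c + (b - b')) = (a - b) + (b' - c).
    by rewrite opprD opprB addrA -[RHS]addrA [b' - c]addrC !addrA
      [a - b - c]addrAC -!addrA [- b + _]addrC.
  by rewrite (le_lt_trans (ler_normD _ _))// ltrD.
Qed.

Local Notation circle_ent := (entourage_ circle_ball).
HB.instance Definition _ := hasNbhs.Build S1 (nbhs_ circle_ent).
HB.instance Definition _ := @Nbhs_isPseudoMetric.Build R S1
  circle_ent erefl circle_ball circle_ball_center circle_ball_sym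
  circle_ball_triangle erefl.

(* S^1 carries the smooth structure for which [proj] is a local
   diffeomorphism, so that a map of S^1 is C^1 iff it is covered by a C^1
   function on the line. *)
Definition is_C1_lift (f : S1 -> S1) (F : R -> R) : Prop :=
  [/\ forall a, f (proj a) = proj (F a),
      forall a, derivable F a 1 &
      continuous F^`()%classic].

Definition is_C1 (f : S1 -> S1) : Prop := exists F, is_C1_lift f F.

(* The derivative of a C^1 map in the trivialisation T S^1 = S^1 * R given by
   [proj]; by [cderiveE] it depends neither on the lift nor on the
   representative. Junk value 0 if f is not C^1. *)
Definition cderive (f : S1 -> S1) (x : S1) : R :=
  (xget (cst 0) (is_C1_lift f))^`()%classic (repr x).

Lemma cderiveE f F a : is_C1_lift f F -> cderive f (proj a) = F^`()%classic a.
Proof.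
move=> fF; rewrite /cderive.
have [G_lift dG _] : is_C1_lift f (xget (cst 0) (is_C1_lift f)).
  by apply: xgetPex; exists F.
move: (xget _ _) G_lift dG => G G_lift dG.
case: fF => F_lift dF _.
set b := repr (proj a); set c := b - a.
have cZ : c \is a Num.int by apply/projP; exact: proj_repr.
pose H := G \o shift c.
have dH y : is_derive y (1 : R) H ('D_1 G (y + c)).
  rewrite -['D_1 G _]mulr1; apply: is_derive1_comp.
    exact: DeriveDef (dG _) _.
  exact: is_derive_shift.
pose K y := H y - F y.
have KZ y : K y \is a Num.int.
  apply/projP; rewrite -G_lift -F_lift; congr f.
  by apply/projP; rewrite /= addrAC subrr add0r.
have K_cont : {for a, continuous K}.
  apply: cvgB.
    exact/differentiable_continuous/derivable1_diffP.
  exact/differentiable_continuous/derivable1_diffP.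
have K_near : \forall y \near a, H y = (F + cst (K a)) y.
  have /cvgrPdist_lt/(_ 1 ltr01) := K_cont.
  apply: filterS => y; apply: contraPP => /eqP hy; apply/negP; rewrite -leNgt.
  apply: norm_intr_ge1; first exact: rpredB.
  apply: contra hy => /eqP/subr0_eq e; apply/eqP.
  by rewrite -[RHS]/(F y + K a) e /K [RHS]addrC subrK.
rewrite !derive1E.
have := near_eq_derive (1 : R) K_near.
rewrite deriveD//.
by rewrite derive_cst addr0 derive_val /c addrC subrK.
Qed.

Lemma is_C1_id : is_C1 id.
Proof.
exists id; split => //.
rewrite (_ : id^`()%classic = cst 1); first by move=> x; exact: cst_continuous.
by apply/funext => x; rewrite derive1_id.
Qed.

Lemma is_C1_comp f g : is_C1 f -> is_C1 g -> is_C1 (f \o g).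
Proof.
move=> [F [Ff dF cF]] [G [Gg dG cG]]; exists (F \o G); split.
- by move=> a /=; rewrite Gg Ff.
- move=> a; apply/derivable1_diffP/differentiable_comp;
    exact/derivable1_diffP.
- rewrite (_ : (F \o G)^`()%classic = (F^`()%classic \o G) * G^`()%classic).
    move=> x; apply: cvgM; last exact: cG.
    apply: continuous_comp; last exact: cF.
    exact/differentiable_continuous/derivable1_diffP.
  by apply/funext => x; rewrite derive1_comp.
Qed.

End Circle.

(* C^1 diffeomorphisms of either orientation. [diff_inv] is determined by
   [diff_fun], so this adds no data. *)
Record diff1 (R : realType) := Diff1 {
  diff_fun :> circle R -> circle R ;
  diff_inv : circle R -> circle R ;
  diff_funK : cancel diff_fun diff_inv ;
  diff_invK : cancel diff_inv diff_fun ;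
  diff_fun_C1 : is_C1 diff_fun ;
  diff_inv_C1 : is_C1 diff_inv }.

HB.instance Definition _ (R : realType) := gen_eqMixin (diff1 R).
HB.instance Definition _ (R : realType) := gen_choiceMixin (diff1 R).

Section Diff1.
Context {R : realType}.
Local Notation S1 := (circle R).
Local Notation Diff := (diff1 R).

Lemma diff1_ext (f g : Diff) : f =1 g -> f = g.
Proof.
case: f g => [f f' K1 K2 c1 c2] [g g' K3 K4 c3 c4] /= fg.
have efg : f = g by apply/funext.
have e' : f' = g'.
  by apply/funext => x; rewrite -{1}(K4 x) -fg K1.
case: _ / efg K3 K4 c3 {fg} => K3 K4 c3; case: _ / e' K3 K4 c4 => K3 K4 c4.
by congr Diff1; exact: Prop_irrelevance.
Qed.

Definition diff_one : Diff :=
  @Diff1 R id id (fun=> erefl) (fun=> erefl) is_C1_id is_C1_id.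

Definition diff_mul (f g : Diff) : Diff :=
  @Diff1 R (f \o g) (diff_inv g \o diff_inv f)
    (can_comp (@diff_funK R f) (@diff_funK R g))
    (can_comp (@diff_invK R g) (@diff_invK R f))
    (is_C1_comp (@diff_fun_C1 R f) (@diff_fun_C1 R g))
    (is_C1_comp (@diff_inv_C1 R g) (@diff_inv_C1 R f)).

Definition diff_invg (f : Diff) : Diff :=
  Diff1 (@diff_invK R f) (@diff_funK R f)
    (@diff_inv_C1 R f) (@diff_fun_C1 R f).

Let diff_mulA : associative diff_mul.
Proof. by move=> f g h; exact: diff1_ext. Qed.
Let diff_mul1 : left_id diff_one diff_mul.
Proof. by move=> f; exact: diff1_ext. Qed.
Let diff_mulr1 : right_id diff_one diff_mul.
Proof. by move=> f; exact: diff1_ext. Qed.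
Let diff_mulV : left_inverse diff_one diff_invg diff_mul.
Proof. by move=> f; apply: diff1_ext => x /=; rewrite diff_funK. Qed.
Let diff_mulrV : right_inverse diff_one diff_invg diff_mul.
Proof. by move=> f; apply: diff1_ext => x /=; rewrite diff_invK. Qed.

HB.instance Definition _ := isGroup.Build Diff
  diff_mulA diff_mul1 diff_mulr1 diff_mulV diff_mulrV.

(* The C^1 topology: uniform convergence of the map and of its derivative. *)
Definition diff_ball (f : Diff) (e : R) (g : Diff) : Prop :=
  forall x, ball (f x) e (g x) /\ `|cderive f x - cderive g x| < e.

Let diff_ball_center f (e : R) : 0 < e -> diff_ball f e f.
Proof.
by move=> e0 x; split; [exact: ballxx|rewrite subrr normr0].
Qed.

Let diff_ball_sym f g (e : R) : diff_ball f e g -> diff_ball g e f.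
Proof.
move=> h x; have [h1 h2] := h x.
by split; [exact: ball_sym|rewrite distrC].
Qed.

Let diff_ball_triangle f g h (e1 e2 : R) :
  diff_ball f e1 g -> diff_ball g e2 h -> diff_ball f (e1 + e2) h.
Proof.
move=> h1 h2 x; have [a1 b1] := h1 x; have [a2 b2] := h2 x; split.
  exact: ball_triangle a1 a2.
by rewrite (le_lt_trans (ler_distD (cderive g x) _ _))// ltrD.
Qed.

Local Notation diff_ent := (entourage_ diff_ball).
HB.instance Definition _ := hasNbhs.Build Diff (nbhs_ diff_ent).
HB.instance Definition _ := @Nbhs_isPseudoMetric.Build R Diff
  diff_ent erefl diff_ball diff_ball_center diff_ball_sym
  diff_ball_triangle erefl.

Definition orientation_preserving (f : Diff) : Prop :=
  forall x, 0 < cderive f x.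
Definition orientation_reversing (f : Diff) : Prop :=
  forall x, cderive f x < 0.

Definition has_period (f : Diff) (x : S1) (n : nat) : Prop :=
  [/\ (0 < n)%N, iter n f x = x &
      forall m, (0 < m < n)%N -> iter m f x <> x].

Definition common_period (f : Diff) (q : nat) : Prop :=
  (exists x, has_period f x q) /\
  forall x n, has_period f x n -> n = q.

Definition nonwandering (f : Diff) : set S1 :=
  [set x | forall U, nbhs x U ->
     exists2 n, (0 < n)%N & exists2 y, U y & U (iter n f y)].

Definition hyperbolic_periodic (f : Diff) : set S1 :=
  [set x | exists2 n, has_period f x n & `|cderive (iter n f) x| != 1].
Definition attracting_periodic (f : Diff) : set S1 :=
  [set x | exists2 n, has_period f x n & `|cderive (iter n f) x| < 1].
Definition repelling_periodic (f : Diff) : set S1 :=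
  [set x | exists2 n, has_period f x n & 1 < `|cderive (iter n f) x|].

(* Any two cyclically consecutive points of W are one in A and one in B; an
   only point of W is its own successor (b = a + 1). *)
Definition alternately (W A B : set S1) : Prop :=
  forall a b : R, a < b -> W (proj a) -> W (proj b) ->
    (forall c, a < c < b -> ~ W (proj c)) ->
    (A (proj a) /\ B (proj b)) \/ (B (proj a) /\ A (proj b)).

Definition morse_smale (f : Diff) : Prop :=
  [/\ finite_set (nonwandering f),
      nonwandering f `<=` hyperbolic_periodic f &
      alternately (nonwandering f)
        (attracting_periodic f) (repelling_periodic f)].

(* Vector fields are read in the trivialisation T S^1 = S^1 * R. *)
Definition smooth_field (X : S1 -> R) : Prop :=
  forall n a, derivable (X \o proj)^`(n)%classic a 1.

Definition field_derive (X : S1 -> R) (x : S1) : R :=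
  (X \o proj)^`()%classic (repr x).

Definition is_flow (X : S1 -> R) (phi : R -> S1 -> S1) : Prop :=
  forall a : R, exists gamma : R -> R,
    [/\ gamma 0 = a,
        forall t : R, is_derive t (1 : R) gamma (X (proj (gamma t))) &
        forall t, phi t (proj a) = proj (gamma t)].

Definition flow_nonwandering (phi : R -> S1 -> S1) : set S1 :=
  [set x | forall U, nbhs x U -> forall T : R,
     exists2 t, T <= t & exists2 y, U y & U (phi t y)].

Definition morse_smale_field (X : S1 -> R) (phi : R -> S1 -> S1) : Prop :=
  [/\ finite_set (flow_nonwandering phi),
      flow_nonwandering phi `<=` [set x | X x = 0 /\ field_derive X x != 0] &
      alternately (flow_nonwandering phi)
        [set x | X x = 0 /\ field_derive X x < 0]
        [set x | X x = 0 /\ 0 < field_derive X x]].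

Definition centralizer (f : Diff) : set Diff := [set g | commute f g].

(* For 0 < q the additive group of 'I_q.-1.+1 is Z/qZ, q = 1 included
   (unlike 'Z_q). *)
Definition centralizer_isog (f : Diff) (q : nat) : Prop :=
  exists Phi : R * 'I_q.-1.+1 -> Diff,
    set_bij setT (centralizer f) Phi /\
    {morph Phi : u v / u + v >-> (u * v)%g}.

End Diff1.

(* Main.v *)
Require Import Defs.
From mathcomp Require Import all_boot all_order all_algebra.
From mathcomp Require Import all_classical all_reals all_analysis.
From mathcomp Require Import ring lra zify.
Import Defs.
Set Implicit Arguments.
Unset Strict Implicit.
Unset Printing Implicit Defensive.
Import Order.TTheory GRing.Theory Num.Theory.
Import numFieldNormedType.Exports.

Local Open Scope ring_scope.
Local Open Scope classical_set_scope.
(** Everything happens on the line, for lifts F of circle diffeomorphisms. A vector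
    field X with simple zeros is used through a clock T, a primitive of 1/X off the
    zeros, in whose coordinate the flow of X is translation by the time. The dense set
    consists of the diffeomorphisms covered by a [model]: T is advanced by exactly 1/q
    under F. Then F permutes the flow lines, commutes with the flow, and its q-th
    iterate is the time one map up to an integer translation; that f is Morse-Smale can
    be read off T and the slopes of X at its zeros. The models have two further
    features, which make the centralizer as small as possible: one orbit of zeros,
    that of p0, has a slope of X that no other orbit (of fixed points, if f reverses the
    orientation) has, and, when f preserves the
    orientation, T behaves differently on the two sides of a repelling zero.

    Centralizer ([model_centralizer]). Let g commute with f, hence with f^q, the time one
    map. Since g is C^1 and commutes with a linear contraction or expansion near each zero,
    it is affine there ([cent_linear]). Therefore the amount by which g advances T is
    locally constant near the zeros, and by invariance under the time one map everywhere
    off the zeros ([shift_time_locally_cst]). The asymmetry of T at the repelling zeros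
    excludes that g reverses the orientation when f preserves it ([cent_not_reversing]). Since g
    preserves slopes, it preserves the orbit of p0, so that after composition with a power
    of f it preserves the orientation and fixes p0; it then agrees with an element of the
    flow near p0, and this propagates along the line ([cent_preserving]). Hence the
    centralizer is generated by the flow and by f, and f composed with the flow at
    time -1/q has order q.

    Density ([models_dense]) has two steps. The first one ([tame_dense]) makes the map
    smooth, with hyperbolic periodic points, affine near them, and with a distinguished
    multiplier. A return of an orbit close to itself is closed by a small rotation
    ([closing]), while an orientation reversing map always has fixed points. Multipliers are adjusted by
    affine germs ([affine_germs]). The remaining periodic points are made
    hyperbolic by pushing the map by a regular value of its displacement on a fundamental
    arc ([hyperbolic_dense]).

    The second step ([adapted_dense]) makes some clock exact. Start from a
    clock T that is exact near the periodic points, a logarithm in the linearizing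
    coordinate ([adapted_clock]). Elsewhere F advances T by 1/q up to a defect that vanishes
    near the periodic points. Replace T by the average T_N of T o F^j - j/q over j < N. The defect
    of T_N is an average of N values of the first defect along an orbit; their sum is
    bounded independently of N, since the displacements of F^q have bounded sums along
    orbits ([orbit_displ_sum]) and dominate the defect. So the defect of T_N is O(1/N). By the same
    summability the vector fields of the clocks T_N are bounded together with their
    derivatives, uniformly in N ([rates_bound], [rates_slope_bound]), and moving F x along
    the flow of such a field by the defect changes F by a C^1 small amount
    ([correction_close]). The result advances T_N by exactly 1/q. *)

(** * One-variable calculus *)

Section Calculus.
Context {R : realType}.
Implicit Types (f g F G : R -> R) (a b c x y z l e d r : R).

(** Opaque to class inference, unlike [is_derive], so that the rules below are
    only used when named. *)
Definition der f x l : Prop := is_derive x (1 : R) f l.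

Lemma near_ball x (P : R -> Prop) :
  (\forall y \near x, P y) <->
  exists2 r : R, 0 < r & forall y, `|y - x| < r -> P y.
Proof.
split.
  by move=> /nbhs_ballP[r /= r0 h]; exists r => // y yx; apply: h; rewrite /ball/= distrC.
by move=> [r r0 h]; apply/nbhs_ballP; exists r => //= y; rewrite /ball/= distrC => /h.
Qed.

Lemma der_derive1 f x l : der f x l -> (derive1 f) x = l.
Proof. by rewrite /der => h; rewrite derive1E derive_val. Qed.

Lemma derivable_der f x : derivable f x 1 -> der f x ((derive1 f) x).
Proof. by move=> h; rewrite /der derive1E; exact: DeriveDef. Qed.

Lemma der_derivable f x l : der f x l -> derivable f x 1.
Proof. by case. Qed.

Lemma der_eq f x l l' : der f x l -> l = l' -> der f x l'.
Proof. by move=> h <-. Qed.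

Lemma der_near f g x l : (\forall y \near x, g y = f y) -> der f x l -> der g x l.
Proof.
move=> h; apply: near_eq_is_derive; near=> y; apply/esym.
by near: y.
Unshelve. all: by end_near. Qed.

Lemma der_ext f g x l : (forall y, g y = f y) -> der f x l -> der g x l.
Proof. by move=> h; apply: der_near; near=> y. Unshelve. all: by end_near. Qed.

Lemma der_continuous f x l : der f x l -> {for x, continuous f}.
Proof. by case=> h _; apply/differentiable_continuous/derivable1_diffP. Qed.

Lemma derivable_continuous f x : derivable f x 1 -> {for x, continuous f}.
Proof. by move=> h; apply/differentiable_continuous/derivable1_diffP. Qed.

Lemma der_cst c x : der (fun=> c) x 0.
Proof. exact: is_derive_cst. Qed.

Lemma der_id x : der (fun y => y) x 1.
Proof. exact: is_derive_id. Qed.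

Lemma derD f g x l l' : der f x l -> der g x l' -> der (fun y => f y + g y) x (l + l').
Proof. by move=> hf hg; apply: (@is_deriveD _ _ _ f g). Qed.

Lemma derN f x l : der f x l -> der (fun y => - f y) x (- l).
Proof. by move=> hf; apply: (@is_deriveN _ _ _ f). Qed.

Lemma derB f g x l l' : der f x l -> der g x l' -> der (fun y => f y - g y) x (l - l').
Proof. by move=> hf hg; apply: derD => //; exact: derN. Qed.

Lemma derM f g x l l' :
  der f x l -> der g x l' -> der (fun y => f y * g y) x (l * g x + f x * l').
Proof.
rewrite /der => hf hg; apply: is_derive_eq.
by rewrite /GRing.scale/= addrC mulrC.
Qed.

Lemma derZ k f x l : der f x l -> der (fun y => k * f y) x (k * l).
Proof.
move=> hf; apply: der_eq; first exact: (derM (der_cst k x) hf).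
by rewrite mul0r add0r.
Qed.

Lemma derV f x l : f x != 0 -> der f x l -> der (fun y => (f y)^-1) x (- l / f x ^+ 2).
Proof.
rewrite /der => f0 hf; apply: is_derive_eq.
by rewrite /GRing.scale/= mulrC mulrN mulNr.
Qed.

Lemma der_comp f g x l l' : der f (g x) l -> der g x l' -> der (fun y => f (g y)) x (l * l').
Proof. by move=> hf hg; apply: (@is_derive1_comp _ f g). Qed.

Lemma der_shift f c x l : der f (x + c) l -> der (fun y => f (y + c)) x l.
Proof.
move=> h; apply: der_eq.
  apply: (@der_comp f (fun y => y + c)); first exact: h.
  by apply: derD; [exact: der_id|exact: der_cst].
by rewrite addr0 mulr1.
Qed.

Lemma der_affine c z s x : der (fun y => c + s * (y - z)) x s.
Proof.
apply: der_eq.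
  apply: derD; first exact: der_cst.
  by apply: derZ; apply: derB; [exact: der_id|exact: der_cst].
by rewrite subr0 mulr1 add0r.
Qed.

Lemma der_inverse f g l x :
  (\forall y \near x, g (f y) = y) -> (\forall y \near x, {for y, continuous f}) ->
  der f x l -> l != 0 -> der g (f x) l^-1.
Proof. by rewrite /der; exact: is_derive_inverse. Qed.

Lemma mvt f (f' : R -> R) a b : a <= b ->
  (forall x, a <= x <= b -> der f x (f' x)) ->
  exists2 c : R, a <= c <= b & f b - f a = f' c * (b - a).
Proof.
move=> ab h; have := @MVT_segment _ f f' a b ab.
case.
- by move=> x; rewrite in_itv/= => /andP[/ltW xa /ltW xb]; apply: h; rewrite xa.
- apply: derivable_within_continuous => x; rewrite in_itv/= => /h xab.
  exact: (der_derivable xab).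
- by move=> c; rewrite in_itv/= => ? ?; exists c.
Qed.

Lemma mvt_between f (f' : R -> R) a b :
  (forall x, (a <= x <= b) \/ (b <= x <= a) -> der f x (f' x)) ->
  exists2 c : R, (a <= c <= b) \/ (b <= c <= a) & f b - f a = f' c * (b - a).
Proof.
move=> h; case: (leP a b) => [ab|/ltW ba].
  have [x xab|c cab e] := mvt (f := f) (f' := f') ab; first by apply: h; left.
  by exists c => //; left.
have [x xab|c cab e] := mvt (f := f) (f' := f') ba; first by apply: h; right.
exists c; first by right.
by rewrite -[LHS]opprB e -mulrN opprB.
Qed.

Lemma between_dist a b c : (a <= c <= b) \/ (b <= c <= a) -> `|c - a| <= `|b - a|.
Proof.
case=> /andP[h1 h2].
  by rewrite !ger0_norm ?subr_ge0 ?lerB// (le_trans h1).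
by rewrite !ler0_norm ?subr_le0 ?lerN2 ?lerB// (le_trans h1).
Qed.

Lemma ivt f a b v : a <= b -> (forall x, a <= x <= b -> {for x, continuous f}) ->
  (f a <= v <= f b) \/ (f b <= v <= f a) -> exists2 c : R, a <= c <= b & f c = v.
Proof.
move=> ab cf hv; have := @IVT _ f a b v ab.
case.
- apply/continuous_in_subspaceT => z /[1!inE]/=; rewrite in_itv/=; exact: cf.
- by rewrite ge_min le_max; case: hv => /andP[-> ->]; rewrite ?orbT.
- by move=> c; rewrite in_itv/=; exists c.
Qed.

Lemma der0_cst f a b : (forall x, a < x < b -> der f x 0) ->
  forall x y, a < x < b -> a < y < b -> f x = f y.
Proof.
move=> h x y; wlog xy : x y / x <= y.
  by move=> w; case: (leP x y) => [/w//|/ltW /w h2 ? ?]; apply/esym/h2.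
move=> /andP[ax xb] /andP[ay yb].
have [z /andP[xz zy]|c _] := mvt xy (f' := fun=> 0) (f := f).
  by apply: h; rewrite (lt_le_trans ax xz) (le_lt_trans zy yb).
by rewrite mul0r => /eqP; rewrite subr_eq0 => /eqP.
Qed.

Lemma continuous_ball f x : {for x, continuous f} <->
  forall e, 0 < e -> exists2 r : R, 0 < r & forall y, `|y - x| < r -> `|f y - f x| < e.
Proof.
split=> [/cvgrPdist_lt h e /h /near_ball[r r0 H]|h].
  by exists r => // y /H; rewrite distrC.
apply/cvgrPdist_lt => e /h [r r0 H]; apply/near_ball; exists r => // y /H.
by rewrite distrC.
Qed.

Lemma continuous_near_neq f x c : {for x, continuous f} -> f x != c ->
  \forall y \near x, f y != c.
Proof.
move=> cf fx; have /continuous_ball/(_ `|f x - c|) := cf.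
rewrite normr_gt0 subr_eq0 => /(_ fx)[r r0 H]; apply/near_ball; exists r => // y /H.
by apply: contraTneq => ->; rewrite distrC ltxx.
Qed.

Lemma continuous_near_lt f x c : {for x, continuous f} -> f x < c ->
  \forall y \near x, f y < c.
Proof.
move=> cf fx; have /continuous_ball/(_ (c - f x)) := cf.
rewrite subr_gt0 => /(_ fx)[r r0 H]; apply/near_ball; exists r => // y /H.
by move=> h; have := ler_norm (f y - f x); lra.
Qed.

Lemma continuous_near_gt f x c : {for x, continuous f} -> c < f x ->
  \forall y \near x, c < f y.
Proof.
move=> cf fx; have /continuous_ball/(_ (f x - c)) := cf.
rewrite subr_gt0 => /(_ fx)[r r0 H]; apply/near_ball; exists r => // y /H.
by move=> h; have := ler_norm (f x - f y); rewrite distrC; lra.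
Qed.

Lemma near_lt x c : x < c -> \forall y \near x, y < c.
Proof. by move=> h; apply: (@continuous_near_lt id) => //; exact: cvg_id. Qed.

Lemma near_gt x c : c < x -> \forall y \near x, c < y.
Proof. by move=> h; apply: (@continuous_near_gt id) => //; exact: cvg_id. Qed.

(** ** Smooth germs *)

(** Order n stands for n+1 derivatives. Germs, rather than functions on an open
    set, make the calculus below blind to the junk values of functions that are
    meaningful off a discrete set only. *)
Fixpoint smooth_germ (n : nat) f x : Prop :=
  (\forall y \near x, derivable f y 1) /\
  if n is k.+1 then smooth_germ k (derive1 f) x else True.

Definition smooth_at f x := forall n, smooth_germ n f x.
Definition smooth f := forall x, smooth_at f x.

Lemma near_near x (P : R -> Prop) :
  (\forall y \near x, P y) -> \forall y \near x, \forall z \near y, P z.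
Proof. by move=> h; exact: near_join. Qed.

Lemma near_derive1 f g x :
  (\forall y \near x, f y = g y) -> \forall y \near x, (derive1 f) y = (derive1 g) y.
Proof.
move=> /near_near; apply: filterS => y h; rewrite !derive1E.
exact: near_eq_derive.
Qed.

Lemma smooth_germ_near n f g x : (\forall y \near x, g y = f y) ->
  smooth_germ n f x -> smooth_germ n g x.
Proof.
elim: n f g => [|n IH] f g fg [h1 h2]; split.
- have := near_near fg; apply: filterS2 h1 => y fy gf.
  have := der_near gf (derivable_der fy); exact: der_derivable.
- by [].
- have := near_near fg; apply: filterS2 h1 => y fy gf.
  have := der_near gf (derivable_der fy); exact: der_derivable.
- by apply: IH h2; exact: near_derive1.
Qed.

Lemma smooth_germ_derivable n f x : smooth_germ n f x -> \forall y \near x, derivable f y 1.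
Proof. by case: n => [|n] []. Qed.

Lemma smooth_germW n f x : smooth_germ n.+1 f x -> smooth_germ n f x.
Proof.
elim: n f => [|n IH] f [h1 h2]; split => //.
by apply: IH.
Qed.

(** The induction pattern of all closure properties: a derivative formula near
    the point reduces order n+1 to order n. *)
Lemma smooth_germS n f (f' : R -> R) x : (\forall y \near x, der f y (f' y)) ->
  smooth_germ n f' x -> smooth_germ n.+1 f x.
Proof.
move=> h hf; split; first by apply: filterS h => y; exact: der_derivable.
apply: smooth_germ_near hf; apply: filterS h => y; exact: der_derive1.
Qed.

Lemma smooth_germ_der n f x : smooth_germ n.+1 f x -> \forall y \near x, der f y ((derive1 f) y).
Proof. by case=> h _; apply: filterS h => y; exact: derivable_der. Qed.

Lemma smooth_germ_cst n c x : smooth_germ n (fun=> c) x.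
Proof.
elim: n c => [|n IH] c.
  by split=> //; near=> y; exact: der_derivable (der_cst c y).
by apply: (smooth_germS (f' := fun=> 0)) => //; near=> y; exact: der_cst.
Unshelve. all: by end_near. Qed.

Lemma smooth_germ_id n x : smooth_germ n (fun y => y) x.
Proof.
apply: smooth_germW; apply: (smooth_germS (f' := fun=> 1)).
  by near=> y; exact: der_id.
exact: smooth_germ_cst.
Unshelve. all: by end_near. Qed.

Lemma smooth_germD n f g x : smooth_germ n f x -> smooth_germ n g x ->
  smooth_germ n (fun y => f y + g y) x.
Proof.
elim: n f g => [|n IH] f g hf hg.
  split=> //; apply: filterS2 (hf.1) (hg.1) => y /derivable_der a /derivable_der b.
  exact: der_derivable (derD a b).
apply: (smooth_germS (f' := fun y => (derive1 f) y + (derive1 g) y)); last first.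
  by apply: IH; [case: hf|case: hg].
by apply: filterS2 (smooth_germ_der hf) (smooth_germ_der hg) => y; exact: derD.
Qed.

Lemma smooth_germM n f g x : smooth_germ n f x -> smooth_germ n g x ->
  smooth_germ n (fun y => f y * g y) x.
Proof.
elim: n f g => [|n IH] f g hf hg.
  split=> //; apply: filterS2 (hf.1) (hg.1) => y /derivable_der a /derivable_der b.
  exact: der_derivable (derM a b).
apply: (smooth_germS (f' := fun y => (derive1 f) y * g y + f y * (derive1 g) y)); last first.
  by apply: smooth_germD; apply: IH; (try exact: smooth_germW); [case: hf|case: hg].
by apply: filterS2 (smooth_germ_der hf) (smooth_germ_der hg) => y; exact: derM.
Qed.

Lemma smooth_germN n f x : smooth_germ n f x -> smooth_germ n (fun y => - f y) x.
Proof.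
move=> h; have := smooth_germM (smooth_germ_cst n (- 1) x) h.
by apply: smooth_germ_near; near=> y; rewrite mulN1r.
Unshelve. all: by end_near. Qed.

Lemma smooth_germB n f g x : smooth_germ n f x -> smooth_germ n g x ->
  smooth_germ n (fun y => f y - g y) x.
Proof. by move=> hf hg; apply: smooth_germD => //; exact: smooth_germN. Qed.

Lemma near_cont_comp f x (P : R -> Prop) : {for x, continuous f} ->
  (\forall y \near f x, P y) -> \forall y \near x, P (f y).
Proof. by move=> cf h; exact: (cf _ h). Qed.

Lemma smooth_germ_continuous n f x : smooth_germ n f x -> {for x, continuous f}.
Proof.
by move=> /smooth_germ_derivable /nbhs_singleton /derivable_continuous.
Qed.

Lemma smooth_germ_comp n f g x : smooth_germ n f (g x) -> smooth_germ n g x ->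
  smooth_germ n (fun y => f (g y)) x.
Proof.
elim: n f g => [|n IH] f g hf hg; have cg := smooth_germ_continuous hg.
  split=> //; have := near_cont_comp cg hf.1.
  apply: filterS2 (hg.1) => y /derivable_der a /derivable_der b.
  exact: der_derivable (der_comp b a).
apply: (smooth_germS (f' := fun y => (derive1 f) (g y) * (derive1 g) y)); last first.
  apply: smooth_germM; last by case: hg.
  by apply: IH; [case: hf|exact: smooth_germW].
have := near_cont_comp cg (smooth_germ_der hf).
by apply: filterS2 (smooth_germ_der hg) => y a b; exact: der_comp.
Qed.

Lemma smooth_germV n f x : f x != 0 -> smooth_germ n f x ->
  smooth_germ n (fun y => (f y)^-1) x.
Proof.
move=> f0 hf; elim: n hf => [|n IH] hf; have cf := smooth_germ_continuous hf;
  have f0' := continuous_near_neq cf f0.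
  split=> //; apply: filterS2 f0' (hf.1) => y y0 /derivable_der a.
  exact: der_derivable (derV y0 a).
have IHf : smooth_germ n (fun y => (f y)^-1) x by apply/IH/smooth_germW.
apply: (smooth_germS (f' := fun y => - (derive1 f) y * ((f y)^-1 * (f y)^-1))).
  apply: filterS2 f0' (smooth_germ_der hf) => y y0 a.
  by apply: der_eq; [exact: (derV y0 a)|rewrite expr2 invfM].
apply: smooth_germM; last exact: smooth_germM.
by apply: smooth_germN; case: hf.
Qed.

Lemma smooth_at_near f g x : (\forall y \near x, g y = f y) -> smooth_at f x -> smooth_at g x.
Proof. by move=> h s n; exact: smooth_germ_near h (s n). Qed.

Lemma smooth_at_cst c x : smooth_at (fun=> c) x.
Proof. by move=> n; exact: smooth_germ_cst. Qed.

Lemma smooth_at_id x : smooth_at (fun y => y) x.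
Proof. by move=> n; exact: smooth_germ_id. Qed.

Lemma smooth_atD f g x : smooth_at f x -> smooth_at g x -> smooth_at (fun y => f y + g y) x.
Proof. by move=> hf hg n; exact: smooth_germD. Qed.

Lemma smooth_atB f g x : smooth_at f x -> smooth_at g x -> smooth_at (fun y => f y - g y) x.
Proof. by move=> hf hg n; exact: smooth_germB. Qed.

Lemma smooth_atM f g x : smooth_at f x -> smooth_at g x -> smooth_at (fun y => f y * g y) x.
Proof. by move=> hf hg n; exact: smooth_germM. Qed.

Lemma smooth_atV f x : f x != 0 -> smooth_at f x -> smooth_at (fun y => (f y)^-1) x.
Proof. by move=> f0 hf n; exact: smooth_germV. Qed.

Lemma smooth_at_comp f g x : smooth_at f (g x) -> smooth_at g x -> smooth_at (fun y => f (g y)) x.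
Proof. by move=> hf hg n; exact: smooth_germ_comp. Qed.

Lemma smooth_at_affine c z s x : smooth_at (fun y => c + s * (y - z)) x.
Proof.
apply: smooth_atD; first exact: smooth_at_cst.
apply: smooth_atM; first exact: smooth_at_cst.
by apply: smooth_atB; [exact: smooth_at_id|exact: smooth_at_cst].
Qed.

Lemma smooth_at_derivable f x : smooth_at f x -> derivable f x 1.
Proof. by move=> /(_ 0%N) /smooth_germ_derivable /nbhs_singleton. Qed.

Lemma smooth_at_continuous f x : smooth_at f x -> {for x, continuous f}.
Proof. by move=> /smooth_at_derivable /derivable_continuous. Qed.

Lemma smooth_at_derive1 f x : smooth_at f x -> smooth_at (derive1 f) x.
Proof. by move=> h n; have [] := h n.+1. Qed.

Lemma smooth_derivable f x : smooth f -> derivable f x 1.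
Proof. by move=> h; exact: smooth_at_derivable. Qed.

Lemma smooth_derive1n f n : smooth f -> smooth f^`(n).
Proof.
by move=> h; elim: n => [|n IH] //= x; apply: smooth_at_derive1.
Qed.

Lemma smooth_at_der f f' x : (\forall y \near x, der f y (f' y)) -> smooth_at f' x -> smooth_at f x.
Proof. by move=> h s n; apply: smooth_germW; exact: smooth_germS h (s n). Qed.

End Calculus.
(** * Compactness and periodic functions *)

Section Compactness.
Context {R : realType}.
Implicit Types (f g : R -> R) (a b c x y z l e d r : R).

(** All uses of compactness below reduce to this form: radii that work locally
    can be chosen uniformly. *)
Lemma uniform_radius (P : R -> R -> Prop) a b :
  (forall r r' x, 0 < r' -> r' <= r -> P r x -> P r' x) ->
  (forall x, a <= x <= b -> exists2 r : R, 0 < r & forall y, `|y - x| < r -> P r y) ->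
  exists2 r : R, 0 < r & forall x, a <= x <= b -> P r x.
Proof.
move=> Pmono Ploc.
have /compact_near_coveringP := @segment_compact R a b.
move=> /(_ _ (0 : R)^'+ (fun r x => P r x) _); case.
  move=> x; rewrite /= in_itv/= => /Ploc[r r0 H].
  exists ([set y | `|y - x| < r], [set s | 0 < s <= r]).
    split=> /=; first by apply/near_ball; exists r.
    have h1 := @nbhs_right_gt R 0; have h2 := nbhs_right_le r0.
    by apply: filterS2 h1 h2 => s s0 sr; apply/andP; split.
  by move=> [y s] /= [yx /andP[s0 sr]]; apply: (Pmono r) => //; exact: H.
move=> r /= r0 H; exists (r / 2) => [|x xab]; first by rewrite divr_gt0.
apply: (H (r / 2)); rewrite /= ?divr_gt0 ?in_itv//= sub0r normrN gtr0_norm ?divr_gt0//.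
by rewrite ltr_pdivrMr// ltr_pMr// ltr1n.
Qed.

Lemma periodic_int f : (forall x, f (x + 1) = f x) -> forall x (k : int), f (x + k%:~R) = f x.
Proof.
move=> h x k.
have hn n y : f (y + n%:R) = f y.
  by elim: n y => [|n IH] y; rewrite ?addr0// -natr1 addrA h.
case: k => n; first exact: hn.
by rewrite NegzE mulrNz -(hn n.+1 (_ - _)) subrK.
Qed.

Lemma floor_shift a x : exists2 k : int, a <= x + k%:~R < a + 1 & True.
Proof.
exists (- Num.floor (x - a)) => //; rewrite mulrNz.
have /andP[h1 h2] := floor_itv (x - a).
by move: h2; rewrite intrD => h2; apply/andP; split; lra.
Qed.

Lemma periodic_radius (P : R -> R -> Prop) :
  (forall r r' x, 0 < r' -> r' <= r -> P r x -> P r' x) ->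
  (forall r x (k : int), P r (x + k%:~R) -> P r x) ->
  (forall x, exists2 r : R, 0 < r & forall y, `|y - x| < r -> P r y) ->
  exists2 r : R, 0 < r & forall x, P r x.
Proof.
move=> Pmono Pper Ploc.
have [|r r0 H] := @uniform_radius P 0 1 Pmono; first by move=> x _; exact: Ploc.
exists r => // x; have [k /andP[k0 k1] _] := floor_shift 0 x; apply: (Pper _ _ k); apply: H.
by rewrite k0/= ltW// (lt_le_trans k1)// add0r.
Qed.

Lemma periodic_unif f : continuous f -> (forall x, f (x + 1) = f x) ->
  forall e, 0 < e -> exists2 d : R, 0 < d & forall x y, `|y - x| < d -> `|f y - f x| < e.
Proof.
move=> cf fp e e0.
apply: (@periodic_radius (fun r x => forall y, `|y - x| < r -> `|f y - f x| < e)).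
- by move=> r r' x r'0 r'r h y yx; apply: h; exact: lt_le_trans r'r.
- move=> r x k h y yx.
  rewrite -(periodic_int fp x k) -(periodic_int fp y k); apply: h.
  by rewrite (_ : _ - _ = y - x)//; ring.
- move=> x; have e20 : 0 < e / 2 by rewrite divr_gt0.
  have /continuous_ball/(_ _ e20)[r r0 H] := cf x.
  exists (r / 2) => [|y yx z zy]; first by rewrite divr_gt0.
  have h1 : `|y - x| < r by rewrite (lt_trans yx)// ltr_pdivrMr// ltr_pMr// ltr1n.
  have h2 : `|z - x| < r.
    rewrite (_ : z - x = (z - y) + (y - x)); last by ring.
    by apply: le_lt_trans (ler_normD _ _) _; rewrite [ltRHS](splitr r) ltrD.
  have := H _ h1; have := H _ h2; rewrite (_ : f z - f y = (f z - f x) - (f y - f x)); last by ring.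
  move=> a b; apply: le_lt_trans (ler_normB _ _) _; by rewrite [ltRHS](splitr e) ltrD.
Qed.

Lemma segment_bounded f a b : continuous f ->
  exists2 C : R, 0 < C & forall x, a <= x <= b -> `|f x| <= C.
Proof.
move=> cf; have [r r' x _ r'r|x _|r r0 H] := @uniform_radius (fun r x => r * `|f x| <= 1) a b.
- by apply: le_trans; exact: ler_wpM2r.
- have /continuous_ball/(_ _ ltr01)[r r0 H] := cf x.
  have p0 : 0 < `|f x| + 1 by have := normr_ge0 (f x); lra.
  exists (Num.min r (`|f x| + 1)^-1) => [|y]; first by rewrite lt_min r0 invr_gt0.
  rewrite lt_min => /andP[/H yr _].
  apply: le_trans (_ : (`|f x| + 1)^-1 * (`|f x| + 1) <= 1); last by rewrite mulVf// gt_eqF.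
  apply: ler_pM => //.
  - by rewrite le_min (ltW r0) invr_ge0 ltW.
  - by rewrite ge_min lexx orbT.
  have := ler_normD (f y - f x) (f x); rewrite subrK; lra.
exists r^-1 => [|x xab]; first by rewrite invr_gt0.
by rewrite -[r^-1]mul1r ler_pdivlMr// mulrC; exact: H.
Qed.

Lemma periodic_bounded f : continuous f -> (forall x, f (x + 1) = f x) ->
  exists2 C : R, 0 < C & forall x, `|f x| <= C.
Proof.
move=> cf fp; have [C C0 H] := segment_bounded 0 1 cf.
exists C => // x; have [k /andP[k0 k1] _] := floor_shift 0 x.
by rewrite -(periodic_int fp x k); apply: H; rewrite k0 ltW// (lt_le_trans k1)// add0r.
Qed.

Lemma periodic_min f : continuous f -> (forall x, f (x + 1) = f x) -> (forall x, 0 < f x) ->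
  exists2 c : R, 0 < c & forall x, c <= f x.
Proof.
move=> cf fp f0.
have [x|x|C C0 H] := @periodic_bounded (fun x => (f x)^-1).
- by apply: cvgV; [rewrite gt_eqF|exact: cf].
- by rewrite fp.
exists C^-1 => [|x]; first by rewrite invr_gt0.
rewrite -[leRHS]invrK lef_pV2 ?posrE ?invr_gt0//; apply: le_trans (H x); exact: ler_norm.
Qed.

End Compactness.

(** * A smooth step function *)

Section SmoothStep.
Context {R : realType}.
Implicit Types (f g : R -> R) (a b c x y z l e d r : R).

Lemma der_of_quadratic f x l C :
  (forall y, `|f y - f x - l * (y - x)| <= C * (y - x) ^+ 2) -> der f x l.
Proof.
move=> h; have C0 : 0 <= C.
  have := le_trans (normr_ge0 _) (h (x + 1)).
  by rewrite (_ : (x + 1 - x) ^+ 2 = 1) ?mulr1//; ring.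
have lim : (fun h => h^-1 *: (((f \o shift x) (h *: 1)) - f x)) @ 0^' --> l.
  apply/cvgrPdist_lt => e e0; near=> t.
  have t0 : t != 0 by near: t; exact: nbhs_dnbhs_neq.
  rewrite /= /GRing.scale/= mulr1.
  rewrite (_ : l - t^-1 * (f (t + x) - f x) = - (t^-1 * (f (t + x) - f x - l * (t + x - x)))); last first.
    by field.
  rewrite normrN normrM; apply: le_lt_trans (_ : `|t^-1| * (C * t ^+ 2) < e).
    by rewrite ler_wpM2l//; have := h (t + x); rewrite addrK.
  have -> : `|t^-1| * (C * t ^+ 2) = C * `|t|.
    have -> : t ^+ 2 = `|t| * `|t| by rewrite -normrM -expr2 ger0_norm ?sqr_ge0.
    by rewrite normrV ?unitfE// mulrCA mulKf ?normr_eq0.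
  have : `|t| < e / (C + 1).
    near: t; apply/nbhs_dnbhs/near_ball; exists (e / (C + 1)); first by rewrite divr_gt0// ltr_wpDl.
    by move=> y; rewrite subr0.
  rewrite ltr_pdivlMr ?ltr_wpDl//; apply: le_lt_trans.
  by rewrite mulrC ler_wpM2l// lerDl.
apply: DeriveDef; first by apply/cvg_ex; exists l.
exact: cvg_lim.
Unshelve. all: by end_near. Qed.

(** As a family in k these functions are closed under differentiation, which
    makes the first one smooth at 0 by induction. *)
Definition flat (k : nat) x : R := if 0 < x then x^-1 ^+ k * expR (- x^-1) else 0.

Lemma flat_ge0 k x : 0 <= flat k x.
Proof.
rewrite /flat; case: ifP => // x0; apply: mulr_ge0; last exact: expR_ge0.
by rewrite exprn_ge0// invr_ge0 ltW.
Qed.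

Lemma flat_le_square k : exists C, forall x, flat k x <= C * x ^+ 2.
Proof.
pose n : R := k.+2%:R; have n0 : 0 < n by rewrite ltr0n.
exists (n ^+ k.+2) => x; rewrite /flat; case: ifP => x0; last first.
  by rewrite mulr_ge0 ?sqr_ge0// exprn_ge0// ltW.
have y0 : 0 < x^-1 by rewrite invr_gt0.
rewrite expRN ler_pdivrMr ?expR_gt0//.
have -> : expR x^-1 = expR (x^-1 / n) ^+ k.+2 by rewrite -expRM_natl; congr expR; field; rewrite !gt_eqF.
have h : (x^-1 / n) ^+ k.+2 <= expR (x^-1 / n) ^+ k.+2.
  have p : 0 <= x^-1 / n by rewrite divr_ge0// ltW.
  rewrite lerXn2r// ?nnegrE ?expR_ge0//.
  by apply: le_trans (expR_ge1Dx _); rewrite lerDr.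
apply: le_trans (ler_wpM2l _ h); last by rewrite mulr_ge0 ?exprn_ge0// ltW.
rewrite expr_div_n !exprS exprVn (_ : n * (n * n ^+ k) * (x * (x * x ^+ 0)) * (x^-1 * (x^-1 * (x ^+ k)^-1) / (n * (n * n ^+ k))) = (x ^+ k)^-1)//.
by rewrite expr0; field; rewrite !expf_neq0 ?gt_eqF.
Qed.

Lemma flat_der k x : der (flat k) x (flat k.+2 x - k%:R * flat k.+1 x).
Proof.
case: (ltgtP x 0) => x0.
- have -> : flat k.+2 x - k%:R * flat k.+1 x = 0 by rewrite /flat ltNge (ltW x0)/= mulr0 subr0.
  apply: (der_near (f := fun=> 0)); last exact: der_cst.
  have := near_lt x0; apply: filterS => y y0; by rewrite /flat ltNge (ltW y0).
- have xn0 : x != 0 by rewrite gt_eqF.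
  apply: (der_near (f := fun y => y^-1 ^+ k * expR (- y^-1))).
    have := near_gt x0; apply: filterS => y y0; by rewrite /flat y0.
  have dV : der (fun y => y^-1) x (- x^-1 ^+ 2).
    by apply: der_eq; [exact: (derV xn0 (der_id x))|rewrite mulN1r exprVn].
  have dX : der (fun y => y^-1 ^+ k) x (- (k%:R * x^-1 ^+ k.+1)).
    elim: k => [|k IH]; first by apply: der_eq; [exact: (der_cst 1 x)|rewrite mul0r oppr0].
    apply: (der_ext (f := fun y => y^-1 * y^-1 ^+ k)); first by move=> y; rewrite exprS.
    by apply: der_eq; [exact: (derM dV IH)|rewrite -[k.+1%:R]natr1 !exprS; ring].
  have dE : der (fun y => expR (- y^-1)) x (expR (- x^-1) * x^-1 ^+ 2).
    apply: der_eq.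
      apply: (@der_comp _ expR (fun y => - y^-1)); first exact: is_derive_expR.
      exact: derN dV.
    by rewrite opprK.
  by apply: der_eq; [exact: (derM dX dE)|rewrite /flat x0 !exprS; ring].
- rewrite x0 /flat ltxx mulr0 subr0.
  have [C HC] := flat_le_square k.
  apply: (@der_of_quadratic _ _ _ C) => y.
  by rewrite ltxx !subr0 mul0r subr0 -/(flat k y) ger0_norm ?flat_ge0//; exact: HC.
Qed.

Lemma flat_smooth k : smooth (flat k).
Proof.
move=> x n; elim: n k => [|n IH] k.
  by split=> //; near=> y; exact: der_derivable (flat_der k y).
apply: (smooth_germS (f' := fun y => flat k.+2 y - k%:R * flat k.+1 y)).
  by near=> y; exact: flat_der.
apply: smooth_germB => //; apply: smooth_germM => //; exact: smooth_germ_cst.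
Unshelve. all: by end_near. Qed.

Definition step x : R := flat 0 x / (flat 0 x + flat 0 (1 - x)).

Let flat_gt0 x : 0 < x -> 0 < flat 0 x.
Proof. by move=> x0; rewrite /flat x0 expr0 mul1r expR_gt0. Qed.

Let step_den x : 0 < flat 0 x + flat 0 (1 - x).
Proof.
case: (ltP 0 x) => x0; first by rewrite ltr_pwDl ?flat_gt0 ?flat_ge0.
by rewrite ltr_wpDl ?flat_ge0 ?flat_gt0//; lra.
Qed.

Let smooth_flat_sub : smooth (fun x => flat 0 (1 - x)).
Proof.
move=> x; apply: smooth_at_comp; first exact: flat_smooth.
by apply: smooth_atB; [exact: smooth_at_cst|exact: smooth_at_id].
Qed.

Lemma step_smooth : smooth step.
Proof.
move=> x; apply: smooth_atM; first exact: flat_smooth.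
apply: smooth_atV; first by rewrite gt_eqF.
by apply: smooth_atD; [exact: flat_smooth|exact: smooth_flat_sub].
Qed.

Lemma step0 x : x <= 0 -> step x = 0.
Proof. by move=> x0; rewrite /step {1}/flat ltNge x0/= mul0r. Qed.

Lemma step1 x : 1 <= x -> step x = 1.
Proof.
move=> x1; rewrite /step {3}/flat ifF ?addr0 ?divff ?gt_eqF ?flat_gt0//; first by lra.
by apply/negP; lra.
Qed.

Lemma step_ge0 x : 0 <= step x.
Proof. by rewrite divr_ge0 ?flat_ge0// ltW. Qed.

Lemma step_le1 x : step x <= 1.
Proof. by rewrite ler_pdivrMr// mul1r lerDl flat_ge0. Qed.

Lemma step_der x : der step x (derive1 step x).
Proof. by apply/derivable_der/smooth_derivable/step_smooth. Qed.

Lemma step_derive_ge0 x : 0 <= derive1 step x.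
Proof.
have d0 : der (flat 0) x (flat 2 x).
  by apply: der_eq; [exact: flat_der|rewrite mul0r subr0].
have d1 : der (fun y => flat 0 (1 - y)) x (- flat 2 (1 - x)).
  apply: der_eq.
    apply: (@der_comp _ (flat 0) (fun y => 1 - y)); first exact: flat_der.
    apply: derB; [exact: der_cst|exact: der_id].
  by ring.
have D := step_den x.
rewrite (der_derive1 (derM d0 (derV (f := fun y => flat 0 y + flat 0 (1 - y)) (lt0r_neq0 D) (derD d0 d1)))).
have -> (u v p s : R) : u + v != 0 -> p * (u + v)^-1 + u * (- (p - s) / (u + v) ^+ 2) = (p * v + u * s) / (u + v) ^+ 2.
  by move=> h; field.
  rewrite divr_ge0 ?sqr_ge0// addr_ge0// mulr_ge0 ?flat_ge0//.
by rewrite gt_eqF.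
Qed.

Lemma step_derive_out x : x < 0 \/ 1 < x -> derive1 step x = 0.
Proof.
case=> h; apply: der_derive1.
- apply: (der_near (f := fun=> 0)); last exact: der_cst.
  by have := near_lt h; apply: filterS => y /ltW/step0.
- apply: (der_near (f := fun=> 1)); last exact: der_cst.
  by have := near_gt h; apply: filterS => y /ltW/step1.
Qed.

Lemma step_derive_bounded : exists2 C : R, 0 < C & forall x, `|derive1 step x| <= C.
Proof.
have cs : continuous (derive1 step).
  by move=> x; apply: smooth_at_continuous; exact/smooth_at_derive1/step_smooth.
have [C C0 H] := segment_bounded (-1) 2 cs.
exists C => // x; case: (boolP (-1 <= x <= 2)) => [/H//|h].
rewrite step_derive_out ?normr0 ?(ltW C0)//.
by move: h; rewrite negb_and -!ltNge => /orP[] ?; [left|right]; lra.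
Qed.

(** To be applied to the square of a distance, which is smooth where the
    distance is not. *)
Definition bump w : R := 1 - step (4 * w - 1).

Lemma bump1 w : w <= 4^-1 -> bump w = 1.
Proof. by move=> h; rewrite /bump step0 ?subr0//; lra. Qed.
Lemma bump0 w : 2^-1 <= w -> bump w = 0.
Proof. by move=> h; rewrite /bump step1 ?subrr//; lra. Qed.
Lemma bump_ge0 w : 0 <= bump w.
Proof. by rewrite subr_ge0 step_le1. Qed.
Lemma bump_le1 w : bump w <= 1.
Proof. by rewrite lerBlDr lerDl step_ge0. Qed.
Lemma bump_smooth : smooth bump.
Proof.
move=> x; apply: smooth_atB; first exact: smooth_at_cst.
apply: smooth_at_comp; first exact: step_smooth.
apply: smooth_atB; last exact: smooth_at_cst.
by apply: smooth_atM; [exact: smooth_at_cst|exact: smooth_at_id].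
Qed.
Lemma bump_der w : der bump w (derive1 bump w).
Proof. by apply/derivable_der/smooth_derivable/bump_smooth. Qed.
Lemma bump_derive w : derive1 bump w = - (4 * derive1 step (4 * w - 1)).
Proof.
apply: der_derive1; apply: der_eq.
  apply: derB; first exact: der_cst.
  apply: (@der_comp _ step (fun w => 4 * w - 1)); first exact: step_der.
  apply: derB; last exact: der_cst.
  exact: (derZ 4 (der_id w)).
by ring.
Qed.
Lemma bump_derive_le0 w : derive1 bump w <= 0.
Proof. by rewrite bump_derive oppr_le0 mulr_ge0// step_derive_ge0. Qed.
Lemma bump_derive_bounded : exists2 C : R, 0 < C & forall x, `|derive1 bump x| <= C.
Proof.
have [C C0 H] := step_derive_bounded; exists (4 * C) => [|x]; first by rewrite mulr_gt0.
by rewrite bump_derive normrN normrM ler_pM// ger0_norm.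
Qed.

End SmoothStep.
(** * Lifts of circle diffeomorphisms *)

Section Lifts.
Context {R : realType}.
Implicit Types (f g F G : R -> R) (a b c x y z l e d r : R).

(** Lift to the line of a C^1 diffeomorphism of the circle; e = 1 or -1 is its
    orientation. *)
Record lift e F : Prop := Lift {
  lift_sgn : e = 1 \/ e = - 1 ;
  lift_add1 : forall x, F (x + 1) = F x + e ;
  lift_derivable : forall x, derivable F x 1 ;
  lift_derive_cont : continuous (derive1 F) ;
  lift_derive_gt0 : forall x, 0 < e * derive1 F x }.

Lemma lift_der e F x : lift e F -> der F x (derive1 F x).
Proof. by move=> hF; exact/derivable_der/(lift_derivable hF). Qed.

Lemma lift_cont e F : lift e F -> continuous F.
Proof. by move=> hF x; exact/derivable_continuous/(lift_derivable hF). Qed.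

Lemma lift_sgn_sq e F : lift e F -> e * e = 1.
Proof. by case/lift_sgn => ->; rewrite ?mulr1// mulrNN mulr1. Qed.

Lemma lift_derive_neq0 e F x : lift e F -> derive1 F x != 0.
Proof. by move=> hF; have := lift_derive_gt0 hF x; apply: contraTneq => ->; rewrite mulr0 ltxx. Qed.

Lemma lift_addint e F x (k : int) : lift e F -> F (x + k%:~R) = F x + e * k%:~R.
Proof.
move=> hF; have := periodic_int (f := fun x => F x - e * x) _ x k => /= h.
have := h; rewrite mulrDr => /(_ _) h'.
suff H : F (x + k%:~R) - (e * x + e * k%:~R) = F x - e * x by lra.
by apply: h' => y; rewrite (lift_add1 hF); ring.
Qed.

Lemma lift_derive_add1 e F x : lift e F -> derive1 F (x + 1) = derive1 F x.
Proof.
move=> hF.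
have h1 := der_shift (lift_der (x + 1) hF).
have h2 : der (fun y => F (y + 1)) x (derive1 F x).
  apply: (der_ext (f := fun y => F y + e)); first by move=> y; rewrite (lift_add1 hF).
  by apply: der_eq; [exact: (derD (lift_der x hF) (der_cst e x))|rewrite addr0].
by rewrite -(der_derive1 h1) (der_derive1 h2).
Qed.

Lemma lift_mvt e F x y : lift e F ->
  exists2 c, (x <= c <= y) \/ (y <= c <= x) & F y - F x = derive1 F c * (y - x).
Proof. by move=> hF; apply: mvt_between => z _; exact: lift_der hF. Qed.

Lemma lift_lt e F x y : lift e F -> x < y -> 0 < e * (F y - F x).
Proof.
move=> hF xy; have [c _ ->] := lift_mvt x y hF.
by rewrite mulrA mulr_gt0 ?subr_gt0// (lift_derive_gt0 hF).
Qed.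

Lemma lift_ltE e F x y : lift e F -> (0 < e * (F y - F x)) = (x < y).
Proof.
move=> hF; case: (ltgtP x y) => [xy|yx|->]; first exact: lift_lt hF xy.
  have := lift_lt hF yx; move=> h; apply/negbTE; rewrite -leNgt; lra.
by rewrite subrr mulr0 ltxx.
Qed.

Lemma lift_inj e F : lift e F -> injective F.
Proof.
move=> hF x y Fxy; case: (ltgtP x y) => // /(lift_lt hF); rewrite Fxy subrr mulr0 ltxx//.
Qed.

Lemma lift1_lt F x y : lift 1 F -> (F x < F y) = (x < y).
Proof. by move=> hF; rewrite -(lift_ltE x y hF) mul1r subr_gt0. Qed.

Lemma lift1_le F x y : lift 1 F -> (F x <= F y) = (x <= y).
Proof. by move=> hF; rewrite leNgt (lift1_lt _ _ hF) -leNgt. Qed.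

Lemma lift_surj e F y : lift e F -> exists x, F x = y.
Proof.
move=> hF; have hF0 (k : int) : F k%:~R = F 0 + e * k%:~R by rewrite -{1}[k%:~R]add0r (lift_addint _ _ hF).
have [k /andP[k1 k2] _] := floor_shift (F 0) y.
have eZ : exists2 s : int, e = s%:~R & s * s = 1.
  by case: (lift_sgn hF) => ->; [exists 1|exists (-1)]; rewrite // mulrNz.
case: eZ => s es ss.
have h1 : F (- s * k)%:~R = F 0 - k%:~R.
  by rewrite hF0 es -intrM mulrA mulrN ss mulN1r mulrNz.
have h2 : F (s * (1 - k))%:~R = F 0 + 1 - k%:~R.
  by rewrite hF0 es -intrM mulrA ss mul1r intrD mulrNz addrA.
set u : R := (- s * k)%:~R in h1; set v : R := (s * (1 - k))%:~R in h2.
case: (leP u v) => uv.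
  have [||c _ e'] := @ivt _ F u v y uv; last by exists c.
    by move=> x _; exact: lift_cont hF x.
  by left; rewrite h1 h2; apply/andP; split; lra.
have [||c _ e'] := @ivt _ F v u y (ltW uv); last by exists c.
  by move=> x _; exact: lift_cont hF x.
by right; rewrite h1 h2; apply/andP; split; lra.
Qed.

Lemma lift_comp e e' F G : lift e F -> lift e' G -> lift (e * e') (fun x => F (G x)).
Proof.
move=> hF hG.
have D x : der (fun x => F (G x)) x (derive1 F (G x) * derive1 G x).
  by apply: der_comp; [exact: lift_der hF|exact: lift_der hG].
have DE : derive1 (fun x => F (G x)) = (fun x => derive1 F (G x) * derive1 G x).
  by apply/funext => x; exact: der_derive1.
split.
- case: (lift_sgn hF) (lift_sgn hG) => -> [] ->; rewrite ?mul1r ?mulr1; [by left|by right|by right|].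
  by left; rewrite mulrNN mulr1.
- move=> x; rewrite (lift_add1 hG); case: (lift_sgn hG) => ->.
    by rewrite (lift_add1 hF) mulr1.
  have := lift_add1 hF (G x - 1); rewrite subrK => ->; ring.
- by move=> x; exact: der_derivable (D x).
- rewrite DE => x; apply: cvgM; last exact: lift_derive_cont hG x.
  by apply: continuous_comp; [exact: lift_cont hG x|exact: lift_derive_cont hF _].
- move=> x; rewrite DE (_ : _ * _ = (e * derive1 F (G x)) * (e' * derive1 G x)); last by ring.
  by rewrite mulr_gt0 ?(lift_derive_gt0 hF) ?(lift_derive_gt0 hG).
Qed.

Lemma lift_id : lift 1 (fun x => x).
Proof.
have D : derive1 (fun x : R => x) = fun=> 1 by apply/funext => x; exact/der_derive1/der_id.
split.
- by left.
- by [].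
- by move=> x; exact: (der_derivable (der_id x)).
- by rewrite D => x; exact: cvg_cst.
- by move=> x; rewrite D mulr1.
Qed.

Lemma lift_addc e F c : lift e F -> lift e (fun x => F x + c).
Proof.
move=> hF.
have D x : der (fun x => F x + c) x (derive1 F x).
  by apply: der_eq; [exact: (derD (lift_der x hF) (der_cst c x))|rewrite addr0].
have DE : derive1 (fun x => F x + c) = derive1 F by apply/funext => x; exact: der_derive1.
split; first exact: lift_sgn hF.
- by move=> x; rewrite (lift_add1 hF); ring.
- by move=> x; exact: der_derivable (D x).
- by rewrite DE; exact: lift_derive_cont hF.
- by move=> x; rewrite DE (lift_derive_gt0 hF).
Qed.

Lemma lift_iter e F n : lift e F -> lift (e ^+ n) (iter n F).
Proof.
move=> hF; elim: n => [|n IH]; first by rewrite expr0; exact: lift_id.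
by rewrite exprS; exact: lift_comp hF IH.
Qed.

Lemma derive_iterS e F n x : lift e F ->
  derive1 (iter n.+1 F) x = derive1 F (iter n F x) * derive1 (iter n F) x.
Proof.
move=> hF; apply: der_derive1.
apply: (@der_comp _ F (iter n F)); first exact: lift_der hF.
exact: lift_der (lift_iter n hF).
Qed.

Lemma derive_iterSr e F n x : lift e F ->
  derive1 (iter n.+1 F) x = derive1 (iter n F) (F x) * derive1 F x.
Proof.
move=> hF; apply: der_derive1; apply: (der_ext (f := fun x => iter n F (F x))).
  by move=> y; rewrite iterSr.
apply: (@der_comp _ (iter n F) F); first exact: lift_der (lift_iter n hF).
exact: lift_der hF.
Qed.

Lemma derive_iter_prod e F n x : lift e F ->
  derive1 (iter n F) x = \prod_(i < n) derive1 F (iter i F x).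
Proof.
move=> hF; elim: n => [|n IH]; first by rewrite big_ord0; exact/der_derive1/der_id.
by rewrite (derive_iterS _ _ hF) big_ord_recr/= IH mulrC.
Qed.

Lemma lift_derive_bounded e F : lift e F -> exists2 K, 1 <= K & forall x, `|derive1 F x| <= K.
Proof.
move=> hF; have [C C0 H] := periodic_bounded (lift_derive_cont hF) (fun x => lift_derive_add1 x hF).
by exists (C + 1) => [|x]; [rewrite lerDr ltW|rewrite (le_trans (H x))// lerDl].
Qed.

Lemma lift_lip e F K : lift e F -> (forall x, `|derive1 F x| <= K) ->
  forall x y, `|F y - F x| <= K * `|y - x|.
Proof.
move=> hF HK x y; have [c _ ->] := lift_mvt x y hF.
by rewrite normrM ler_wpM2r.
Qed.

Lemma lift_iter_lip e F K n : lift e F -> 1 <= K -> (forall x, `|derive1 F x| <= K) ->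
  forall x y, `|iter n F y - iter n F x| <= K ^+ n * `|y - x|.
Proof.
move=> hF K1 HK x y; elim: n => [|n IH]; first by rewrite expr0 mul1r.
apply: le_trans (lift_lip hF HK _ _) _.
by rewrite exprS -mulrA ler_wpM2l// (le_trans ler01).
Qed.

Lemma lift_inverse e F : lift e F -> exists2 G, lift e G & forall x, F (G x) = x /\ G (F x) = x.
Proof.
move=> hF; pose G y := xget 0 [set x | F x = y].
have FG y : F (G y) = y by apply: (xgetPex 0 (lift_surj y hF)).
have GF x : G (F x) = x by apply: (lift_inj hF); exact: FG.
have ee := lift_sgn_sq hF.
have D y : der G y (derive1 F (G y))^-1.
  rewrite -{1}[y]FG; apply: der_inverse.
  - by near=> z; exact: GF.
  - by near=> z; exact: lift_cont hF z.
  - exact: lift_der hF.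
  - exact: lift_derive_neq0 hF.
have cG y : {for y, continuous G} := der_continuous (D y).
have DE : derive1 G = fun y => (derive1 F (G y))^-1.
  by apply/funext => x; exact: der_derive1.
exists G => //; split.
- exact: lift_sgn hF.
- move=> x; apply: (lift_inj hF); rewrite FG; case: (lift_sgn hF) => ee1; rewrite {1}ee1.
    by rewrite (lift_add1 hF) FG ee1.
  by have := lift_add1 hF (G x - 1); rewrite subrK FG ee1 => h; lra.
- by move=> x; exact: der_derivable (D x).
- rewrite DE => y; apply: cvgV; first exact: lift_derive_neq0 hF.
  by apply: continuous_comp; [exact: cG|exact: lift_derive_cont hF _].
- move=> x; rewrite DE; have := lift_derive_gt0 hF (G x).
  have e1 : e = e^-1 by rewrite -[RHS]mulr1 -ee mulKf//; apply/eqP => e0; move: ee; rewrite e0 mul0r => /esym/eqP; rewrite oner_eq0.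
  by rewrite {2}e1 -invfM invr_gt0 mulrC.
Unshelve. all: by end_near. Qed.

Lemma lift1_iter_int F n x (k : int) : lift 1 F -> iter n F (x + k%:~R) = iter n F x + k%:~R.
Proof. by move=> hF; rewrite (lift_addint _ _ (lift_iter n hF)) expr1n mul1r. Qed.

Lemma lift1_iter_mul F q (m : int) n x : lift 1 F -> iter q F x = x + m%:~R ->
  iter (q * n) F x = x + (m *+ n)%:~R.
Proof.
move=> hF hx; elim: n => [|n IH]; first by rewrite muln0 mulr0n addr0.
by rewrite mulnS iterD IH (lift1_iter_int _ _ _ hF) hx mulrS intrD addrA.
Qed.

(** If F^j also fixes x up to k, then comparing F^(jq) computed in both ways
    gives k q = m j. *)
Lemma lift1_period_dvd F q (m : int) j (k : int) x : lift 1 F -> coprime q `|m|%N ->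
  iter q F x = x + m%:~R -> iter j F x = x + k%:~R -> (q %| j)%N.
Proof.
move=> hF cop hq hj.
have e2 : k *+ q = m *+ j.
  apply: (@intr_inj R); apply: (addrI x).
  by rewrite -(lift1_iter_mul _ hF hq) -(lift1_iter_mul _ hF hj) mulnC.
have e3 : k * q%:Z = m * j%:Z by rewrite -!natz !mulr_natr.
rewrite -(Gauss_dvdr j cop); have := f_equal absz e3; rewrite !abszM /= => <-.
exact: dvdn_mull.
Qed.

End Lifts.

(** * From lifts to the circle *)

Section CircleLifts.
Context {R : realType}.
Implicit Types (F G : R -> R) (a b c x y z l e d r : R).
Local Notation S1 := (circle R).

Lemma proj_eq a b : proj a = proj b <-> exists k : int, a = b + k%:~R.
Proof.
split=> [/projP/intrP[k h]|[k ->]]; first by exists k; rewrite -h; ring.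
by apply/projP; rewrite addrAC subrr add0r intr_int.
Qed.

Lemma proj_int a (k : int) : proj (a + k%:~R) = proj a.
Proof. by apply/proj_eq; exists k. Qed.

Lemma proj1 a : proj (a + 1) = proj a.
Proof. exact: (proj_int a 1). Qed.

Lemma repr_proj a : exists k : int, repr (proj a) = a + k%:~R.
Proof. by apply/proj_eq; exact: proj_repr. Qed.

Lemma proj_ind (P : S1 -> Prop) : (forall a, P (proj a)) -> forall p : S1, P p.
Proof. by move=> h p; rewrite -(proj_repr p). Qed.

Lemma lift_descend e F : lift e F -> forall a, proj (F (repr (proj a))) = proj (F a).
Proof.
move=> hF a; have [k ->] := repr_proj a; rewrite (lift_addint _ _ hF).
case: (lift_sgn hF) => ->; first by rewrite mul1r proj_int.
by rewrite mulN1r -mulrNz proj_int.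
Qed.

Lemma lift_is_C1_lift e F (f : S1 -> S1) : lift e F -> (forall a, f (proj a) = proj (F a)) ->
  is_C1_lift f F.
Proof. by move=> hF h; split => //; [exact: lift_derivable hF|exact: lift_derive_cont hF]. Qed.

Lemma diff_of_lift e F : lift e F -> exists f : diff1 R, is_C1_lift f F.
Proof.
move=> hF; have [G hG FG] := lift_inverse hF.
pose f (x : S1) := proj (F (repr x)); pose g (x : S1) := proj (G (repr x)).
have fE a : f (proj a) = proj (F a) by exact: lift_descend hF a.
have gE a : g (proj a) = proj (G a) by exact: lift_descend hG a.
have fg : cancel f g by apply: proj_ind => a; rewrite fE gE (FG a).2.
have gf : cancel g f by apply: proj_ind => a; rewrite gE fE (FG a).1.
exists (@Diff1 R f g fg gf (ex_intro _ F (lift_is_C1_lift hF fE)) (ex_intro _ G (lift_is_C1_lift hG gE))).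
exact: lift_is_C1_lift hF fE.
Qed.

(** The derivative of a C^1 map of the circle does not depend on the lift, so
    that F (x + 1) - F x is constant. *)
Lemma C1_lift_int (f : S1 -> S1) F : is_C1_lift f F -> exists k : int, forall x, F (x + 1) = F x + k%:~R.
Proof.
move=> hF; have [fE dF _] := hF.
have D x : der (fun x => F (x + 1) - F x) x 0.
  apply: der_eq.
    apply: derB; last exact: derivable_der (dF x).
    exact: der_shift (derivable_der (dF (x + 1))).
  by rewrite -!(cderiveE _ hF) proj1 subrr.
have [k hk] : exists k : int, F (0 + 1) = F 0 + k%:~R by apply/proj_eq; rewrite -!fE proj1.
exists k => x.
have := @der0_cst _ (fun x => F (x + 1) - F x) (- (`|x| + 1)) (`|x| + 1) (fun y _ => D y) x 0.
have := ler_norm x; have := ler_norm (- x); rewrite normrN => h1 h2.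
move=> /(_ _ _) h; have : F (x + 1) - F x = F (0 + 1) - F 0.
  by apply: h; apply/andP; split; have := normr_ge0 x; lra.
by rewrite hk => h'; lra.
Qed.

Lemma intr_sgn (k : int) : k = 1 \/ k = -1 -> (k%:~R : R) = 1 \/ (k%:~R : R) = -1.
Proof. by case=> ->; [left|right; rewrite mulrNz]. Qed.

(** If G lifts the inverse of f, then G \o F lifts the identity, so the degrees of
    F and G are inverse to each other and F' does not vanish. *)
Lemma lift_of_diff (f : diff1 R) : exists e F, lift e F /\ is_C1_lift f F.
Proof.
have [F hF] := diff_fun_C1 f; have [G hG] := diff_inv_C1 f.
have [fE dF cF] := hF; have [gE dG cG] := hG.
have GF : is_C1_lift id (G \o F).
  have -> : id = diff_inv f \o f by apply/funext => p; rewrite /= diff_funK.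
  split.
  - by move=> a; rewrite /= fE gE.
  - move=> a; apply: der_derivable.
    exact: (der_comp (derivable_der (dG (F a))) (derivable_der (dF a))).
  - rewrite (_ : derive1 _ = fun x => derive1 G (F x) * derive1 F x).
      move=> x; apply: cvgM; last exact: cF.
      by apply: continuous_comp; [exact: derivable_continuous (dF x)|exact: cG].
    apply/funext => x; apply: der_derive1.
    exact: (der_comp (derivable_der (dG (F x))) (derivable_der (dF x))).
have idl : is_C1_lift id (fun x : R => x).
  by apply: (lift_is_C1_lift lift_id).
have D x : derive1 G (F x) * derive1 F x = 1.
  have := cderiveE x GF; rewrite (cderiveE x idl) => h.
  rewrite -(der_derive1 (der_comp (derivable_der (dG (F x))) (derivable_der (dF x)))).
  by rewrite -[LHS]h; exact/der_derive1/der_id.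
have F0 x : derive1 F x != 0.
  by apply/eqP => h; have := D x; rewrite h mulr0 => /esym/eqP; rewrite oner_eq0.
have [k hk] := C1_lift_int hF; have [k' hk'] := C1_lift_int hG.
have kk : k * k' = 1.
  have [c hc] := C1_lift_int GF.
  have hGn x (n : int) : G (x + n%:~R) = G x + k'%:~R * n%:~R.
    have := periodic_int (f := fun x => G x - k'%:~R * x) _ x n => /= h.
    suff : G (x + n%:~R) - k'%:~R * (x + n%:~R) = G x - k'%:~R * x by lra.
    by apply: h => y; rewrite hk'; ring.
  have c1 : c = 1.
    have [_ h1 _] := GF.
    have [z zz hz] := @mvt _ (G \o F) (derive1 (G \o F)) 0 1 ler01 (fun x _ => derivable_der (h1 x)).
    have h2 := cderiveE z GF; rewrite (cderiveE z idl) in h2.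
    move: hz; rewrite -h2 (der_derive1 (der_id z)) subr0 mulr1.
    have := hc 0; rewrite add0r => -> h3.
    have : (c%:~R : R) = 1 by lra.
    exact: (@intr_inj R c 1).
  have := hc 0; rewrite /= hk hGn c1 => h.
  by apply/eqP; rewrite -(eqr_int R) intrM mulrC; apply/eqP; lra.
have [z zz hz] := @mvt _ F (derive1 F) 0 1 ler01 (fun x _ => derivable_der (dF x)).
have kz : k%:~R = derive1 F z.
  by move: hz; rewrite subr0 mulr1 => <-; have := hk 0; rewrite add0r => ->; ring.
have ks : k = 1 \/ k = -1.
  have := f_equal absz kk; rewrite abszM => /eqP; rewrite muln_eq1 => /andP[/eqP ak _].
  by clear -ak; lia.
exists k%:~R, F; split; [split|exact: hF].
- exact: intr_sgn ks.
- exact: hk.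
- exact: dF.
- exact: cF.
- move=> x; rewrite ltNge; apply/negP => h.
  have p0 : 0 < (k%:~R : R) * derive1 F z.
    by rewrite -kz -intrM ltr0z; case: ks => ->.
  have kn0 : (k%:~R : R) != 0 by rewrite intr_eq0; case: ks => ->.
  have cc : continuous (fun x => (k%:~R : R) * derive1 F x).
    by move=> y; apply: cvgM; [exact: cvg_cst|exact: cF].
  suff [y hy] : exists y, (k%:~R : R) * derive1 F y = 0.
    by move/eqP: hy; rewrite mulf_eq0 (negbTE kn0) (negbTE (F0 y)).
  case: (leP x z) => xz.
    have [||y _ e'] := @ivt _ (fun x => (k%:~R : R) * derive1 F x) x z 0 xz; last by exists y.
      by move=> y _; exact: cc.
    by left; rewrite h ltW.
  have [||y _ e'] := @ivt _ (fun x => (k%:~R : R) * derive1 F x) z x 0 (ltW xz); last by exists y.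
    by move=> y _; exact: cc.
  by right; rewrite h ltW.
Qed.

Lemma diff_ball_lifts (f g : diff1 R) F G d : is_C1_lift f F -> is_C1_lift g G ->
  (forall x, `|F x - G x| < d /\ `|derive1 F x - derive1 G x| < d) -> diff_ball f d g.
Proof.
move=> hF hG h; apply: proj_ind => a; have [h1 h2] := h a; split.
  have [-> _ _] := hF; have [-> _ _] := hG.
  by exists (F a), (G a).
by rewrite (cderiveE _ hF) (cderiveE _ hG).
Qed.

Lemma C1_lift_iter (f : diff1 R) e F n : lift e F -> is_C1_lift f F -> is_C1_lift (iter n f) (iter n F).
Proof.
move=> hF [fE _ _]; apply: lift_is_C1_lift (lift_iter n hF) _ => a.
by elim: n => //= n ->.
Qed.

End CircleLifts.
(** * Flows in the coordinate of a clock *)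

Section Flow.
Context {R : realType}.
Implicit Types (F G : R -> R) (a b c w x y z l e d r s t v : R).
Context (jump X T : R -> R).

(** A vector field X with simple linear zeros, together with a time function T,
    a primitive of 1/X off the zeros. The flow is then translation by t in the
    coordinate T, which avoids solving a differential equation. [jump] prescribes the
    difference of the constants in the logarithmic expansions of T on the two
    sides of a zero of slope l. *)
Record clock : Prop := Clock {
  clock_smooth : smooth X ;
  clock_X1 : forall x, X (x + 1) = X x ;
  clock_T1 : forall x, T (x + 1) = T x ;
  clock_zero : exists z, X z = 0 ;
  clock_der : forall x, X x != 0 -> der T x (X x)^-1 ;
  clock_germ : forall z, X z = 0 -> exists l c r, [/\ l != 0, 0 < r &
    forall x, 0 < `|x - z| < r -> X x = l * (x - z) /\
      T x = ln `|x - z| / l + c + (if z < x then jump l else 0)] }.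

Context (hC : clock).

Definition same_arc x y := forall w, (x <= w <= y) \/ (y <= w <= x) -> X w != 0.

Lemma same_arc_refl x : X x != 0 -> same_arc x x.
Proof.
move=> h w hw; have -> // : w = x; apply/eqP; rewrite eq_le.
by case: hw => /andP[-> ->].
Qed.

Lemma same_arc_sym x y : same_arc x y -> same_arc y x.
Proof. by move=> h w hw; apply: h; case: hw; [right|left]. Qed.

Lemma same_arc_trans x y z : same_arc x y -> same_arc y z -> same_arc x z.
Proof.
move=> hxy hyz w hw; case: (leP y w) => yw; case: (leP x w) => xw.
- case: hw => /andP[h1 h2]; first by apply: hyz; left; rewrite yw.
  by apply: hxy; right; rewrite yw (le_trans h2).
- by apply: hxy; right; rewrite yw ltW.
- by apply: hxy; left; rewrite xw ltW.
- case: hw => /andP[h1 h2]; last by apply: hyz; right; rewrite h1 ltW.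
  by move: xw; rewrite ltNge h1.
Qed.

Lemma same_arcl x y : same_arc x y -> X x != 0.
Proof. by apply; case: (leP x y) => h; [left|right]; rewrite lexx ?h// ltW. Qed.

Lemma same_arcr x y : same_arc x y -> X y != 0.
Proof. by move/same_arc_sym/same_arcl. Qed.

Lemma clock_cont : continuous X.
Proof. by move=> x; exact: smooth_at_continuous (clock_smooth hC x). Qed.

Lemma same_arc_near x : X x != 0 -> exists2 r : R, 0 < r & forall y, `|y - x| < r -> same_arc x y.
Proof.
move=> h; have := continuous_near_neq (@clock_cont x) h => /near_ball[r r0 H].
by exists r => // y yx w /between_dist hw; apply: H; exact: le_lt_trans yx.
Qed.

Lemma same_arc_sgn x y : same_arc x y -> 0 < X x * X y.
Proof.
move=> h; rewrite ltNge; apply/negP => h0.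
have cf z : {for z, continuous X} by exact: clock_cont.
have : (X x <= 0 <= X y) \/ (X y <= 0 <= X x).
  by case: (leP (X x) 0) => hx; [left|right]; have := same_arcl h; have := same_arcr h => /eqP ? /eqP ?; nra.
move=> hxy; case: (leP x y) => xy.
  have [w hw w0] := ivt xy (fun z _ => cf z) hxy.
  by have := h w (or_introl hw); rewrite w0 eqxx.
have [|w hw w0] := ivt (v := 0) (ltW xy) (fun z _ => cf z); first by case: hxy; [right|left].
by have := h w (or_intror hw); rewrite w0 eqxx.
Qed.

Lemma T_mvt x y : same_arc x y ->
  exists2 c, (x <= c <= y) \/ (y <= c <= x) & T y - T x = (X c)^-1 * (y - x).
Proof.
by move=> h; apply: (@mvt_between _ T (fun c => (X c)^-1)) => c /h; exact: clock_der.
Qed.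

Lemma T_inj x y : same_arc x y -> T x = T y -> x = y.
Proof.
move=> h e; have [c /h c0] := T_mvt h; rewrite e subrr => /esym/eqP.
by rewrite mulf_eq0 invr_eq0 (negbTE c0)/= subr_eq0 => /eqP.
Qed.

(** On both sides of a zero, T tends to -oo if l > 0 and to +oo if l < 0. *)
Lemma germ_end z v : X z = 0 -> exists2 l, l != 0 & exists2 d : R, 0 < d &
  forall y, 0 < y < d -> [/\ X (z + y) = l * y, X (z - y) = - (l * y),
     l * (T (z + y) - v) <= 0 & l * (T (z - y) - v) <= 0].
Proof.
move=> z0; have [l [c [r [l0 r0 H]]]] := clock_germ hC z0; exists l => //.
pose k1 := expR (l * (v - c - jump l)); pose k2 := expR (l * (v - c)).
exists (Num.min r (Num.min k1 k2)); first by rewrite !lt_min r0 !expR_gt0.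
move=> y /andP[y0]; rewrite !lt_min => /and3P[yr yk1 yk2].
have y0' := lt0r_neq0 y0.
have [|X1 T1] := H (z + y); first by rewrite (_ : z + y - z = y) ?gtr0_norm ?y0//; ring.
have [|X2 T2] := H (z - y); first by rewrite (_ : z - y - z = - y) ?normrN ?gtr0_norm ?y0//; ring.
have e1 : z + y - z = y by ring. have e2 : z - y - z = - y by ring.
rewrite {}X1 {}X2 {}T1 {}T2 e1 e2 normrN gtr0_norm// ltrDl y0 ltrDl oppr_gt0 ltNge (ltW y0)/= addr0.
split=> //; first by rewrite mulrN.
  have : ln y <= l * (v - c - jump l) by rewrite -(expRK (l * _)) ler_ln ?posrE ?expR_gt0// ltW.
  by rewrite (_ : l * (ln y / l + c + jump l - v) = ln y - l * (v - c - jump l)) ?subr_le0//; field.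
have : ln y <= l * (v - c) by rewrite -(expRK (l * _)) ler_ln ?posrE ?expR_gt0// ltW.
by rewrite (_ : l * (ln y / l + c - v) = ln y - l * (v - c)) ?subr_le0//; field.
Qed.

Lemma zero_left x : X x != 0 -> exists2 a, a < x /\ X a = 0 & forall w, a < w <= x -> X w != 0.
Proof.
move=> x0; pose A := [set z | z <= x /\ X z = 0].
have [z z0] := clock_zero hC.
have [k /andP[k1 k2] _] := floor_shift (x - 1) z.
have Az : A (z + k%:~R) by split; [lra|rewrite periodic_int//; exact: clock_X1 hC].
have supA : has_sup A by split; [exists (z + k%:~R)|exists x => ? []].
have sx : sup A <= x by apply: ge_sup; [case: supA|move=> ? []].
have X0 : X (sup A) = 0.
  apply/eqP; apply: contrapT => /negP h.
  have [r r0 H] := same_arc_near h.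
  have [w [wx w0] hw] := sup_adherent r0 supA.
  have ws : w <= sup A by exact: (ub_le_sup supA.2).
  have /same_arcr : same_arc (sup A) w by apply: H; rewrite ler0_norm; lra.
  by rewrite w0 eqxx.
exists (sup A).
  by split=> //; rewrite lt_neqAle sx andbT; apply: contraNneq x0 => <-; rewrite X0.
move=> w /andP[aw wx]; apply/eqP => w0.
by have : w <= sup A; [exact: (ub_le_sup supA.2)|rewrite leNgt aw].
Qed.

Lemma zero_right x : X x != 0 -> exists2 b, x < b /\ X b = 0 & forall w, x <= w < b -> X w != 0.
Proof.
move=> x0; pose A := [set z | x <= z /\ X z = 0].
have [z z0] := clock_zero hC.
have [k /andP[k1 k2] _] := floor_shift x z.
have Az : A (z + k%:~R) by split; [lra|rewrite periodic_int//; exact: clock_X1 hC].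
have infA : has_inf A by split; [exists (z + k%:~R)|exists x => ? []].
have sx : x <= inf A by apply: lb_le_inf; [case: infA|move=> ? []].
have X0 : X (inf A) = 0.
  apply/eqP; apply: contrapT => /negP h.
  have [r r0 H] := same_arc_near h.
  have [w [wx w0] hw] := inf_adherent r0 infA.
  have ws : inf A <= w by exact: (ge_inf infA.2).
  have /same_arcr : same_arc (inf A) w by apply: H; rewrite ger0_norm; lra.
  by rewrite w0 eqxx.
exists (inf A).
  by split=> //; rewrite lt_neqAle sx andbT; apply: contraNneq x0 => ->; rewrite X0.
move=> w /andP[aw wx]; apply/eqP => w0.
by have : inf A <= w; [exact: (ge_inf infA.2)|rewrite leNgt wx].
Qed.

Lemma arc_ends x : X x != 0 -> exists a b, [/\ a < x < b, X a = 0, X b = 0 &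
  forall w, a < w < b -> same_arc x w].
Proof.
move=> x0; have [a [ax a0] ha] := zero_left x0; have [b [xb b0] hb] := zero_right x0.
exists a, b; split=> //; first by rewrite ax.
move=> w /andP[aw wb] u; case=> /andP[u1 u2].
  by apply: hb; rewrite u1 (le_lt_trans u2).
by apply: ha; rewrite u2 andbT (lt_le_trans aw).
Qed.

Lemma T_surj x v : X x != 0 -> exists2 y, same_arc x y & T y = v.
Proof.
move=> x0; have [a [b [/andP[ax xb] a0 b0 H]]] := arc_ends x0.
have [la la0 [da da0 Ha]] := germ_end v a0; have [lb lb0 [db db0 Hb]] := germ_end v b0.
pose ya := Num.min da (x - a) / 2; pose yb := Num.min db (b - x) / 2.
have ma : 0 < Num.min da (x - a) by rewrite lt_min da0 subr_gt0.
have mb : 0 < Num.min db (b - x) by rewrite lt_min db0 subr_gt0.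
have ya0 : 0 < ya by rewrite divr_gt0. have yb0 : 0 < yb by rewrite divr_gt0.
have yad : ya < Num.min da (x - a) by rewrite /ya; lra.
have ybd : yb < Num.min db (b - x) by rewrite /yb; lra.
move: yad ybd; rewrite !lt_min => /andP[yad yax] /andP[ybd ybx].
have [|Xa _ Ta _] := Ha ya; first by rewrite ya0.
have [|_ Xb _ Tb] := Hb yb; first by rewrite yb0.
have sa : same_arc x (a + ya) by apply: H; apply/andP; split; lra.
have sb : same_arc x (b - yb) by apply: H; apply/andP; split; lra.
have sab := same_arc_trans (same_arc_sym sa) sb.
have sg := same_arc_sgn sab.
have lab : la * lb < 0.
  have p : 0 < ya * yb by exact: mulr_gt0.
  by rewrite -(pmulr_llt0 _ p); move: sg; rewrite Xa Xb; lra.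
have ab : a + ya <= b - yb by lra.
have lab1 : (0 < la /\ lb < 0) \/ (la < 0 /\ 0 < lb).
  by case: (ltgtP la 0) la0 lab => // h _; [rewrite nmulr_rlt0//; right|rewrite pmulr_rlt0//; left].
have [y|| y hy Ty] := @ivt _ T (a + ya) (b - yb) v ab.
- by move=> hy; exact: der_continuous (clock_der hC (sab _ (or_introl hy))).
- case: lab1 => [] [h1 h2].
    rewrite pmulr_rle0// in Ta; rewrite nmulr_rle0// in Tb.
    by left; apply/andP; split; lra.
  rewrite nmulr_rle0// in Ta; rewrite pmulr_rle0// in Tb.
  by right; apply/andP; split; lra.
- exists y => //; apply: same_arc_trans sa _.
  move=> w hw; apply: sab; case: hw => /andP[w1 w2]; move/andP: hy => [y1 y2].
    by left; rewrite w1 (le_trans w2).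
  by left; rewrite (le_trans y1)//= (le_trans w2)//; lra.
Qed.

Definition flow t x : R := if X x == 0 then x else xget x [set y | same_arc x y /\ T y = T x + t].

Lemma flow_zero t z : X z = 0 -> flow t z = z.
Proof. by rewrite /flow => ->; rewrite eqxx. Qed.

Lemma flowP t x : X x != 0 -> same_arc x (flow t x) /\ T (flow t x) = T x + t.
Proof.
move=> x0; rewrite /flow (negbTE x0).
have [y h1 h2] := T_surj (T x + t) x0.
exact: (@xgetPex R x [set y0 | same_arc x y0 /\ T y0 = T x + t] (ex_intro _ y (conj h1 h2))).
Qed.

Lemma flow_unique t x y : same_arc x y -> T y = T x + t -> flow t x = y.
Proof.
move=> h1 h2; have [h3 h4] := flowP t (same_arcl h1).
apply: T_inj; last by rewrite h4 h2.
exact: same_arc_trans (same_arc_sym h3) h1.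
Qed.

Lemma flow_neq0 t x : (X (flow t x) == 0) = (X x == 0).
Proof.
have [x0|x0] := eqVneq (X x) 0; first by rewrite flow_zero// x0 eqxx.
by apply/negbTE; have [/same_arcr] := flowP t x0.
Qed.

Lemma flow0 x : flow 0 x = x.
Proof.
have [x0|x0] := eqVneq (X x) 0; first by rewrite flow_zero.
by apply: flow_unique; [exact: same_arc_refl|rewrite addr0].
Qed.

Lemma flowD s t x : flow (s + t) x = flow s (flow t x).
Proof.
have [x0|x0] := eqVneq (X x) 0; first by rewrite !flow_zero.
have [h1 h2] := flowP t x0; have [h3 h4] := flowP s (same_arcr h1).
apply: flow_unique; first exact: same_arc_trans h1 h3.
by rewrite h4 h2 -addrA [t + s]addrC.
Qed.

Lemma flowK t x : flow (- t) (flow t x) = x.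
Proof. by rewrite -flowD addNr flow0. Qed.

Lemma X_int x (k : int) : X (x + k%:~R) = X x.
Proof. by rewrite periodic_int//; exact: clock_X1 hC. Qed.

Lemma T_int x (k : int) : T (x + k%:~R) = T x.
Proof. by rewrite periodic_int//; exact: clock_T1 hC. Qed.

Lemma same_arc_int x y (k : int) : same_arc x y -> same_arc (x + k%:~R) (y + k%:~R).
Proof.
move=> h w hw; rewrite -(subrK k%:~R w) X_int; apply: h.
by case: hw => /andP[? ?]; [left|right]; apply/andP; split; lra.
Qed.

Lemma flow_int t x (k : int) : flow t (x + k%:~R) = flow t x + k%:~R.
Proof.
have [x0|x0] := eqVneq (X x) 0; first by rewrite !flow_zero// X_int.
have [h1 h2] := flowP t x0.
by apply: flow_unique; [exact: same_arc_int|rewrite !T_int].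
Qed.

(** The inverse function rule for T at flow t x; the group law reduces all times to
    times near zero. *)
Lemma flow_der_time x t : der (fun s => flow s x) t (X (flow t x)).
Proof.
have [x0|x0] := eqVneq (X x) 0.
  rewrite flow_zero// x0; apply: (der_ext (f := fun=> x)); last exact: der_cst.
  by move=> s; rewrite flow_zero.
have [h1 h2] := flowP t x0; set y := flow t x in h1 h2 *.
have y0 := same_arcr h1.
pose g v := flow (v - T y) y.
have [r r0 H] := same_arc_near y0.
have hg : der g (T y) (X y).
  rewrite -[X y]invrK; apply: der_inverse.
  - apply/near_ball; exists r => // y' /H hy'; apply: flow_unique => //; ring.
  - apply/near_ball; exists r => // y' /H/same_arcr hy'.
    exact: der_continuous (clock_der hC hy').
  - exact: clock_der.
  - by rewrite invr_eq0.
apply: (der_ext (f := fun s => g (T y + 1 * (s - t)))).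
  move=> s; rewrite /g mul1r addrAC subrr add0r /y -flowD; congr flow; ring.
apply: der_eq.
  apply: (@der_comp _ g); last exact: der_affine.
  by rewrite subrr mulr0 addr0; exact: hg.
by rewrite mulr1.
Qed.

Lemma flow_der t x : X x != 0 -> der (flow t) x (X (flow t x) / X x).
Proof.
move=> x0; have [r r0 H] := same_arc_near x0.
apply: (der_near (f := fun x' => flow (T x' - T x + t) x)).
  apply/near_ball; exists r => // y /H hy.
  have [h1 h2] := flowP t (same_arcr hy).
  by apply/esym/flow_unique; [exact: same_arc_trans hy h1|rewrite h2; ring].
apply: (@der_comp _ (fun s => flow s x) (fun x' => T x' - T x + t)).
  by rewrite subrr add0r; exact: flow_der_time.
apply: der_eq.
  by apply: derD; [apply: derB; [exact: clock_der|exact: der_cst]|exact: der_cst].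
by rewrite subr0 addr0.
Qed.

Lemma zero_slope z l r : 0 < r -> X z = 0 ->
  (forall x, 0 < `|x - z| < r -> X x = l * (x - z)) -> derive1 X z = l.
Proof.
move=> r0 z0 H; apply: der_derive1.
apply: (der_near (f := fun x => 0 + l * (x - z))); last exact: der_affine.
apply/near_ball; exists r => // y yz; rewrite add0r.
have [->|yz0] := eqVneq y z; first by rewrite z0 subrr mulr0.
by rewrite H// yz normr_gt0 subr_eq0 yz0.
Qed.

Lemma zero_germ z : X z = 0 -> [/\ derive1 X z != 0 & exists c, exists2 r : R, 0 < r &
    forall x, 0 < `|x - z| < r -> [/\ X x = derive1 X z * (x - z), X x != 0 &
      T x = ln `|x - z| / derive1 X z + c + (if z < x then jump (derive1 X z) else 0)]].
Proof.
move=> z0; have [l [c [r [l0 r0 H]]]] := clock_germ hC z0.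
have -> : derive1 X z = l by apply: (zero_slope r0 z0) => x /H[].
split=> //; exists c, r => // x xz; have [H1 H2] := H x xz; split=> //.
by rewrite H1 mulf_neq0//; case/andP: xz; rewrite normr_gt0.
Qed.

Lemma zero_slope_int z (k : int) : derive1 X (z + k%:~R) = derive1 X z.
Proof.
have d x : der X x (derive1 X x) by apply/derivable_der/smooth_derivable; exact: clock_smooth hC.
rewrite -(der_derive1 (der_shift (d (z + k%:~R)))); apply: der_derive1.
by apply: der_ext (d z) => y; rewrite X_int.
Qed.

(** T is a logarithm near z, so that adding t to T multiplies x - z by a constant. *)
Lemma flow_linear t z : X z = 0 -> exists2 r : R, 0 < r &
  forall x, `|x - z| < r -> flow t x = z + expR (derive1 X z * t) * (x - z).
Proof.
move=> z0; have [l0 [c [r r0 H]]] := zero_germ z0; set l := derive1 X z in l0 H *.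
have E0 := expR_gt0 (l * t); set E := expR (l * t) in E0 *.
exists (Num.min r (r / E)); first by rewrite lt_min r0 divr_gt0.
move=> x; rewrite lt_min => /andP[xr]; rewrite ltr_pdivlMr// => xE.
have [->|xz] := eqVneq x z; first by rewrite flow_zero// subrr mulr0 addr0.
have xz0 : 0 < `|x - z| by rewrite normr_gt0 subr_eq0.
set y := z + E * (x - z).
have yz : y - z = E * (x - z) by rewrite /y; ring.
have nyz : `|y - z| = `|x - z| * E by rewrite yz normrM (gtr0_norm E0) mulrC.
have side w : (x <= w <= y) \/ (y <= w <= x) -> 0 < `|w - z| < r.
  move=> hw; case: (ltgtP x z) xz => // xz _.
    have xyz : y < z by rewrite -subr_lt0 yz nmulr_llt0// subr_lt0.
    have wz : w < z by case: hw => /andP[h1 h2]; lra.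
    rewrite ltr0_norm ?subr_lt0// in xr xz0 xE nyz *.
    rewrite ltr0_norm ?subr_lt0// in nyz.
    by rewrite ltr0_norm ?subr_lt0//; case: hw => /andP[h1 h2]; apply/andP; split; lra.
  have xyz : z < y by rewrite -subr_gt0 yz pmulr_rgt0// subr_gt0.
  have wz : z < w by case: hw => /andP[h1 h2]; lra.
  rewrite gtr0_norm ?subr_gt0// in xr xz0 xE nyz *.
  rewrite gtr0_norm ?subr_gt0// in nyz.
  by rewrite gtr0_norm ?subr_gt0//; case: hw => /andP[h1 h2]; apply/andP; split; lra.
have sxy : same_arc x y by move=> w /side/H[].
apply: flow_unique => //.
have [_ _ ->] := H y (side y ltac:(by case: (leP x y) => h; [left|right]; rewrite lexx ?h// ltW)).
have [_ _ ->] := H x (side x ltac:(by case: (leP x y) => h; [left|right]; rewrite lexx ?h// ltW)).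
have -> : (z < y) = (z < x) by rewrite -subr_gt0 yz pmulr_rgt0// subr_gt0.
rewrite nyz lnM ?posrE// /E expRK; field.
exact: l0.
Qed.

Lemma flow_derive_zero t z : X z = 0 -> der (flow t) z (expR (derive1 X z * t)).
Proof.
move=> z0; have [r r0 H] := flow_linear t z0.
apply: der_near (der_affine z z (expR (derive1 X z * t)) z).
by apply/near_ball; exists r.
Qed.

Lemma flow_lift t : lift 1 (flow t).
Proof.
have D x : exists2 l, der (flow t) x l & 0 < l.
  have [x0|x0] := eqVneq (X x) 0.
    by eexists; [exact: flow_derive_zero|exact: expR_gt0].
  exists (X (flow t x) / X x); first exact: flow_der.
  have [h _] := flowP t x0; have := same_arc_sgn h.
  have := same_arcl h; move: (X x) (X (flow t x)) => u v u0 uv.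
  by rewrite (_ : v / u = (u * v) / u ^+ 2) ?divr_gt0//; [rewrite exprn_even_gt0|field].
have cfl x : {for x, continuous (flow t)} by have [l h _] := D x; exact: der_continuous h.
split.
- by left.
- by move=> x; rewrite (flow_int t x 1).
- by move=> x; have [l h _] := D x; exact: der_derivable h.
- move=> x; have [x0|x0] := eqVneq (X x) 0.
    have [r r0 H] := flow_linear t x0.
    have h : \forall y \near x, derive1 (flow t) y = expR (derive1 X x * t).
      apply/near_ball; exists (r / 2) => [|y yx]; first by rewrite divr_gt0.
      apply: der_derive1; apply: der_near (der_affine x x (expR (derive1 X x * t)) y).
      apply/near_ball; exists (r / 2) => [|w wy]; first by rewrite divr_gt0.
      apply: H; rewrite (_ : w - x = (w - y) + (y - x)); last by ring.
      by apply: le_lt_trans (ler_normD _ _) _; rewrite [ltRHS](splitr r) ltrD.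
    apply/continuous_ball => e e0; have /near_ball[d d0 Hd] := h.
    by exists d => // y yd; rewrite (Hd y yd) (Hd x) ?subrr ?normr0.
  have [r r0 H] := same_arc_near x0.
  have cq : {for x, continuous (fun y => X (flow t y) / X y)}.
    apply: cvgM; last by apply: cvgV => //; exact: clock_cont.
    by apply: continuous_comp; [exact: cfl|exact: clock_cont].
  apply/continuous_ball => e e0; have /continuous_ball/(_ e e0)[d d0 Hd] := cq.
  exists (Num.min r d) => [|y]; first by rewrite lt_min r0.
  rewrite lt_min => /andP[/H/same_arcr yr /Hd].
  by rewrite (der_derive1 (flow_der t yr)) (der_derive1 (flow_der t x0)).
- by move=> x; have [l h l0] := D x; rewrite mul1r (der_derive1 h).
Qed.

Lemma lift_same_arc e F x y : lift e F -> (forall x, (X (F x) == 0) = (X x == 0)) ->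
  same_arc x y -> same_arc (F x) (F y).
Proof.
move=> hF XF h w hw; have [v vw] := lift_surj w hF; rewrite -vw XF; apply: h.
rewrite -vw in hw; have mono u u' : F u <= F u' -> if e == 1 then u <= u' else u' <= u.
  move=> uu; case: ifP => [/eqP e1|/eqP e1]; rewrite leNgt; apply/negP => lt.
    by have := lift_lt hF lt; rewrite e1; lra.
  by have := lift_lt hF lt; case: (lift_sgn hF) => // ->; lra.
by case: hw => /andP[/mono h1 /mono h2]; move: h1 h2; case: ifP => _ h1 h2; [left|right|right|left]; apply/andP.
Qed.

(** Both sides lie on one arc and have the same time. *)
Lemma flow_commute e F tau t x : lift e F -> (forall x, (X (F x) == 0) = (X x == 0)) ->
  (forall x, X x != 0 -> T (F x) = T x + tau) -> F (flow t x) = flow t (F x).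
Proof.
move=> hF XF TF; have [x0|x0] := eqVneq (X x) 0.
  by rewrite !flow_zero//; apply/eqP; rewrite XF x0.
have [h1 h2] := flowP t x0; apply/esym/flow_unique; first exact: (lift_same_arc hF XF h1).
rewrite !TF ?h2//; [ring|exact: same_arcr h1].
Qed.

End Flow.
(** * The model diffeomorphisms *)

Section CircleNbhs.
Context {R : realType}.
Local Notation S1 := (circle R).

Lemma nbhs_projP (a : R) (U : set S1) : nbhs (proj a) U <->
  exists2 r : R, 0 < r & forall y, `|y - a| < r -> U (proj y).
Proof.
split=> [/nbhs_ballP[r /= r0 h]|[r r0 h]].
  by exists r => // y yr; apply: h; exists a, y; rewrite distrC.
apply/nbhs_ballP; exists r => //= p [a' [b' [ha hb hab]]].
have [k ak] : exists k : int, a' = a + k%:~R by apply/proj_eq.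
rewrite -hb -(proj_int b' (- k)); apply: h.
rewrite mulrNz (_ : _ - a = - (a' - b')); first by rewrite normrN.
by rewrite ak; ring.
Qed.

End CircleNbhs.

Section Model.
Context {R : realType}.
Implicit Types (a b c w x y z l d r s t v : R).
Local Notation S1 := (circle R).

Definition side_jump (e l : R) : R := if (e == 1) && (0 < l) then 1 else 0.

(** The lifts of the diffeomorphisms of the dense set: T is a time function for
    which F is translation by 1/q; F^q fixes the zeros of X up to translation by
    m; p0 is recognizable up to its orbit by its multiplier, among the zeros
    fixed by f if f reverses the orientation; if f preserves it, the unit jump of T
    distinguishes the two sides of a repelling zero. *)
Record model (e : R) (q : nat) (m : int) (F X T : R -> R) (p0 : R) : Prop := Model {
  model_lift : lift e F ;
  model_clock : clock (side_jump e) X T ;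
  model_q : (0 < q)%N ;
  model_X : forall x, (X (F x) == 0) = (X x == 0) ;
  model_T : forall x, X x != 0 -> T (F x) = T x + q%:R^-1 ;
  model_fix : forall z, X z = 0 -> iter q F z = z + m%:~R ;
  model_sgn : (e = 1 /\ coprime q `|m|%N) \/ (e = -1 /\ q = 2%N /\ m = 0) ;
  model_p0 : X p0 = 0 /\ (e = -1 -> exists k : int, F p0 = p0 + k%:~R) ;
  model_rigid : forall z, X z = 0 -> (e = -1 -> exists k : int, F z = z + k%:~R) ->
    derive1 X z = derive1 X p0 -> exists j (k : int), z = iter j F p0 + k%:~R }.

Context (e : R) (q : nat) (m : int) (F X T : R -> R) (p0 : R).
Context (hM : model e q m F X T p0).
Context (f : diff1 R) (hf : is_C1_lift f F).

Let hF := model_lift hM.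
Let hC := model_clock hM.
Let q0 := model_q hM.
Local Notation phi := (flow X T).

Lemma model_qR : 0 < q%:R :> R.
Proof. by rewrite ltr0n. Qed.

Lemma model_eq : e ^+ q = 1.
Proof. by case: (model_sgn hM) => [[-> _]|[-> [-> _]]]; rewrite ?expr1n// sqrrN expr1n. Qed.

Lemma model_XiterE n x : (X (iter n F x) == 0) = (X x == 0).
Proof. by elim: n => //= n <-; exact: model_X hM _. Qed.

Lemma model_Titer n x : X x != 0 -> T (iter n F x) = T x + n%:R / q%:R.
Proof.
move=> x0; elim: n => [|n IH]; first by rewrite mul0r addr0.
rewrite iterS (model_T hM) ?model_XiterE// IH -natr1; ring.
Qed.

(** F^q maps each arc to itself up to translation by m, hence is the time one
    map there. *)
Lemma model_iterq x : iter q F x = phi 1 x + m%:~R.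
Proof.
have [x0|x0] := eqVneq (X x) 0; first by rewrite flow_zero// (model_fix hM).
have [a [b [/andP[ax xb] a0 b0 H]]] := arc_ends hC x0.
have hq := lift_iter q hF; rewrite model_eq in hq.
have h1 : a < iter q F x - m%:~R.
  by rewrite ltrBrDr -(model_fix hM a0) (lift1_lt _ _ hq).
have h2 : iter q F x - m%:~R < b.
  by rewrite ltrBlDr -(model_fix hM b0) (lift1_lt _ _ hq).
suff -> : phi 1 x = iter q F x - m%:~R by rewrite subrK.
apply: (flow_unique hC); first by apply: H; rewrite h1.
rewrite -mulrNz (T_int hC) model_Titer// divff// gt_eqF// model_qR//.
Qed.

Lemma model_commute t x : F (phi t x) = phi t (F x).
Proof. exact: (flow_commute hC t x hF (model_X hM) (model_T hM)). Qed.

Lemma model_derive_iterq z : X z = 0 -> derive1 (iter q F) z = expR (derive1 X z).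
Proof.
move=> z0; apply: der_derive1.
apply: (der_ext (f := fun x => phi 1 x + m%:~R)); first exact: model_iterq.
apply: der_eq.
  apply: derD; last exact: der_cst.
  exact: flow_derive_zero hC 1 _ z0.
by rewrite mulr1 addr0.
Qed.

Let fE a : f (proj a) = proj (F a).
Proof. by have [h _ _] := hf. Qed.

Lemma model_iterE n a : iter n f (proj a) = proj (iter n F a).
Proof. by elim: n => //= n ->. Qed.

Definition circle_field (p : S1) : R := X (repr p).
Definition circle_flow t (p : S1) : S1 := proj (phi t (repr p)).

Lemma circle_fieldE a : circle_field (proj a) = X a.
Proof. by rewrite /circle_field; have [k ->] := repr_proj a; rewrite (X_int hC). Qed.

Lemma circle_flowE t a : circle_flow t (proj a) = proj (phi t a).
Proof.
by rewrite /circle_flow; have [k ->] := repr_proj a; rewrite (flow_int hC) proj_int.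
Qed.

Lemma circle_field_proj : circle_field \o proj = X.
Proof. by apply/funext => a /=; rewrite circle_fieldE. Qed.

Lemma field_deriveE a : field_derive circle_field (proj a) = derive1 X a.
Proof.
rewrite /field_derive circle_field_proj.
by have [k ->] := repr_proj a; rewrite (zero_slope_int hC).
Qed.

Lemma model_smooth_field : smooth_field circle_field.
Proof.
move=> n a; rewrite circle_field_proj.
by apply: smooth_derivable; apply: smooth_derive1n; exact: clock_smooth hC.
Qed.

Lemma model_is_flow : is_flow circle_field circle_flow.
Proof.
move=> a; exists (fun t => phi t a); split.
- exact: flow0 hC a.
- by move=> t; rewrite circle_fieldE; exact: flow_der_time hC a t.
- by move=> t; rewrite circle_flowE.
Qed.

(** The clock tells apart the points near a from their later images. *)
Lemma model_wandering a d : X a != 0 -> 0 < d ->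
  exists2 U : set S1, nbhs (proj a) U &
    forall p : S1, U p -> exists2 b, p = proj b & X b != 0 /\ `|T b - T a| < d.
Proof.
move=> a0 d0.
exists [set p : S1 | exists2 b, p = proj b & X b != 0 /\ `|T b - T a| < d]; last by [].
apply/nbhs_projP.
have [r r0 H] := same_arc_near hC a0.
have /continuous_ball/(_ d d0)[r' r'0 H'] := der_continuous (clock_der hC a0).
exists (Num.min r r') => [|y]; first by rewrite lt_min r0.
rewrite lt_min => /andP[/H/same_arcr h1 /H' h2]; by exists y.
Qed.

Lemma model_T_proj a b : proj a = proj b -> T a = T b.
Proof. by move=> /proj_eq[k ->]; rewrite (T_int hC). Qed.

Lemma flow_nonwanderingE : flow_nonwandering circle_flow = [set p | circle_field p = 0].
Proof.
apply/seteqP; split; apply: proj_ind => a /=; rewrite circle_fieldE.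
  move=> h; apply/eqP; apply: contrapT => /negP a0.
  have d0 : 0 < 2^-1 :> R by [].
  have [U nU HU] := model_wandering a0 d0.
  have [t t1 [y /HU[b -> [b0 hb]]]] := h U nU 1; rewrite circle_flowE => /HU[b' /model_T_proj hb' [_ hb'']].
  move: hb''; rewrite -hb'; have [_ ->] := flowP hC t b0.
  have := ler_norm (T b + t - T a); have := ler_norm (T a - T b); rewrite distrC; lra.
move=> a0 U /nbhs_singleton Ua t; exists t => //; exists (proj a) => //.
by rewrite circle_flowE flow_zero.
Qed.

Lemma nonwanderingE : nonwandering f = [set p | circle_field p = 0].
Proof.
apply/seteqP; split; apply: proj_ind => a /=; rewrite circle_fieldE.
  move=> h; apply/eqP; apply: contrapT => /negP a0.
  have qR := model_qR.
  have d0 : 0 < (2 * q%:R)^-1 :> R by rewrite invr_gt0 mulr_gt0.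
  have [U nU HU] := model_wandering a0 d0.
  have [n n1 [y /HU[b -> [b0 hb]]]] := h U nU; rewrite model_iterE => /HU[b' /model_T_proj hb' [_ hb'']].
  move: hb''; rewrite -hb' model_Titer// => hb''.
  have nq : (q%:R^-1 : R) <= n%:R / q%:R by rewrite -[leLHS]mul1r ler_pM2r ?invr_gt0// ler1n.
  have dd : (2 * q%:R)^-1 + (2 * q%:R)^-1 = q%:R^-1 :> R by field; rewrite gt_eqF.
  have := ler_norm (T b + n%:R / q%:R - T a); have := ler_norm (T a - T b); rewrite distrC; lra.
move=> a0 U /nbhs_singleton Ua; exists q => //; exists (proj a) => //.
by rewrite model_iterE (model_fix hM a0) proj_int.
Qed.

Lemma model_zeros_separated : exists2 r : R, 0 < r &
  forall y z, X y = 0 -> X z = 0 -> `|y - z| < r -> y = z.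
Proof.
have [|||r r0 H] := @periodic_radius R (fun r x => forall y, X y = 0 -> X x = 0 -> `|y - x| < r -> y = x).
- by move=> r r' x _ r'r h y y0 x0 yx; apply: h => //; exact: lt_le_trans r'r.
- move=> r x k h y y0 x0 yx; apply: (addIr k%:~R); apply: h; rewrite ?(X_int hC)//.
  by rewrite (_ : _ - _ = y - x)//; ring.
- move=> x; have [x0|x0] := eqVneq (X x) 0.
    have [_ [c [r r0 H]]] := zero_germ hC x0; exists (r / 2) => [|y yx z z0 y0 zy]; first by rewrite divr_gt0.
    have iso w : `|w - x| < r -> X w = 0 -> w = x.
      move=> wr w0; apply/eqP; apply: contrapT => /negP wx.
      by have [|_ /eqP] := H w; rewrite ?wr ?normr_gt0 ?subr_eq0 ?wx.
    have -> : y = x by apply: iso => //; apply: (lt_trans yx); rewrite ltr_pdivrMr// ltr_pMr// ltr1n.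
    apply: iso => //; rewrite (_ : z - x = (z - y) + (y - x)); last by ring.
    by apply: le_lt_trans (ler_normD _ _) _; rewrite [ltRHS](splitr r) ltrD.
  have [r r0 H] := same_arc_near hC x0; exists r => // y /H/same_arcr/eqP y0 z _ y00.
  by case: y0.
- by exists r => // y z y0 z0; exact: H.
Qed.

(** Separated zeros in the unit interval are told apart by the cell of width r that
    contains them. *)
Lemma model_finite : finite_set [set p | circle_field p = 0].
Proof.
have [r r0 H] := model_zeros_separated.
pose N := (Num.truncn (r^-1)).+1.
pose g (i : nat) := xget p0 [set z | [/\ X z = 0, 0 <= z & Num.truncn (z / r) = i]].
apply: (@sub_finite_set _ _ [set proj (g i) | i in `I_N]); last exact/finite_image/finite_II.
apply: proj_ind => a /=; rewrite circle_fieldE => a0.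
have [k /andP[k0 k1] _] := floor_shift 0 a.
set z := a + k%:~R in k0 k1; have z0 : X z = 0 by rewrite /z (X_int hC).
have zr0 : 0 <= z / r by rewrite divr_ge0// ltW.
exists (Num.truncn (z / r)) => /=.
  rewrite ltnS; apply: le_truncn; rewrite ler_pdivrMr// mulVf ?gt_eqF//; lra.
rewrite -(proj_int a k) -/z; congr proj.
have [g0 gp gE] := @xgetPex R p0 [set y | [/\ X y = 0, 0 <= y & Num.truncn (y / r) = Num.truncn (z / r)]] (ex_intro _ z (And3 z0 k0 erefl)).
apply: H => //.
set y := g _; rewrite -/(g (Num.truncn (z / r))) -/y in gp gE.
have /andP[z1 z2] := truncn_itv zr0.
have yr0 : 0 <= y / r by rewrite divr_ge0// ltW.
have /andP[y1 y2] := truncn_itv yr0; rewrite gE in y1 y2.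
rewrite -natr1 in z2 y2.
have : `|y / r - z / r| < 1 by rewrite ltr_norml; apply/andP; split; lra.
by rewrite -mulrBl normrM normfV (gtr0_norm r0) ltr_pdivrMr// mul1r.
Qed.

(** Consecutive zeros have slopes of opposite signs, since X has constant sign
    between them. *)
Lemma model_alternate a b : a < b -> X a = 0 -> X b = 0 ->
  (forall c, a < c < b -> X c != 0) -> derive1 X a * derive1 X b < 0.
Proof.
move=> ab a0 b0 H.
have [_ [ca [ra ra0 Ha]]] := zero_germ hC a0; have [_ [cb [rb rb0 Hb]]] := zero_germ hC b0.
pose y := Num.min (Num.min ra rb) (b - a) / 2.
have mp : 0 < Num.min (Num.min ra rb) (b - a) by rewrite !lt_min ra0 rb0 subr_gt0.
have y0 : 0 < y by rewrite divr_gt0.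
have : y < Num.min (Num.min ra rb) (b - a) by rewrite /y; lra.
have : y * 2 = Num.min (Num.min ra rb) (b - a) by rewrite /y; field.
have : Num.min (Num.min ra rb) (b - a) <= b - a by rewrite ge_min lexx orbT.
rewrite !lt_min => y1 y2 /andP[/andP[yra yrb] yab].
have ea : a + y - a = y by ring.
have eb : b - y - b = - y by ring.
have [|Xa _ _] := Ha (a + y); first by rewrite ea gtr0_norm// y0.
have [|Xb _ _] := Hb (b - y); first by rewrite eb normrN gtr0_norm// y0.
have s : same_arc X (a + y) (b - y).
  by move=> w hw; apply: H; case: hw => /andP[h1 h2]; apply/andP; split; lra.
have := same_arc_sgn hC s; rewrite Xa Xb ea eb => h.
have yy : 0 < y * y by exact: mulr_gt0.
rewrite -(pmulr_llt0 _ yy); lra.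
Qed.

Lemma flow_morse_smale : morse_smale_field circle_field circle_flow.
Proof.
split; rewrite flow_nonwanderingE.
- exact: model_finite.
- apply: proj_ind => a /=; rewrite circle_fieldE field_deriveE => a0; split=> //.
  by have [] := zero_germ hC a0.
- move=> a b ab /=; rewrite !circle_fieldE => a0 b0 H.
  have := model_alternate ab a0 b0; rewrite !field_deriveE => h.
  have {}h : derive1 X a * derive1 X b < 0.
    by apply: h => c /H/=; rewrite circle_fieldE => /eqP.
  case: (ltgtP (derive1 X a) 0) h => ha h; last by rewrite ha mul0r ltxx in h.
  - by left; rewrite nmulr_rlt0 in h.
  - by right; rewrite pmulr_rlt0 in h.
Qed.

Lemma model_period_not j (k : int) z : e = 1 -> X z = 0 -> (0 < j < q)%N ->
  iter j F z <> z + k%:~R.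
Proof.
move=> e1 z0 /andP[j0 jq] h.
have hF1 : lift 1 F by rewrite -e1.
have cop : coprime q `|m|%N.
  case: (model_sgn hM) => [[_ //]|[em _]]; exfalso.
  by have := @ltr01 R; rewrite -[X in _ < X]e1 em; lra.
have := lift1_period_dvd hF1 cop (model_fix hM z0) h.
by move=> /(dvdn_leq j0); rewrite leqNgt jq.
Qed.

Lemma model_has_period z : e = 1 -> X z = 0 -> has_period f (proj z) q.
Proof.
move=> e1 z0; split=> //; first by rewrite model_iterE (model_fix hM z0) proj_int.
move=> j jq; rewrite model_iterE => /proj_eq[k]; exact: model_period_not.
Qed.

Lemma model_cderive n a : cderive (iter n f) (proj a) = derive1 (iter n F) a.
Proof. by rewrite (cderiveE a (C1_lift_iter n hF hf)). Qed.

(** The k-th power appears because an orientation reversing f may fix p, while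
    the slope of X at p reads off the derivative of f^2. *)
Lemma model_multiplier z : X z = 0 -> exists n k, [/\ has_period f (proj z) n, (0 < k)%N &
  `|cderive (iter n f) (proj z)| ^+ k = expR (derive1 X z)].
Proof.
move=> z0; case: (model_sgn hM) => [[e1 _]|[e1 [q2 m0]]].
  exists q, 1%N; split=> //; first exact: model_has_period.
  by rewrite expr1 model_cderive (model_derive_iterq z0) gtr0_norm// expR_gt0.
have [fz|fz] := pselect (f (proj z) = proj z).
  exists 1%N, 2%N; split=> //.
    by split=> // -[|[|j]]; rewrite ?andbF.
  rewrite -(model_derive_iterq z0) q2 model_cderive.
  move: fz; rewrite fE => /proj_eq[k hk].
  have d1 : derive1 F (F z) = derive1 F z.
    rewrite hk; apply: (periodic_int (f := derive1 F)) => x; exact: lift_derive_add1 hF.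
  rewrite (derive_iter_prod 1 z hF) (derive_iter_prod 2 z hF) big_ord1 big_ord_recl big_ord1 /= d1.
  by rewrite -normrX ger0_norm ?sqr_ge0// expr2.
exists 2%N, 1%N; split=> //.
  split=> //; first by rewrite -q2 model_iterE (model_fix hM z0) proj_int.
  by move=> [|[|j]].
by rewrite expr1 -q2 model_cderive (model_derive_iterq z0) gtr0_norm// expR_gt0.
Qed.

Lemma model_attracting z : X z = 0 -> derive1 X z < 0 -> attracting_periodic f (proj z).
Proof.
move=> z0 l0; have [n [k [h1 h2 h3]]] := model_multiplier z0; exists n => //.
by rewrite -(expr_lt1 h2)// h3 -expR0 ltr_expR.
Qed.

Lemma model_repelling z : X z = 0 -> 0 < derive1 X z -> repelling_periodic f (proj z).
Proof.
move=> z0 l0; have [n [k [h1 h2 h3]]] := model_multiplier z0; exists n => //.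
by rewrite -(expr_gt1 h2)// h3 -expR0 ltr_expR.
Qed.

Lemma model_morse_smale : morse_smale f.
Proof.
split; rewrite nonwanderingE.
- exact: model_finite.
- apply: proj_ind => a /=; rewrite circle_fieldE => a0.
  have [n [k [h1 h2 h3]]] := model_multiplier a0; exists n => //.
  have [l0 _] := zero_germ hC a0; apply: contraNneq l0 => h.
  by move: h3; rewrite h expr1n -expR0 => /expR_inj <-.
- move=> a b ab /=; rewrite !circle_fieldE => a0 b0 H.
  have h : derive1 X a * derive1 X b < 0.
    by apply: model_alternate ab a0 b0 _ => c /H/=; rewrite circle_fieldE => /eqP.
  case: (ltgtP (derive1 X a) 0) h => ha h; last by rewrite ha mul0r ltxx in h.
  - by left; rewrite nmulr_rlt0// in h; split; [exact: model_attracting|exact: model_repelling].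
  - by right; rewrite pmulr_rlt0// in h; split; [exact: model_repelling|exact: model_attracting].
Qed.

Lemma model_periodic_zero a n : has_period f (proj a) n -> X a = 0.
Proof.
move=> [n0 h _]; apply/eqP; apply: contrapT => /negP a0.
move: h; rewrite model_iterE => /model_T_proj; rewrite model_Titer// => h.
have : n%:R / q%:R = 0 :> R by lra.
by move/eqP; rewrite mulf_eq0 invr_eq0 !pnatr_eq0 !eqn0Ngt n0 q0.
Qed.

Lemma model_orientation : (orientation_preserving f /\ common_period f q) \/
  (orientation_reversing f /\ q = 2%N).
Proof.
case: (model_sgn hM) => [[e1 _]|[e1 [q2 _]]]; [left|right]; split=> //.
- by apply: proj_ind => a; rewrite (cderiveE _ hf); have := lift_derive_gt0 hF a; rewrite e1 mul1r.
- have [p00 _] := model_p0 hM; split; first by exists (proj p0); exact: model_has_period.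
  apply: proj_ind => a n hn; have a0 := model_periodic_zero hn.
  have [_ h1 h2] := model_has_period e1 a0; case: hn => n0 h3 h4.
  apply/eqP; rewrite eqn_leq; apply/andP; split; rewrite leqNgt; apply/negP => lt.
    by apply: (h4 q); rewrite ?q0.
  by apply: (h2 n); rewrite ?n0.
- by apply: proj_ind => a; rewrite (cderiveE _ hf); have := lift_derive_gt0 hF a; rewrite e1; lra.
Qed.

Lemma model_time_one p : iter q f p = circle_flow 1 p.
Proof.
rewrite -(proj_repr p) model_iterE circle_flowE model_iterq proj_int//.
Qed.

Lemma model_flow_commute t p : f (circle_flow t p) = circle_flow t (f p).
Proof. by rewrite -(proj_repr p) circle_flowE !fE circle_flowE model_commute. Qed.

End Model.
(** * Centralizers *)

Section Rightward.
Context {R : realType}.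
Implicit Types (x y w b r : R).

(** The supremum of the points reached from x1 without leaving P would itself have a
    neighbourhood in which P propagates. *)
Lemma rightward_induction (Z P : R -> Prop) x1 :
  (forall a b : R, a < b -> exists2 w, a < w < b & ~ Z w) -> ~ Z x1 -> P x1 ->
  (forall x0, exists2 r : R, 0 < r & forall x y, ~ Z x -> ~ Z y ->
     `|x - x0| < r -> `|y - x0| < r -> x <= y -> P x -> P y) ->
  forall y, x1 <= y -> ~ Z y -> P y.
Proof.
move=> dns nx1 Px1 loc y0 xy0 ny0; apply: contrapT => nPy0.
pose S := [set x | x1 <= x /\ forall w, x1 <= w <= x -> ~ Z w -> P w].
have Sx1 : S x1.
  split=> // w /andP[h1 h2] _; suff -> : w = x1 by [].
  by apply/eqP; rewrite eq_le h1 h2.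
have ubS : ubound S y0.
  move=> x [h1 h2]; rewrite leNgt; apply/negP => lt; apply: nPy0; apply: h2 => //.
  by rewrite xy0 ltW.
have supS : has_sup S by split; [exists x1|exists y0].
set b := sup S; have [r r0 H] := loc b.
have [x [h1 h2] bx] := sup_adherent r0 supS; rewrite -/b in bx.
have xb : x <= b by apply: (ub_le_sup supS.2); split.
have x1b : x1 <= b by exact: (ub_le_sup supS.2).
have [w0 [w1 w2 w3 w4]] : exists w0, [/\ x1 <= w0, w0 <= x, b - r < w0 & ~ Z w0].
  move: h1; rewrite le_eqVlt => /orP[/eqP e1|lt].
    by exists x1; split=> //; rewrite e1.
  have [|w /andP[] ] := dns (Num.max x1 (b - r)) x; first by rewrite gt_max lt.
  by rewrite gt_max => /andP[h3 h4] h5 h6; exists w; split=> //; exact: ltW.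
have Pw0 : P w0 by apply: h2 => //; rewrite w1.
have : S (b + r / 2).
  split=> [|w /andP[h3 h4] h5]; first by lra.
  case: (leP w x) => wx; first by apply: h2; rewrite ?h3.
  apply: (H w0 w) => //; [rewrite ltr_norml|rewrite ltr_norml|]; try (apply/andP; split); lra.
move=> /(ub_le_sup supS.2); rewrite -/b; lra.
Qed.

End Rightward.

Lemma between_between {R : realType} (y w c u : R) : y < w ->
  (w <= c <= y) \/ (y <= c <= w) -> (c <= u <= y) \/ (y <= u <= c) -> y <= u <= w.
Proof. by move=> yw [] /andP[c1 c2] [] /andP[u1 u2]; apply/andP; split; lra. Qed.

Lemma subr_exchange {R : realType} (a b c d : R) : a + b = c + d -> a - c = d - b.
Proof. by move=> h; lra. Qed.

Lemma sign_parity {R : realType} (c : R) (u v : nat) : (u < 2)%N -> (v < 2)%N ->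
  0 < (-1) ^+ v * c -> 0 < (-1) ^+ u * c -> u = v.
Proof.
case: u => [|[|u]] //; case: v => [|[|v]] //= _ _;
  by rewrite expr0 expr1 mul1r mulN1r => h1 h2; have : false by lra.
Qed.

Section LiftUnique.
Context {R : realType}.

Lemma C1_lift_unique (f : circle R -> circle R) F G : is_C1_lift f F -> is_C1_lift f G ->
  exists k : int, forall x, F x = G x + k%:~R.
Proof.
move=> hF hG; have [Ff dF _] := hF; have [Gf dG _] := hG.
have D x : der (fun x => F x - G x) x 0.
  apply: der_eq; first by apply: derB; apply: derivable_der; [exact: dF|exact: dG].
  by rewrite -!(cderiveE _ hF) -!(cderiveE _ hG) subrr.
have [k hk] : exists k : int, F 0 = G 0 + k%:~R by apply/proj_eq; rewrite -Ff -Gf.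
exists k => x.
have h1 := ler_norm x; have := ler_norm (- x); rewrite normrN => h2.
have h3 := normr_ge0 x.
suff : F x - G x = F 0 - G 0 by rewrite hk => h; lra.
by apply: (@der0_cst _ (fun x => F x - G x) (- (`|x| + 1)) (`|x| + 1) (fun y _ => D y));
  apply/andP; split; lra.
Qed.

End LiftUnique.

Section Centralizer.
Context {R : realType}.
Implicit Types (a b c w x y z l d r s t v : R).
Local Notation S1 := (circle R).
Context (e : R) (q : nat) (m : int) (F X T : R -> R) (p0 : R).
Context (hM : model e q m F X T p0).
Context (f : diff1 R) (hf : is_C1_lift f F).

Let hF := model_lift hM.
Let hC := model_clock hM.
Let q0 := model_q hM.
Local Notation phi := (flow X T).

Section OneLift.
Context (g : diff1 R) (e' : R) (G : R -> R).
Context (hG : lift e' G) (hg : is_C1_lift g G) (fg : forall p, g (f p) = f (g p)).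

Let gE a : g (proj a) = proj (G a).
Proof. by have [h _ _] := hg. Qed.

Lemma cent_iter n p : g (iter n f p) = iter n f (g p).
Proof. by elim: n => //= n <-. Qed.

(** The zeros of X are the points fixed by f^q. *)
Lemma cent_zero x : (X (G x) == 0) = (X x == 0).
Proof.
have key y : X y != 0 -> proj (iter q F y) <> proj y.
  move=> y0 /(model_T_proj hM); rewrite (model_Titer hM)// divff ?gt_eqF ?(model_qR hM)// => h; lra.
apply/eqP/eqP => [G0|x0].
  apply/eqP; apply: contrapT => /negP x0; apply: (key _ x0).
  apply: (can_inj (@diff_funK _ g)).
  rewrite -!(model_iterE hf) cent_iter gE (model_iterE hf) (model_fix hM G0) proj_int//.
apply/eqP; apply: contrapT => /negP Gx0; apply: (key _ Gx0).
by rewrite -(model_iterE hf) -gE -cent_iter (model_iterE hf) (model_fix hM x0) proj_int.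
Qed.

(** f^q is the time one map. Lifts of commuting maps commute up to an integer,
    which vanishes since both sides agree at a zero. *)
Lemma cent_flow1 x : G (phi 1 x) = phi 1 (G x).
Proof.
have l1 : is_C1_lift (fun p => g (iter q f p)) (fun x => G (phi 1 x)).
  apply: lift_is_C1_lift (lift_comp hG (flow_lift hC 1)) _ => a.
  by rewrite (model_iterE hf) (model_iterq hM) proj_int gE.
have l2 : is_C1_lift (fun p => g (iter q f p)) (fun x => phi 1 (G x)).
  apply: lift_is_C1_lift (lift_comp (flow_lift hC 1) hG) _ => a.
  by rewrite cent_iter gE (model_iterE hf) (model_iterq hM) proj_int.
have [k hk] := C1_lift_unique l1 l2.
have [z z0] := clock_zero hC.
have Gz0 : X (G z) = 0 by apply/eqP; rewrite cent_zero z0.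
have := hk z; rewrite (flow_zero T 1 z0) (flow_zero T 1 Gz0) => h.
by rewrite hk; lra.
Qed.

Lemma cent_flow_int (k : int) x : G (phi k%:~R x) = phi k%:~R (G x).
Proof.
have hn n y : G (phi n%:R y) = phi n%:R (G y).
  elim: n y => [|n IH] y; first by rewrite !(flow0 hC).
  by rewrite -natr1 !(flowD hC) IH cent_flow1.
case: k => n; first exact: hn.
rewrite NegzE mulrNz.
by rewrite -[LHS](flowK hC n.+1%:R) -hn -(flowD hC) subrr (flow0 hC).
Qed.

(** Differentiate the previous identity at z. *)
Lemma cent_slope z : X z = 0 -> derive1 X (G z) = derive1 X z.
Proof.
move=> z0; have Gz0 : X (G z) = 0 by apply/eqP; rewrite cent_zero z0.
have d1 : der (fun x => G (phi 1 x)) z (derive1 G z * expR (derive1 X z)).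
  apply: der_comp; first by rewrite (flow_zero T 1 z0); exact: lift_der hG.
  by rewrite -[derive1 X z]mulr1; exact: (flow_derive_zero hC 1 z0).
have d2 : der (fun x => G (phi 1 x)) z (expR (derive1 X (G z)) * derive1 G z).
  apply: (der_ext (f := fun x => phi 1 (G x))); first exact: cent_flow1.
  apply: der_comp; last exact: lift_der hG.
  by rewrite -[derive1 X _]mulr1; exact: (flow_derive_zero hC 1 Gz0).
have := der_derive1 d1; rewrite (der_derive1 d2) mulrC => /(mulfI (lift_derive_neq0 z hG)).
exact: expR_inj.
Qed.

(** The argument that makes C^1 centralizers small: a C^1 map commuting with a
    linear contraction is linear, because rescaling by the contraction replaces
    its difference quotients by those at arbitrarily small scale. *)
Lemma cent_linear z : X z = 0 -> exists2 r : R, 0 < r &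
  forall x, `|x - z| < r -> G x = G z + derive1 G z * (x - z).
Proof.
move=> z0; have Gz0 : X (G z) = 0 by apply/eqP; rewrite cent_zero z0.
have [l0 _] := zero_germ hC z0.
pose k : int := if derive1 X z < 0 then 1 else -1.
pose nu := expR (derive1 X z * k%:~R).
have nu0 : 0 < nu by exact: expR_gt0.
have nu1 : nu < 1.
  have kE : k%:~R = if derive1 X z < 0 then 1 else -1 :> R.
    by rewrite /k; case: ifP; rewrite ?mulrNz.
  rewrite /nu -[ltRHS]expR0 ltr_expR kE; case: ifP => [h|/negbT]; first by rewrite mulr1.
  by rewrite -leNgt le_eqVlt eq_sym (negbTE l0)/= => h; rewrite mulrN mulr1 oppr_lt0.
have [r1 r10 H1] := flow_linear hC k%:~R z0.
have [r2 r20 H2] := flow_linear hC k%:~R Gz0.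
rewrite -/nu in H1; rewrite (cent_slope z0) -/nu in H2.
have /continuous_ball/(_ r2 r20)[r3 r30 H3] := @lift_cont _ _ _ hG z.
exists (Num.min r1 r3) => [|x]; first by rewrite lt_min r10.
rewrite lt_min => /andP[xr1 xr3].
have scaled n : `|(z + nu ^+ n * (x - z)) - z| <= `|x - z|.
  rewrite addrAC subrr add0r normrM ger0_norm ?exprn_ge0 ?(ltW nu0)//.
  by rewrite ler_piMl// exprn_ile1// ltW.
have scale n : G (z + nu ^+ n * (x - z)) - G z = nu ^+ n * (G x - G z).
  elim: n => [|n IH]; first by rewrite expr0 !mul1r (addrC z) subrK.
  set y := z + nu ^+ n * (x - z) in IH.
  have -> : z + nu ^+ n.+1 * (x - z) = z + nu * (y - z) by rewrite /y exprS; ring.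
  have yr := scaled n; rewrite -/y in yr.
  rewrite -H1; last exact: le_lt_trans yr xr1.
  rewrite cent_flow_int H2; last by apply: H3; exact: le_lt_trans yr xr3.
  by rewrite IH exprS; ring.
apply/eqP; rewrite -subr_eq0 -normr_le0; apply/ler_addgt0Pr => eps eps0.
rewrite add0r.
have [->|xz] := eqVneq x z; first by rewrite subrr mulr0 addr0 subrr normr0 ltW.
have xz0 : 0 < `|x - z| by rewrite normr_gt0 subr_eq0.
have eps1 : 0 < eps / `|x - z| by rewrite divr_gt0.
have /continuous_ball/(_ _ eps1)[d d0 Hd] := @lift_derive_cont _ _ _ hG z.
have [n hn] : exists n, nu ^+ n * `|x - z| < d.
  have : nu ^+ n @[n --> \oo] --> (0 : R) by apply: cvg_expr; rewrite ger0_norm// ltW.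
  move=> /cvgrPdist_lt/(_ (d / `|x - z|)); rewrite divr_gt0// => /(_ isT)[n _ Hn].
  exists n; rewrite -ltr_pdivlMr//; have := Hn n (leqnn n).
  by rewrite /= sub0r normrN ger0_norm// exprn_ge0// ltW.
have nun0 : 0 < nu ^+ n by rewrite exprn_gt0.
set h := nu ^+ n * (x - z).
have [c hc] := lift_mvt z (z + h) hG; rewrite scale addrAC subrr add0r => E.
have cz : `|derive1 G c - derive1 G z| < eps / `|x - z|.
  apply: Hd; apply: le_lt_trans (between_dist hc) _.
  by rewrite addrAC subrr add0r /h normrM gtr0_norm.
have -> : G x - (G z + derive1 G z * (x - z)) = (derive1 G c - derive1 G z) * (x - z).
  apply: (mulfI (lt0r_neq0 nun0)); rewrite mulrBr mulrDr.
  have : nu ^+ n * G x = nu ^+ n * G z + derive1 G c * h by rewrite -E; ring.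
  by move=> ->; rewrite /h; ring.
by rewrite normrM -ler_pdivlMr// ltW.
Qed.

(** How much G advances the clock; it measures the distance of G from the flow. *)
Definition shift_time x := T (G x) - T x.

Lemma zero_isolated z : X z = 0 -> exists2 r : R, 0 < r & forall x, 0 < `|x - z| < r -> X x != 0.
Proof. by move=> z0; have [_ [c [r r0 H]]] := zero_germ hC z0; exists r => // x /H[]. Qed.

Lemma zeros_sparse a b : a < b -> exists2 w, a < w < b & ~ (X w = 0).
Proof.
move=> ab; have [m0|m0] := eqVneq (X ((a + b) / 2)) 0; last first.
  by exists ((a + b) / 2); [apply/andP; split; lra|exact/eqP].
have [r r0 H] := zero_isolated m0.
have d0 : 0 < Num.min r (b - a) by rewrite lt_min r0 subr_gt0.
pose w := (a + b) / 2 + Num.min r (b - a) / 4.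
have h1 : Num.min r (b - a) <= r by rewrite ge_min lexx.
have h2 : Num.min r (b - a) <= b - a by rewrite ge_min lexx orbT.
exists w; first by rewrite /w; apply/andP; split; lra.
apply/eqP; apply: H; rewrite /w addrAC subrr add0r gtr0_norm ?divr_gt0//; lra.
Qed.

(** Expansion of [shift_time] at a zero: equal one-sided values if g preserves
    the orientation, while an orientation reversing g exchanges the two sides. *)
Lemma shift_time_germ z : X z = 0 -> exists B, exists2 r : R, 0 < r & forall y, 0 < y < r ->
  let J := if e' == 1 then 0 else side_jump e (derive1 X z) in
  shift_time (z + y) = B - J /\ shift_time (z - y) = B + J.
Proof.
move=> z0; have Gz0 : X (G z) = 0 by apply/eqP; rewrite cent_zero z0.
have [r1 r10 H1] := cent_linear z0.
have [l0 [c [r2 r20 H2]]] := zero_germ hC z0; have [_ [c' [r3 r30 H3]]] := zero_germ hC Gz0.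
rewrite (cent_slope z0) in H3; set l := derive1 X z in l0 H2 H3 *.
have mu0 := lift_derive_neq0 z hG; set mu := derive1 G z in H1 mu0.
have nmu0 : 0 < `|mu| by rewrite normr_gt0.
exists (ln `|mu| / l + c' - c), (Num.min r1 (Num.min r2 (r3 / `|mu|))).
  by rewrite !lt_min r10 r20 divr_gt0.
move=> y /andP[y0]; rewrite !lt_min => /and3P[yr1 yr2]; rewrite ltr_pdivlMr// => yr3.
have ny : `|y| = y by rewrite gtr0_norm.
have e1 : z + y - z = y by ring. have e2 : z - y - z = - y by ring.
rewrite /shift_time (H1 (z + y)) ?e1 ?ny// (H1 (z - y)) ?e2 ?normrN ?ny//.
have g1 : G z + mu * y - G z = mu * y by ring. have g2 : G z + mu * - y - G z = - (mu * y) by ring.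
have nmy : `|mu * y| = y * `|mu| by rewrite normrM ny mulrC.
have [|_ _ ->] := H3 (G z + mu * y); first by rewrite g1 nmy mulr_gt0.
have [|_ _ ->] := H3 (G z + mu * - y); first by rewrite g2 normrN nmy mulr_gt0.
have [|_ _ ->] := H2 (z + y); first by rewrite e1 ny y0.
have [|_ _ ->] := H2 (z - y); first by rewrite e2 normrN ny y0.
rewrite g1 g2 e1 e2 !normrN nmy ny lnM ?posrE//.
rewrite !ltrDl oppr_gt0 y0 (ltNge y 0) (ltW y0)/=.
have mug := lift_derive_gt0 hG z; rewrite -/mu in mug.
case: (lift_sgn hG) => e'1; rewrite e'1 in mug *.
  rewrite eqxx mul1r in mug *; rewrite pmulr_rgt0// y0 pmulr_rgt0// oppr_gt0 (ltNge y 0) (ltW y0)/=.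
  by split; ring.
have -> : (- 1 == 1 :> R) = false by apply/negbTE; rewrite lt_eqF//; lra.
have mun : mu < 0 by lra.
rewrite nmulr_rgt0// (ltNge y 0) (ltW y0)/= nmulr_rgt0// oppr_lt0 y0.
by split; ring.
Qed.

(** In integral time the flow brings x0 close to one end of its arc, in the past if
    this end is repelling. *)
Lemma arc_near_end x0 : X x0 != 0 -> exists2 a, X a = 0 & forall r, 0 < r ->
  exists k : int, a < phi k%:~R x0 < a + r.
Proof.
move=> x00; have [a [b [/andP[ax xb] a0 b0 H]]] := arc_ends hC x00.
exists a => // r r0.
have [l0 [c [r1 r10 H1]]] := zero_germ hC a0.
pose y := a + Num.min (Num.min r r1) (b - a) / 2.
have mp : 0 < Num.min (Num.min r r1) (b - a) by rewrite !lt_min r0 r10 subr_gt0 (lt_trans ax).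
have : y - a < Num.min (Num.min r r1) (b - a) by rewrite /y; lra.
have ya : a < y by rewrite /y; lra.
rewrite !lt_min => /andP[/andP[yr yr1] yb].
have xy : same_arc X x0 y by apply: H; apply/andP; split; lra.
have [|Xy _ _] := H1 y; first by rewrite gtr0_norm ?subr_gt0// ya.
have ck := archi_boundP (normr_ge0 (T x0 - T y)); set n := Num.bound _ in ck.
pose k : int := if 0 < derive1 X a then - n%:Z else n%:Z.
have kE : k%:~R = if 0 < derive1 X a then - n%:R else n%:R :> R.
  by rewrite /k; case: ifP; rewrite ?mulrNz.
exists k; have [h1 h2] := flowP hC k%:~R x00.
set w := phi k%:~R x0 in h1 h2 *.
have aw : a < w.
  rewrite ltNge; apply/negP => wa; have := h1 a; rewrite a0 eqxx.
  by move=> h; have : false by apply: h; right; rewrite wa ltW.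
rewrite aw/=; apply: le_lt_trans (_ : y < a + r); last by lra.
have sy := same_arc_trans (same_arc_sym h1) xy.
have [c' hc' E] := T_mvt hC sy.
rewrite leNgt; apply/negP => yw.
have nT := ler_norm (T x0 - T y); have := ler_norm (- (T x0 - T y)); rewrite normrN => nT'.
have sc : same_arc X c' y.
  move=> u hu; apply: sy; right.
  exact: between_between yw hc' hu.
have := same_arc_sgn hC sc; rewrite Xy => sg.
have yaP : 0 < y - a by rewrite subr_gt0.
move: h2; rewrite kE; case: ifP => [lp h2|/negbT]; last rewrite -leNgt le_eqVlt (negbTE l0)/= => ln h2.
  have Xc : 0 < X c' by move: sg; rewrite pmulr_lgt0// mulr_gt0.
  have Xc' : 0 < (X c')^-1 by rewrite invr_gt0.
  have : (X c')^-1 * (y - w) < 0 by rewrite pmulr_rlt0// subr_lt0.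
  by rewrite -E h2; lra.
have Xc : X c' < 0 by move: sg; rewrite nmulr_lgt0// nmulr_rlt0.
have Xc' : (X c')^-1 < 0 by rewrite invr_lt0.
have : 0 < (X c')^-1 * (y - w) by rewrite nmulr_rgt0// subr_lt0.
by rewrite -E h2; lra.
Qed.

(** [shift_time] is invariant under the time one map, which moves a neighbourhood of
    x0 close to the end of its arc, where G is affine and [shift_time] constant. *)
Lemma shift_time_locally_cst x0 : X x0 != 0 ->
  exists2 r : R, 0 < r & forall x, `|x - x0| < r -> shift_time x = shift_time x0.
Proof.
move=> x00; have [a a0 Ha] := arc_near_end x00.
have [B [r r0 HB]] := shift_time_germ a0.
have [k /andP[k1 k2]] := Ha r r0.
have inv x : X x != 0 -> shift_time (phi k%:~R x) = shift_time x.
  move=> xn; rewrite /shift_time cent_flow_int.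
  have Gn : X (G x) != 0 by rewrite cent_zero.
  by have [_ ->] := flowP hC k%:~R xn; have [_ ->] := flowP hC k%:~R Gn; ring.
have val w : a < w < a + r -> shift_time w = B - (if e' == 1 then 0 else side_jump e (derive1 X a)).
  move=> /andP[h1 h2]; have [|] := HB (w - a); first by apply/andP; split; lra.
  by rewrite (_ : a + (w - a) = w)//; ring.
have cp : {for x0, continuous (phi k%:~R)} by exact: (lift_cont (flow_lift hC k%:~R)).
have /near_ball[d1 d10 Hd1] := continuous_near_gt cp k1.
have /near_ball[d2 d20 Hd2] := continuous_near_lt cp k2.
have [d3 d30 Hd3] := same_arc_near hC x00.
exists (Num.min d1 (Num.min d2 d3)) => [|x]; first by rewrite !lt_min d10 d20.
rewrite !lt_min => /and3P[/Hd1 h1 /Hd2 h2 /Hd3 /same_arcr h3].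
by rewrite -(inv x)// -(inv x0)// !val ?k1 ?h1.
Qed.

(** With t chosen such that G and the flow have the same derivative at p0, they agree
    near p0. The agreement extends along each arc since [shift_time] is constant
    there, and across a zero since both maps are affine near it. *)
Lemma cent_preserving : e' = 1 -> G p0 = p0 -> exists t, forall x, G x = phi t x.
Proof.
move=> e'1 Gp; have [p00 _] := model_p0 hM.
have hG1 : lift 1 G by rewrite -e'1.
have mu0 : 0 < derive1 G p0 by have := lift_derive_gt0 hG1 p0; rewrite mul1r.
have [l0 _] := zero_germ hC p00.
pose t := ln (derive1 G p0) / derive1 X p0.
have tE : expR (derive1 X p0 * t) = derive1 G p0.
  by rewrite /t mulrC divfK// lnK.
have [r1 r10 H1] := cent_linear p00; have [r2 r20 H2] := flow_linear hC t p00.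
have [rs rs0 Hs] := model_zeros_separated hM.
(* Agreement at one point near a zero forces G to fix this zero, by separation
   of the zeros, and to have the same slope as the flow. *)
have atzero z : X z = 0 -> exists2 r : R, 0 < r & forall x, 0 < `|x - z| < r -> G x = phi t x ->
    forall y, `|y - z| < r -> G y = phi t y.
  move=> z0; have [ra ra0 Ha] := cent_linear z0; have [rb rb0 Hb] := flow_linear hC t z0.
  have [K K1 HK] : exists2 K, 0 < K & `|expR (derive1 X z * t) - derive1 G z| <= K.
    exists (`|expR (derive1 X z * t) - derive1 G z| + 1); last by rewrite lerDl.
    by rewrite ltr_wpDl.
  exists (Num.min ra (Num.min rb (rs / K))); first by rewrite !lt_min ra0 rb0 divr_gt0.
  move=> x /andP[xz]; rewrite !lt_min => /and3P[xa xb]; rewrite ltr_pdivlMr// => xs.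
  rewrite Ha// Hb// => E y; rewrite !lt_min => /and3P[ya yb _]; rewrite Ha// Hb//.
  have Gz : G z = z.
    apply: Hs => //; first by apply/eqP; rewrite cent_zero z0.
    have -> : G z - z = (expR (derive1 X z * t) - derive1 G z) * (x - z).
      by rewrite mulrBl; exact: subr_exchange.
    by rewrite normrM; apply: le_lt_trans xs; rewrite mulrC ler_wpM2l.
  rewrite Gz in E *; congr (_ + _ * _); move/addrI: E => /mulIf; apply.
  by rewrite -normr_gt0.
have perG x (k : int) : G x = phi t x -> G (x + k%:~R) = phi t (x + k%:~R).
  by move=> h; rewrite (lift_addint _ _ hG1) mul1r h (flow_int hC).
pose rr := Num.min r1 r2; have rr0 : 0 < rr by rewrite lt_min r10.
have [ri ri0 Hi] := zero_isolated p00.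
pose x1 := p0 + Num.min rr ri / 2.
have mp : 0 < Num.min rr ri by rewrite lt_min rr0.
have x1p : `|x1 - p0| < Num.min rr ri by rewrite /x1 addrAC subrr add0r gtr0_norm ?divr_gt0//; lra.
have x1p' : 0 < `|x1 - p0| by rewrite /x1 addrAC subrr add0r gtr0_norm divr_gt0.
move: x1p; rewrite !lt_min => /andP[/andP[x1a x1b] x1i].
have Px1 : G x1 = phi t x1 by rewrite H1// H2// Gp tE.
have nx1 : X x1 <> 0 by apply/eqP; apply: Hi; rewrite x1p'.
have right := @rightward_induction R (fun x => X x = 0) (fun x => G x = phi t x) x1 zeros_sparse nx1 Px1.
have offZ x : X x <> 0 -> G x = phi t x.
  move=> xn; have [k /andP[k1 k2] _] := floor_shift x1 x.
  rewrite -[x](addrK k%:~R) -mulrNz; apply: perG; apply: right => //; last by rewrite (X_int hC).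
  move=> x0; have [x00|x00] := eqVneq (X x0) 0.
    have [r r0 H] := atzero x0 x00; exists r => // y w ny nw yr wr _ Py.
    apply: (H y) => //; rewrite yr normr_gt0 subr_eq0 andbT.
    by apply: contra_notN ny => /eqP ->.
  have [ra ra0 Ha] := same_arc_near hC x00; have [rb rb0 Hb] := shift_time_locally_cst x00.
  exists (Num.min ra rb) => [|y w ny nw]; first by rewrite lt_min ra0.
  rewrite !lt_min => /andP[ya yb] /andP[wa wb] _ Py.
  have yw : same_arc X y w := same_arc_trans (same_arc_sym (Ha _ ya)) (Ha _ wa).
  have yn := same_arcl yw; have [h1 h2] := flowP hC t yn.
  apply/esym/(flow_unique hC).
    apply: same_arc_trans (same_arc_sym yw) _; apply: same_arc_trans h1 _.
    by rewrite -Py; exact: (lift_same_arc hG cent_zero yw).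
  have := Hb _ yb; rewrite -(Hb _ wb) /shift_time Py h2; lra.
exists t => x; have [x0|/eqP x0] := eqVneq (X x) 0; last exact: offZ.
have [r r0 H] := atzero x x0; have [r' r'0 H'] := zero_isolated x0.
pose y := x + Num.min r r' / 2.
have mp' : 0 < Num.min r r' by rewrite lt_min r0.
have yx : 0 < `|y - x| < Num.min r r'.
  by rewrite /y addrAC subrr add0r gtr0_norm ?divr_gt0//=; lra.
move: yx; rewrite lt_min => /and3P[y1 y2 y3].
apply: (H y); rewrite ?y1 ?subrr ?normr0//; apply: offZ.
by apply/eqP; apply: H'; rewrite y1.
Qed.

(** The time shift of an orientation reversing g would drop by two at each
    repelling zero and increase nowhere, yet it is 1-periodic. *)
Lemma cent_not_reversing : e = 1 -> e' <> -1.
Proof.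
move=> e1 e'1.
have e'n : (e' == 1) = false by rewrite e'1; apply/negbTE; rewrite lt_eqF//; lra.
have [z [z0 lz]] : exists z, X z = 0 /\ 0 < derive1 X z.
  have [a a0] := clock_zero hC; have [l0 _] := zero_germ hC a0.
  case: (ltP 0 (derive1 X a)) => la; first by exists a.
  have [r r0 H] := zero_isolated a0.
  have xn : X (a + r / 2) != 0.
    by apply: H; rewrite addrAC subrr add0r gtr0_norm ?divr_gt0//=; lra.
  have [b [bx b0] Hb] := zero_right hC xn.
  exists b; split=> //.
  have ab : a < b by lra.
  have := model_alternate hM ab a0 b0; rewrite nmulr_rlt0; last by rewrite lt_neqAle l0.
  apply=> c /andP[ac cb]; case: (leP (a + r / 2) c) => h; first by apply: Hb; rewrite h.
  by apply: H; rewrite gtr0_norm ?subr_gt0// ac/=; lra.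
have [B [r r0 HB]] := shift_time_germ z0.
have [ri ri0 Hi] := zero_isolated z0.
rewrite e'n /side_jump e1 eqxx lz /= in HB.
have mp : 0 < Num.min (Num.min r ri) 1 by rewrite !lt_min r0 ri0 ltr01.
pose y := Num.min (Num.min r ri) 1 / 3.
have y0 : 0 < y by rewrite /y; lra.
have y3 : y * 3 = Num.min (Num.min r ri) 1 by rewrite /y; field.
have : y < Num.min (Num.min r ri) 1 by rewrite /y; lra.
have y31 : y * 3 <= 1 by rewrite y3 ge_min lexx orbT.
rewrite !lt_min => /andP[/andP[yr yri] y1].
have [|h1 h2] := HB y; first by rewrite y0.
have per x : shift_time (x + 1) = shift_time x.
  rewrite /shift_time (lift_add1 hG) e'1 (clock_T1 hC); congr (_ - _).
  by rewrite -(clock_T1 hC (G x - 1)) subrK.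
have nz1 : ~ X (z + y) = 0 by apply/eqP; apply: Hi; rewrite addrAC subrr add0r gtr0_norm ?y0.
have nz2 : ~ X (z - y + 1) = 0.
  by apply/eqP; rewrite (clock_X1 hC); apply: Hi; rewrite addrAC subrr add0r normrN gtr0_norm ?y0.
have := @rightward_induction R (fun x => X x = 0) (fun x => shift_time x <= B - 1) (z + y) zeros_sparse nz1.
rewrite h1 lexx => /(_ isT) H.
suff : shift_time (z - y + 1) <= B - 1 by rewrite per h2; lra.
apply: H => //; last by lra.
move=> x0; have [x00|x00] := eqVneq (X x0) 0; last first.
  have [rb rb0 Hb] := shift_time_locally_cst x00; exists rb => // u v _ _ /Hb -> /Hb -> //.
have [B' [r' r'0 HB']] := shift_time_germ x00; exists r' => // u v nu nv ur vr uv.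
rewrite e'n in HB'; set J := side_jump e _ in HB'.
have J0 : 0 <= J by rewrite /J /side_jump; case: ifP.
have ge w : ~ X w = 0 -> `|w - x0| < r' -> (w < x0 -> shift_time w = B' + J) /\ (x0 < w -> shift_time w = B' - J).
  move=> nw; rewrite ltr_norml => /andP[w1 w2]; split=> h.
    have [|_] := HB' (x0 - w); first by apply/andP; split; lra.
    by rewrite (_ : x0 - (x0 - w) = w)//; ring.
  have [|] := HB' (w - x0); first by apply/andP; split; lra.
  by rewrite (_ : x0 + (w - x0) = w)//; ring.
have [u1 u2] := ge u nu ur; have [v1 v2] := ge v nv vr.
have nx w : ~ X w = 0 -> w < x0 \/ x0 < w.
  by move=> nw; case: (ltgtP w x0) => h; [left|right|rewrite h in nw].
case: (nx u nu) => hu; case: (nx v nv) => hv; rewrite ?(u1 hu) ?(u2 hu) ?(v1 hv) ?(v2 hv)//; lra.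
Qed.

End OneLift.

Definition flow_diff t : diff1 R := sval (cid (diff_of_lift (flow_lift hC t))).

Lemma flow_diff_lift t : is_C1_lift (flow_diff t) (phi t).
Proof. exact: (svalP (cid (diff_of_lift (flow_lift hC t)))). Qed.

Lemma flow_diffE t a : flow_diff t (proj a) = proj (phi t a).
Proof. by have [h _ _] := flow_diff_lift t. Qed.

Lemma diff_mulE (u v : diff1 R) p : (u * v)%g p = u (v p).
Proof. by []. Qed.

Lemma diff_expE (u : diff1 R) n p : (u ^+ n)%g p = iter n u p.
Proof. by elim: n => [|n IH] //; rewrite expgS diff_mulE IH. Qed.

Lemma flow_diffD s t : flow_diff (s + t) = (flow_diff s * flow_diff t)%g.
Proof.
by apply: diff1_ext; apply: proj_ind => a; rewrite diff_mulE !flow_diffE (flowD hC).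
Qed.

Lemma flow_diff0 : flow_diff 0 = 1%g.
Proof. by apply: diff1_ext; apply: proj_ind => a; rewrite flow_diffE (flow0 hC). Qed.

Lemma flow_diff_inj s t : flow_diff s = flow_diff t -> s = t.
Proof.
move=> h; have [p00 _] := model_p0 hM.
have [w _ /eqP w0] := zeros_sparse (@ltr01 R).
have : proj (phi s w) = proj (phi t w) by rewrite -!flow_diffE h.
move=> /(model_T_proj hM).
by have [_ ->] := flowP hC s w0; have [_ ->] := flowP hC t w0 => /addrI.
Qed.

Lemma flow_diff_commute t : commute f (flow_diff t).
Proof.
apply: diff1_ext; apply: proj_ind => a; have [fE _ _] := hf.
by rewrite !diff_mulE flow_diffE !fE flow_diffE (model_commute hM).
Qed.

(** A generator of the finite factor: f composed with the flow at time -1/q. *)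
Definition rotation : diff1 R := (flow_diff (- q%:R^-1) * f)%g.

Lemma rotation_exp n : (rotation ^+ n)%g = (flow_diff (- (n%:R / q%:R)) * f ^+ n)%g.
Proof.
rewrite expgMn; last exact/commute_sym/flow_diff_commute.
congr (_ * _)%g; elim: n => [|n IH]; first by rewrite mul0r oppr0 flow_diff0.
by rewrite expgS IH -flow_diffD; congr flow_diff; rewrite -[n.+1%:R]natr1; ring.
Qed.

Lemma rotation_q : (rotation ^+ q)%g = 1%g.
Proof.
rewrite rotation_exp divff ?gt_eqF ?(model_qR hM)//.
apply: diff1_ext; apply: proj_ind => a.
rewrite diff_mulE diff_expE (model_iterE hf) flow_diffE (model_iterq hM) (flow_int hC) proj_int.
by rewrite (flowK hC).
Qed.

Lemma rotation_flow_commute t : commute (flow_diff t) rotation.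
Proof.
apply: commuteM; last exact/commute_sym/flow_diff_commute.
by rewrite /commute -!flow_diffD addrC.
Qed.

Lemma rotation_exp_mod n : (rotation ^+ (n %% q))%g = (rotation ^+ n)%g.
Proof. by rewrite {2}(divn_eq n q) expgnDr mulnC expgnA rotation_q expg1n mul1g. Qed.

Lemma flow_rotation_exp t n :
  (flow_diff t * rotation ^+ n)%g = (flow_diff (t - n%:R / q%:R) * f ^+ n)%g.
Proof. by rewrite rotation_exp mulgA -flow_diffD. Qed.

(** Two different powers of f differ at p0, or in orientation, from each other
    composed with elements of the flow. *)
Lemma rotation_exp_inj i j : (i < q)%N -> (j < q)%N ->
  forall s t, (flow_diff s * rotation ^+ i)%g = (flow_diff t * rotation ^+ j)%g -> i = j.
Proof.
move=> iq jq s t; rewrite (flow_rotation_exp s) (flow_rotation_exp t).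
set s' := s + _; set t' := t + _ => h.
have [p00 _] := model_p0 hM.
case: (model_sgn hM) => [[e1 _]|[e1 [q2 _]]].
  wlog lt : i j s' t' iq jq h / (i <= j)%N.
    move=> w; case/orP: (leq_total i j) => ij; first exact: (w i j s' t' iq jq h ij).
    exact: (esym (w j i t' s' jq iq (esym h) ij)).
  move: lt; rewrite leq_eqVlt => /orP[/eqP//|lt]; exfalso.
  have it0 n : X (iter n F p0) = 0 by apply/eqP; rewrite (model_XiterE hM) p00.
  have : proj (iter i F p0) = proj (iter j F p0).
    have := f_equal (fun u : diff1 R => u (proj p0)) h; rewrite !diff_mulE !diff_expE !(model_iterE hf) !flow_diffE.
    by rewrite (flow_zero T s' (it0 i)) (flow_zero T t' (it0 j)).
  rewrite -(subnK (ltnW lt)) iterD => /esym/proj_eq[k].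
  apply: (model_period_not hM e1 (it0 i)).
  by rewrite subn_gt0 lt (leq_ltn_trans (leq_subr _ _) jq).
have h1 u n : is_C1_lift (flow_diff u * f ^+ n)%g (fun x => phi u (iter n F x)).
  apply: lift_is_C1_lift (lift_comp (flow_lift hC u) (lift_iter n hF)) _ => a.
  by rewrite diff_mulE diff_expE (model_iterE hf) flow_diffE.
have d u n : 0 < e ^+ n * cderive (flow_diff u * f ^+ n)%g (proj 0).
  rewrite (cderiveE _ (h1 u n)).
  by have := lift_derive_gt0 (lift_comp (flow_lift hC u) (lift_iter n hF)) 0; rewrite mul1r.
have := d s' i; rewrite h; have := d t' j; rewrite e1.
move: (cderive _ _) => c; move: iq jq; rewrite q2.
exact: sign_parity.
Qed.

(** Up to a power of f, a diffeomorphism commuting with f preserves the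
    orientation and fixes p0, hence belongs to the flow. *)
Lemma centralizer_form (g : diff1 R) : commute f g ->
  exists i t, (f ^+ i * g)%g = flow_diff t.
Proof.
move=> cfg; have [e' [G [hG hg]]] := lift_of_diff g.
have fg p : g (f p) = f (g p) by have := f_equal (fun u : diff1 R => u p) cfg; rewrite !diff_mulE.
have [fE _ _] := hf; have [gE _ _] := hg.
have [p00 p0e] := model_p0 hM.
have Gp00 : X (G p0) = 0 by apply/eqP; rewrite (cent_zero hg fg) p00.
have [j [k Gpk]] : exists j (k : int), G p0 = iter j F p0 + k%:~R.
  apply: (model_rigid hM) => //; last exact: (cent_slope hG hg fg).
  move=> e1; have [k hk] := p0e e1; apply/proj_eq.
  by rewrite -fE -gE -fg fE hk proj_int.
have finish i e'' H : lift e'' H -> is_C1_lift (f ^+ i * g)%g H -> e'' = 1 ->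
    (f ^+ i * g)%g (proj p0) = proj p0 -> exists i t, (f ^+ i * g)%g = flow_diff t.
  move=> hH hh e''1 hp; have [hE _ _] := hh.
  have [k' hk'] : exists k' : int, H p0 = p0 + k'%:~R by apply/proj_eq; rewrite -hE.
  have hH' := lift_addc (- k'%:~R) hH.
  have hh' : is_C1_lift (f ^+ i * g)%g (fun x => H x + - k'%:~R).
    by apply: (lift_is_C1_lift hH') => a; rewrite hE -mulrNz proj_int.
  have ch p : (f ^+ i * g)%g (f p) = f ((f ^+ i * g)%g p).
    have c : commute f (f ^+ i * g)%g by apply: commuteM => //; exact/commuteX/commute_refl.
    by have := f_equal (fun u : diff1 R => u p) c; rewrite (diff_mulE f) (diff_mulE _ f) => ->.
  have [|t ht] := cent_preserving hH' hh' ch e''1; first by rewrite hk' addrK.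
  exists i, t; apply: diff1_ext; apply: proj_ind => a.
  by have [-> _ _] := hh'; rewrite ht flow_diffE.
have lifted i : is_C1_lift (f ^+ i * g)%g (fun x => iter i F (G x)).
  apply: lift_is_C1_lift (lift_comp (lift_iter i hF) hG) _ => a.
  by rewrite diff_mulE diff_expE gE (model_iterE hf).
have liftedE i := lift_comp (lift_iter i hF) hG.
case: (model_sgn hM) => [[e1 _]|[e1 [q2 _]]].
  have e'1 : e' = 1 by case: (lift_sgn hG) => // h; case: (cent_not_reversing hG hg fg e1 h).
  apply: (finish (q.-1 * j)%N _ _ (liftedE _) (lifted _)); first by rewrite e1 expr1n mul1r.
  rewrite diff_mulE diff_expE gE Gpk proj_int (model_iterE hf) -iterD.
  rewrite -{2}[j]mul1n -mulnDl addn1 prednK ?(model_q hM)//.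
  elim: j {Gpk} => [|j IH]; first by rewrite muln0.
  have itq0 : X (iter (q * j) F p0) = 0 by apply/eqP; rewrite (model_XiterE hM) p00.
  by rewrite mulnS iterD (model_fix hM itq0) proj_int.
have fp : f (proj p0) = proj p0 by have [k' hk'] := p0e e1; rewrite fE hk' proj_int.
have gp : g (proj p0) = proj p0.
  by rewrite gE Gpk proj_int -(model_iterE hf); elim: j {Gpk} => //= j ->.
case: (lift_sgn hG) => e'1.
  by apply: (finish 0%N _ _ (liftedE _) (lifted _)); rewrite ?expr0 ?mul1r// diff_mulE gp.
apply: (finish 1%N _ _ (liftedE _) (lifted _)).
  by rewrite expr1 e1 e'1 mulrNN mulr1.
by rewrite diff_mulE gp expg1.
Qed.

Lemma model_centralizer : centralizer_isog f q.
Proof.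
exists (fun u : R * 'I_q.-1.+1 => (flow_diff u.1 * rotation ^+ (u.2 : nat))%g).
have qE : q.-1.+1 = q by rewrite prednK// (model_q hM).
have ltq (i : 'I_q.-1.+1) : (i < q)%N by rewrite -{2}qE ltn_ord.
have comm n t : commute (flow_diff t) (rotation ^+ n)%g by apply/commuteX/rotation_flow_commute.
split; last first.
  move=> [s i] [t j] /=; rewrite flow_diffD.
  have -> : (rotation ^+ ((i + j)%R : 'I_q.-1.+1))%g = (rotation ^+ i * rotation ^+ j)%g.
    have E n : (n %% q.-1.+1 = n %% q)%N by rewrite qE.
    by rewrite /= E rotation_exp_mod expgnDr.
  rewrite !mulgA; congr (_ * _)%g; rewrite -!mulgA; congr (_ * _)%g; exact: comm.
split.
- move=> [t i] _ /=; apply: commuteM; first exact: flow_diff_commute.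
  apply: commuteX; apply: commuteM; [exact: flow_diff_commute|exact: commute_refl].
- move=> [s i] [t j] _ _ /= h.
  have ij := rotation_exp_inj (ltq i) (ltq j) h.
  have {ij}ij : i = j by exact: val_inj.
  move: h; rewrite ij => /mulIg/flow_diff_inj -> //.
- move=> g cfg; have [i [t h]] := centralizer_form cfg.
  have jlt : ((q - i %% q) %% q < q.-1.+1)%N by rewrite qE ltn_mod (model_q hM).
  exists (t - i%:R / q%:R, Ordinal jlt) => //=.
  have rr : (rotation ^+ ((q - i %% q) %% q) * rotation ^+ i = 1)%g.
    rewrite rotation_exp_mod -(rotation_exp_mod i) -expgnDr subnK ?rotation_q//.
    by rewrite ltnW// ltn_mod (model_q hM).
  have fi : (f ^+ i)%g = (flow_diff (i%:R / q%:R) * rotation ^+ i)%g.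
    by rewrite rotation_exp mulgA -flow_diffD subrr flow_diff0 mul1g.
  have : (flow_diff (- (i%:R / q%:R)) * rotation ^+ ((q - i %% q) %% q) * (f ^+ i * g))%g = g.
    rewrite fi (comm _ (- _)) -!mulgA (mulgA (flow_diff (- _))) -flow_diffD addNr flow_diff0 mul1g.
    by rewrite mulgA rr mul1g.
  rewrite h => <-; rewrite addrC flow_diffD -!mulgA; congr (_ * _)%g; exact: comm.
Qed.

End Centralizer.
(** * Approximation by smooth lifts with affine germs *)

Section Approximation.
Context {R : realType}.
Implicit Types (F G : R -> R) (a b c d e r s w x y z : R).

Definition C1_close d F G := forall x, `|F x - G x| < d /\ `|derive1 F x - derive1 G x| < d.

Lemma C1_closeW d d' F G : d <= d' -> C1_close d F G -> C1_close d' F G.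
Proof. by move=> dd h x; have [h1 h2] := h x; split; exact: lt_le_trans dd. Qed.

Lemma C1_close_trans d d' F G H : C1_close d F G -> C1_close d' G H -> C1_close (d + d') F H.
Proof.
move=> h h' x; have [h1 h2] := h x; have [h3 h4] := h' x.
by split; [apply: le_lt_trans (ler_distD (G x) _ _) _|apply: le_lt_trans (ler_distD (derive1 G x) _ _) _];
  exact: ltrD.
Qed.

(** The derivative of F is bounded away from 0. *)
Lemma lift_of_close e F : lift e F -> exists2 d : R, 0 < d & forall G,
  (forall x, G (x + 1) = G x + e) -> (forall x, derivable G x 1) -> continuous (derive1 G) ->
  (forall x, `|derive1 F x - derive1 G x| < d) -> lift e G.
Proof.
move=> hF.
have [x|x|x|c c0 H] := @periodic_min R (fun x => e * derive1 F x).
- by apply: cvgM; [exact: cvg_cst|exact: lift_derive_cont hF x].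
- by rewrite (lift_derive_add1 x hF).
- exact: lift_derive_gt0 hF x.
exists c => // G G1 dG cG hG; split=> // [|x]; first exact: lift_sgn hF.
have := H x; have := hG x; rewrite ltr_norml => /andP[h1 h2].
by case: (lift_sgn hF) => ->; rewrite ?mul1r ?mulN1r; lra.
Qed.

Lemma smooth_derive_cont F : smooth F -> continuous (derive1 F).
Proof. by move=> h x; apply: smooth_at_continuous; exact/smooth_at_derive1. Qed.

Section Smoothing.
Context (e : R) (F : R -> R) (hF : lift e F) (M : nat) (M0 : (0 < M)%N).

Let node (i : int) : R := i%:~R / M%:R.
Let tangent i x := F (node i) + derive1 F (node i) * (x - node i).
Let piece (i : int) x := tangent i x + step (3 * (M%:R * x - i%:~R) - 1) * (tangent (i + 1) x - tangent i x).

(** The tangent lines of F at the multiples of 1/M are glued in the middle third of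
    each cell, so that at most one step is active near any point; the grid being
    invariant under translation by 1, the result is again a lift. *)
Definition smoothing x : R := piece (Num.floor (M%:R * x)) x.

Let MR : 0 < M%:R :> R. Proof. by rewrite ltr0n. Qed.

Lemma smoothing_near x0 : \forall x \near x0, smoothing x = piece (Num.floor (M%:R * x0)) x.
Proof.
set i := Num.floor _.
have /andP[i1 i2] := floor_itv (M%:R * x0); rewrite -/i intrD in i1 i2.
have h1 : (i%:~R - 3^-1) / M%:R < x0 by rewrite ltr_pdivrMr// mulrC; lra.
have h2 : x0 < (i%:~R + 1) / M%:R by rewrite ltr_pdivlMr// mulrC.
near=> x.
have : (i%:~R - 3^-1) / M%:R < x by near: x; exact: near_gt.
have : x < (i%:~R + 1) / M%:R by near: x; exact: near_lt.
rewrite ltr_pdivlMr// ltr_pdivrMr// mulrC => x1 x2.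
case: (leP i%:~R (M%:R * x)) => ix.
  by rewrite /smoothing (@floor_def _ _ i)// ix intrD x1.
have fl : Num.floor (M%:R * x) = i - 1 by apply: floor_def; rewrite !intrD mulrNz; apply/andP; split; lra.
rewrite /smoothing fl /piece subrK [step _]step1; last by rewrite intrD mulrNz; lra.
by rewrite [step _]step0; [ring|lra].
Unshelve. all: by end_near. Qed.

Lemma piece_smooth i : smooth (piece i).
Proof.
have sa j : smooth (tangent j) by move=> y; exact: smooth_at_affine.
move=> x; apply: smooth_atD; first exact: sa.
apply: smooth_atM; last by apply: smooth_atB; exact: sa.
apply: smooth_at_comp; first exact: step_smooth.
apply: smooth_atB; last exact: smooth_at_cst.
apply: smooth_atM; first exact: smooth_at_cst.
apply: smooth_atB; last exact: smooth_at_cst.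
by apply: smooth_atM; [exact: smooth_at_cst|exact: smooth_at_id].
Qed.

Lemma smoothing_smooth : smooth smoothing.
Proof. by move=> x; apply: smooth_at_near (smoothing_near x) _; exact: piece_smooth. Qed.

Lemma smoothing_add1 x : smoothing (x + 1) = smoothing x + e.
Proof.
rewrite /smoothing mulrDr mulr1.
have -> : Num.floor (M%:R * x + M%:R) = Num.floor (M%:R * x) + M%:Z.
  by rewrite floorDrz ?intr_nat// -[M%:R]/(M%:Z%:~R) intrKfloor.
set i := Num.floor _.
have nE j : node (j + M%:Z) = node j + 1.
  by rewrite /node intrD mulrDl divff// gt_eqF.
have tE j : tangent (j + M%:Z) (x + 1) = tangent j x + e.
  by rewrite /tangent nE (lift_add1 hF) (lift_derive_add1 _ hF); ring.
have tE1 : tangent (i + M%:Z + 1) (x + 1) = tangent (i + 1) x + e by rewrite addrAC tE.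
have cE : 3 * (M%:R * (x + 1) - (i + M%:Z)%:~R) - 1 = 3 * (M%:R * x - i%:~R) - 1.
  by rewrite intrD -[(M%:Z)%:~R]/(M%:R : R); ring.
by rewrite /piece tE1 tE cE; ring.
Qed.

Lemma smoothing_close S om : (forall x, `|derive1 step x| <= S) -> 0 < S ->
  (forall x y, `|y - x| <= M%:R^-1 -> `|derive1 F y - derive1 F x| < om) ->
  forall x, `|F x - smoothing x| < 4 * om /\ `|derive1 F x - derive1 smoothing x| < (3 + 6 * S) * om.
Proof.
move=> HS S0 Hom x.
have om0 : 0 < om by apply: le_lt_trans (Hom x x _); rewrite ?subrr ?normr0// invr_ge0 ltW.
set i := Num.floor (M%:R * x).
have /andP[i1 i2] := floor_itv (M%:R * x); rewrite -/i intrD in i1 i2.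
have xE : x = (M%:R * x) / M%:R by rewrite mulrC mulKf// gt_eqF.
pose h : R := M%:R^-1; have h0 : 0 < h by rewrite invr_gt0.
have h1 : h <= 1 by rewrite invf_le1// ler1n.
have Mh : M%:R * h = 1 by rewrite divff// gt_eqF.
have d1 : `|x - node i| <= h.
  rewrite xE /node -mulrBl normrM (gtr0_norm h0) ler_piMl ?(ltW h0)// ger0_norm; lra.
have d2 : `|x - node (i + 1)| <= h.
  rewrite xE /node -mulrBl normrM (gtr0_norm h0) ler_piMl ?(ltW h0)// intrD ler0_norm; lra.
have dn : `|node (i + 1) - node i| <= h.
  by rewrite /node -mulrBl intrD addrAC subrr add0r mul1r gtr0_norm.
have tg j : `|x - node j| <= h -> `|F x - tangent j x| <= om * h.
  move=> dj; have [c hc E] := lift_mvt (node j) x hF.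
  rewrite /tangent opprD addrA E -mulrBl normrM ler_pM//.
  by apply/ltW/Hom; exact: le_trans (between_dist hc) dj.
have t1 := tg i d1; have t2 := tg _ d2.
have t12 : `|tangent (i + 1) x - tangent i x| <= 2 * (om * h).
  rewrite distrC in t2; apply: le_trans (ler_distD (F x) _ _) _; lra.
have omh : om * h <= om by rewrite ler_piMr// ltW.
have st := step_ge0 (3 * (M%:R * x - i%:~R) - 1); have st1 := step_le1 (3 * (M%:R * x - i%:~R) - 1).
have Dp : der (piece i) x (derive1 F (node i) + (derive1 step (3 * (M%:R * x - i%:~R) - 1) * (3 * M%:R) *
   (tangent (i + 1) x - tangent i x) + step (3 * (M%:R * x - i%:~R) - 1) * (derive1 F (node (i + 1)) - derive1 F (node i)))).
  apply: derD; first exact: der_affine.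
  apply: derM; last by apply: derB; exact: der_affine.
  apply: (@der_comp _ step (fun x => 3 * (M%:R * x - i%:~R) - 1)); first exact: step_der.
  apply: der_eq.
    apply: derB; last exact: der_cst.
    apply: derZ; apply: derB; last exact: der_cst.
    exact: derZ (der_id x).
  by rewrite !subr0 mulr1.
have DE := der_derive1 (der_near (smoothing_near x) Dp).
split.
  rewrite /smoothing -/i /piece opprD addrA.
  apply: le_lt_trans (ler_normB _ _) _; rewrite normrM (ger0_norm st).
  have : step (3 * (M%:R * x - i%:~R) - 1) * `|tangent (i + 1) x - tangent i x| <= 1 * (2 * (om * h)).
    by rewrite ler_pM.
  lra.
rewrite DE opprD addrA.
apply: le_lt_trans (ler_normB _ _) _.
have a1 : `|derive1 F x - derive1 F (node i)| < om by exact: Hom.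
have a2 : `|derive1 F (node (i + 1)) - derive1 F (node i)| < om by exact: Hom.
apply: le_lt_trans (_ : _ <= om + (6 * S * om + om)) _; last by lra.
apply: lerD; first exact: ltW.
apply: le_trans (ler_normD _ _) _; apply: lerD.
  rewrite !normrM (gtr0_norm MR) (@gtr0_norm _ 3)//.
  apply: le_trans (_ : S * (3 * M%:R) * (2 * (om * h)) <= _).
    by rewrite ler_pM ?mulr_ge0// ler_wpM2r// mulr_ge0.
  have -> : S * (3 * M%:R) * (2 * (om * h)) = 6 * S * om * (M%:R * h) by ring.
  by rewrite Mh mulr1.
rewrite normrM (ger0_norm st); apply: le_trans (_ : 1 * om <= _); last by rewrite mul1r.
by rewrite ler_pM// ltW.
Qed.

End Smoothing.

Lemma smooth_lifts_dense e F d : lift e F -> 0 < d ->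
  exists G, [/\ lift e G, smooth G & C1_close d F G].
Proof.
move=> hF d0; have [d1 d10 H1] := lift_of_close hF.
have [S S0 HS] := @step_derive_bounded R.
pose om := Num.min d d1 / (10 * (1 + S)).
have m0 : 0 < Num.min d d1 by rewrite lt_min d0.
have om0 : 0 < om by rewrite divr_gt0// mulr_gt0// addr_gt0.
have omE : om * (10 * (1 + S)) = Num.min d d1 by rewrite divfK// gt_eqF// mulr_gt0// addr_gt0.
have [r r0 Hr] := periodic_unif (lift_derive_cont hF) (fun x => lift_derive_add1 x hF) om0.
have ib := archi_boundP (ltW (_ : 0 < r^-1)).
have := ib; rewrite invr_gt0 => /(_ r0) {}ib; set M := Num.bound _ in ib.
have M0 : (0 < M)%N by rewrite -(ltr0n R) (lt_trans _ ib)// invr_gt0.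
have MR : 0 < M%:R :> R by rewrite ltr0n.
have Mr : M%:R^-1 < r by rewrite invf_plt// posrE.
have oS : 0 < om * S by exact: mulr_gt0.
have cl' x : `|F x - smoothing F M x| < Num.min d d1 /\ `|derive1 F x - derive1 (smoothing F M) x| < Num.min d d1.
  have [|c1 c2] := smoothing_close hF M0 HS S0 (om := om) _ x.
    by move=> u v uv; apply: Hr; exact: le_lt_trans Mr.
  by rewrite -omE; split; [apply: lt_trans c1 _|apply: lt_trans c2 _]; lra.
have sm := smoothing_smooth F M0.
exists (smoothing F M); split=> //.
  apply: H1.
  - exact: (smoothing_add1 hF M0).
  - by move=> x; exact: smooth_derivable.
  - exact: smooth_derive_cont.
  - by move=> x; have [_] := cl' x; rewrite lt_min => /andP[].
by move=> x; have [] := cl' x; rewrite !lt_min => /andP[-> _] /andP[->].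
Qed.

(** ** Patching near a discrete set *)

Section Patch.
Context (W : R -> Prop) (rho : R) (rho0 : 0 < rho).
Context (sepW : forall w w', W w -> W w' -> `|w - w'| < 2 * rho -> w = w').
Context (A : R -> R) (B : R -> R -> R).

(** At most one w in W is close to x, so that the choice of w is immaterial. *)
Definition patch x : R :=
  if `[< exists w, W w /\ `|x - w| < rho >] then
    let w := xget 0 [set w | W w /\ `|x - w| < rho] in
    A x + bump ((x - w) ^+ 2 / rho ^+ 2) * (B w x - A x)
  else A x.

Lemma patch_in w x : W w -> `|x - w| < rho ->
  patch x = A x + bump ((x - w) ^+ 2 / rho ^+ 2) * (B w x - A x).
Proof.
move=> Ww xw; rewrite /patch asboolT; last by exists w.
have [W' xw'] := @xgetPex R 0 [set w | W w /\ `|x - w| < rho] (ex_intro _ w (conj Ww xw)).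
set w' := xget _ _ in W' xw' *; suff -> : w' = w by [].
apply: sepW => //; rewrite (_ : w' - w = (x - w) - (x - w')); last by ring.
by apply: le_lt_trans (ler_normB _ _) _; rewrite mulr_natl mulr2n ltrD.
Qed.

Lemma patch_out x : (forall w, W w -> 3 / 4 * rho <= `|x - w|) -> patch x = A x.
Proof.
move=> h; rewrite /patch; case: asboolP => // -[w [Ww xw]].
have [W' xw'] := @xgetPex R 0 [set w | W w /\ `|x - w| < rho] (ex_intro _ w (conj Ww xw)).
set w' := xget _ _ in W' xw' *.
rewrite bump0 ?mul0r ?addr0// ler_pdivlMr ?exprn_gt0//.
have := h _ W'; rewrite -(real_normK (num_real (x - w'))) => h'.
have n0 := normr_ge0 (x - w'); nra.
Qed.

Lemma patch_core w x : W w -> `|x - w| < rho / 2 -> patch x = B w x.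
Proof.
move=> Ww xw; have xr : `|x - w| < rho by apply: lt_trans xw _; rewrite ltr_pdivrMr// ltr_pMr// ltr1n.
rewrite (patch_in Ww xr).
rewrite bump1 ?mul1r ?subrKC//.
rewrite ler_pdivrMr ?exprn_gt0// -(real_normK (num_real (x - w))).
have n0 := normr_ge0 (x - w); nra.
Qed.

Lemma patch_near x0 :
  (exists2 w, W w & `|x0 - w| < rho /\
     \forall x \near x0, patch x = A x + bump ((x - w) ^+ 2 / rho ^+ 2) * (B w x - A x)) \/
  ((forall w, W w -> rho <= `|x0 - w|) /\ \forall x \near x0, patch x = A x).
Proof.
have [[w [Ww xw]]|h] := pselect (exists w, W w /\ `|x0 - w| < rho).
  left; exists w => //; split=> //.
  apply/near_ball; exists (rho - `|x0 - w|) => [|x xx]; first by rewrite subr_gt0.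
  apply: patch_in => //; apply: le_lt_trans (ler_distD x0 _ _) _; lra.
right; have h' w : W w -> rho <= `|x0 - w|.
  by move=> Ww; rewrite leNgt; apply/negP => xw; apply: h; exists w.
split=> //; apply/near_ball; exists (rho / 4) => [|x xx]; first by rewrite divr_gt0.
apply: patch_out => w /h' h''; have := ler_distD x x0 w; rewrite (distrC x0 x); lra.
Qed.

Lemma patch_smooth_at x0 : smooth_at A x0 ->
  (forall w, W w -> `|x0 - w| < rho -> smooth_at (B w) x0) -> smooth_at patch x0.
Proof.
move=> sA sB; case: (patch_near x0) => [[w Ww [xw h]]|[_ h]]; apply: smooth_at_near h _ => //.
apply: smooth_atD => //; apply: smooth_atM; last by apply: smooth_atB => //; exact: sB.
apply: smooth_at_comp; first exact: bump_smooth.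
apply: smooth_atM; last exact: smooth_at_cst.
have s1 : smooth_at (fun x => x - w) x0.
  by apply: smooth_atB; [exact: smooth_at_id|exact: smooth_at_cst].
by apply: smooth_at_near (smooth_atM s1 s1); near=> x; rewrite expr2.
Unshelve. all: by end_near. Qed.

Lemma patch_der w x0 a' b' : W w -> `|x0 - w| < rho -> der A x0 a' -> der (B w) x0 b' ->
  let u := (x0 - w) ^+ 2 / rho ^+ 2 in
  der patch x0 (a' + (derive1 bump u * (2 * (x0 - w) / rho ^+ 2) * (B w x0 - A x0) + bump u * (b' - a'))).
Proof.
move=> Ww xw dA dB u; case: (patch_near x0) => [[w' W' [xw' h]]|[h _]]; last first.
  by have := h w Ww; rewrite leNgt xw.
have ww : w' = w.
  apply: sepW => //; rewrite (_ : w' - w = (x0 - w) - (x0 - w')); last by ring.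
  by apply: le_lt_trans (ler_normB _ _) _; rewrite mulr_natl mulr2n ltrD.
rewrite ww in h; apply: der_near h _.
apply: derD => //; apply: derM; last exact: derB.
apply: (@der_comp _ bump (fun x => (x - w) ^+ 2 / rho ^+ 2)); first exact: bump_der.
have d1 : der (fun x => x - w) x0 1.
  by apply: der_eq; [apply: derB; [exact: der_id|exact: der_cst]|rewrite subr0].
apply: (der_ext (f := fun x => (rho ^+ 2)^-1 * ((x - w) * (x - w)))); first by move=> x; rewrite expr2 mulrC.
by apply: der_eq; [exact: (derZ _ (derM d1 d1))|rewrite /=; ring].
Qed.

Lemma patch_add1 c : (forall w, W (w + 1) <-> W w) -> (forall x, A (x + 1) = A x + c) ->
  (forall w x, W w -> B (w + 1) (x + 1) = B w x + c) ->
  forall x, patch (x + 1) = patch x + c.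
Proof.
move=> WZ A1 B1 x; case: (patch_near x) => [[w Ww [xw _]]|[h _]].
  have E : x + 1 - (w + 1) = x - w by ring.
  rewrite (patch_in Ww xw) (patch_in ((WZ w).2 Ww)) E// A1 B1//; ring.
have far y : (forall w, W w -> rho <= `|y - w|) -> forall w, W w -> 3 / 4 * rho <= `|y - w|.
  by move=> H w /H; apply: le_trans; rewrite ler_piMl// ?(ltW rho0)//; lra.
rewrite !patch_out ?A1//; first exact: far.
apply: far => w Ww; have := h (w - 1); rewrite -WZ subrK => /(_ Ww).
by rewrite (_ : x - (w - 1) = x + 1 - w)//; ring.
Qed.

End Patch.

(** ** Making a smooth lift affine near prescribed points *)

(** Near w the patched map stays C^1 close to F because the two patched functions
    differ by o(rho) on the ball of radius rho, while the derivative of the bump is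
    O(1/rho). The size of the slope change allowed is uniform in the points of W. *)
Lemma affine_germs e F (W : R -> Prop) rho0 d : lift e F -> smooth F ->
  0 < rho0 -> (forall w w', W w -> W w' -> `|w - w'| < rho0 -> w = w') ->
  (forall x (k : int), W x -> W (x + k%:~R)) -> 0 < d ->
  exists2 dl : R, 0 < dl & forall s : R -> R, (forall w (k : int), s (w + k%:~R) = s w) ->
    (forall w, W w -> `|s w - derive1 F w| < dl) ->
    exists G, [/\ lift e G, smooth G, C1_close d F G & exists2 r : R, 0 < r &
      forall w x, W w -> `|x - w| < r -> G x = F w + s w * (x - w)].
Proof.
move=> hF sF rho00 sepW WZ d0; have [d1 d10 H1] := lift_of_close hF.
have [S S0 HS] := @bump_derive_bounded R.
pose om := Num.min d d1 / (10 * (1 + S)).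
have m0 : 0 < Num.min d d1 by rewrite lt_min d0.
have om0 : 0 < om by rewrite divr_gt0// mulr_gt0// addr_gt0.
have omE : om * (10 * (1 + S)) = Num.min d d1 by rewrite divfK// gt_eqF// mulr_gt0// addr_gt0.
have oS : 0 < om * S by exact: mulr_gt0.
exists om => // s s1 hs.
have [r r0 Hr] := periodic_unif (lift_derive_cont hF) (fun x => lift_derive_add1 x hF) om0.
pose rho := Num.min (Num.min r 1) (rho0 / 2).
have rh0 : 0 < rho by rewrite !lt_min r0 ltr01 divr_gt0.
have rho1 : rho <= 1 by rewrite !ge_min lexx orbT.
have rhor : rho <= r by rewrite !ge_min lexx.
have rhoh : 2 * rho <= rho0 by have : rho <= rho0 / 2 by [rewrite !ge_min lexx orbT]; lra.
have sep w w' : W w -> W w' -> `|w - w'| < 2 * rho -> w = w'.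
  by move=> Ww Ww' ww; apply: sepW => //; exact: lt_le_trans rhoh.
pose B w x := F w + s w * (x - w).
pose G := patch W rho F B.
have sG : smooth G.
  move=> x; apply: (patch_smooth_at rh0 sep (sF x)) => w _ _; exact: smooth_at_affine.
have BF w x : W w -> `|x - w| < rho -> `|B w x - F x| <= 2 * om * `|x - w|.
  move=> Ww xw; have [c hc E] := lift_mvt w x hF.
  have -> : B w x - F x = (s w - derive1 F c) * (x - w).
    by rewrite /B mulrBl -E; ring.
  rewrite normrM ler_wpM2r//; apply: le_trans (ler_distD (derive1 F w) _ _) _.
  have h1 := hs w Ww; have : `|derive1 F c - derive1 F w| < om.
    apply: Hr; apply: le_lt_trans (between_dist hc) _; exact: lt_le_trans rhor.
  by rewrite (distrC (derive1 F w)); lra.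
have cl x : `|F x - G x| < Num.min d d1 /\ `|derive1 F x - derive1 G x| < Num.min d d1.
  case: (patch_near rh0 sep F B x) => [[w Ww [xw _]]|[_ h]]; last first.
    have -> : derive1 G x = derive1 F x.
      by apply: der_derive1; apply: der_near h _; exact: lift_der hF.
    by rewrite /G (nbhs_singleton h) !subrr normr0.
  have b := BF w x Ww xw; have xw1 : `|x - w| <= 1 by rewrite (le_trans (ltW xw)).
  have xw0 := normr_ge0 (x - w).
  have b2 : `|B w x - F x| <= 2 * om by apply: le_trans b _; nra.
  set u := (x - w) ^+ 2 / rho ^+ 2.
  have bu := bump_ge0 u; have bu1 := bump_le1 u.
  split.
    rewrite /G (patch_in sep F B Ww xw) opprD addrA subrr sub0r normrN normrM (ger0_norm bu) -/u -omE.
    apply: le_lt_trans (_ : 1 * (2 * om) < _); first by rewrite ler_pM.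
    by lra.
  have D := @patch_der W rho rh0 sep F B w x _ _ Ww xw (lift_der x hF) (der_affine (F w) w (s w) x).
  rewrite (der_derive1 D) opprD addrA subrr sub0r normrN -/u -omE.
  apply: le_lt_trans (ler_normD _ _) _.
  apply: le_lt_trans (_ : _ <= 4 * (om * S) + 2 * om) _; last by lra.
  apply: lerD.
    rewrite !normrM normfV normrX (gtr0_norm rh0) (@gtr0_norm _ 2)//.
    apply: le_trans (_ : S * (2 * `|x - w| / rho ^+ 2) * (2 * om * `|x - w|) <= _).
      by rewrite ler_pM ?mulr_ge0 ?invr_ge0 ?exprn_ge0 ?(ltW rh0)// ler_wpM2r// ?mulr_ge0// ?invr_ge0 ?exprn_ge0 ?(ltW rh0).
    have -> : S * (2 * `|x - w| / rho ^+ 2) * (2 * om * `|x - w|) = 4 * (om * S) * (`|x - w| / rho) ^+ 2.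
      by rewrite expr_div_n; field; rewrite gt_eqF.
    have p1 : (`|x - w| / rho) ^+ 2 <= 1.
      by rewrite exprn_ile1 ?divr_ge0 ?(ltW rh0)// ler_pdivrMr// mul1r ltW.
    by rewrite -[leRHS]mulr1 ler_wpM2l// mulr_ge0// ltW.
  rewrite normrM (ger0_norm bu); apply: le_trans (_ : 1 * (2 * om) <= _); last by rewrite mul1r.
  rewrite ler_pM//; apply: le_trans (ler_distD (derive1 F w) _ _) _.
  have := hs w Ww; have : `|derive1 F x - derive1 F w| < om by apply: Hr; exact: lt_le_trans rhor.
  by rewrite (distrC (derive1 F w)); lra.
exists G; split=> //.
- apply: H1.
  + apply: (patch_add1 rh0 sep).
    * move=> w; split=> [/(WZ _ (-1))|/(WZ _ 1)//].
      by rewrite mulrNz addrK.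
    * by move=> x; rewrite (lift_add1 hF).
    * move=> w x _; rewrite /B (lift_add1 hF).
      have -> : s (w + 1) = s w by exact: (s1 w 1).
      ring.
  + by move=> x; exact: smooth_derivable.
  + exact: smooth_derive_cont.
  + by move=> x; have [_] := cl x; rewrite lt_min => /andP[].
- by move=> x; have [] := cl x; rewrite !lt_min => /andP[-> _] /andP[->].
- exists (rho / 2) => [|w x Ww xw]; first by rewrite divr_gt0.
  by rewrite /G (patch_core rh0 sep F B Ww xw).
Qed.

End Approximation.
(** * Periodic orbits: hyperbolicity and closing *)

Section PeriodicOrbits.
Context {R : realType}.
Implicit Types (F G u : R -> R) (a b c d e r s t x y z : R) (m k : int).

Definition per (q : nat) m F x : Prop := iter q F x = x + m%:~R.

Definition hyperbolic (q : nat) m F : Prop :=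
  forall x, per q m F x -> derive1 (iter q F) x != 1.

(** The possible combinatorics: for e = 1, m / q is the rotation number of F. *)
Definition rotation_type e (q : nat) m : Prop :=
  (0 < q)%N /\ ((e = 1 /\ coprime q `|m|%N) \/ (e = -1 /\ q = 2%N /\ m = 0)).

Lemma rotation_sgn e q m : rotation_type e q m -> e ^+ q = 1.
Proof. by case=> _ [[-> _]|[-> [-> _]]]; rewrite ?expr1n ?sqrrN ?expr1n. Qed.

Lemma rotation_shift e q m : rotation_type e q m -> e * m%:~R = m%:~R.
Proof. by case=> _ [[-> _]|[-> [_ ->]]]; rewrite ?mul1r ?mulr0. Qed.

Section Orbit.
Context (e : R) (q : nat) (m : int) (F : R -> R) (hF : lift e F) (hr : rotation_type e q m).

Lemma lift_iterq : lift 1 (iter q F).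
Proof. by rewrite -(rotation_sgn hr); exact: lift_iter. Qed.

Lemma iterq_int x k : iter q F (x + k%:~R) = iter q F x + k%:~R.
Proof. by rewrite (lift_addint _ _ lift_iterq) mul1r. Qed.

Lemma perE_int x k : per q m F (x + k%:~R) <-> per q m F x.
Proof. by rewrite /per iterq_int addrAC; split => [/addIr|->]. Qed.

Lemma per_succ x : per q m F x -> per q m F (F x).
Proof. by move=> h; rewrite /per -iterSr iterS h (lift_addint _ _ hF) (rotation_shift hr). Qed.

Lemma per_iter j x : per q m F x -> per q m F (iter j F x).
Proof. by move=> h; elim: j => //= j; exact: per_succ. Qed.

Lemma multiplier_int x k : derive1 (iter q F) (x + k%:~R) = derive1 (iter q F) x.
Proof. by apply: periodic_int => y; exact: lift_derive_add1 lift_iterq. Qed.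

Lemma multiplier_succ x : per q m F x -> derive1 (iter q F) (F x) = derive1 (iter q F) x.
Proof.
move=> h; apply: (mulIf (lift_derive_neq0 x hF)).
rewrite -(derive_iterSr _ _ hF) (derive_iterS _ _ hF) h mulrC; congr (_ * _).
by apply: periodic_int => y; exact: lift_derive_add1 hF.
Qed.

Lemma multiplier_iter j x : per q m F x -> derive1 (iter q F) (iter j F x) = derive1 (iter q F) x.
Proof. by move=> h; elim: j => //= j IH; rewrite multiplier_succ//; exact: per_iter. Qed.

Lemma multiplier_gt0 x : 0 < derive1 (iter q F) x.
Proof. by have := lift_derive_gt0 lift_iterq x; rewrite mul1r. Qed.

Definition displ x := iter q F x - x - m%:~R.

Lemma displ_eq0 x : displ x = 0 <-> per q m F x.
Proof. by rewrite /per /displ; split => h; [rewrite -[LHS](subrK x) -[_ - x](subrK m%:~R) h add0r addrC|rewrite h; ring]. Qed.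

Lemma displ_der x : der displ x (derive1 (iter q F) x - 1).
Proof.
apply: der_eq; last exact: subr0.
apply: derB; last exact: der_cst.
by apply: derB; [exact: lift_der lift_iterq|exact: der_id].
Qed.

Lemma displ_derive x : derive1 displ x = derive1 (iter q F) x - 1.
Proof. exact/der_derive1/displ_der. Qed.

Lemma displ_derive_cont : continuous (derive1 displ).
Proof.
have -> : derive1 displ = (fun x => derive1 (iter q F) x - 1) by apply/funext => x; exact: displ_derive.
by move=> x; apply: cvgB; [exact: lift_derive_cont lift_iterq _|exact: cvg_cst].
Qed.

Lemma displ_add1 x : displ (x + 1) = displ x.
Proof. by rewrite /displ (iterq_int x 1); ring. Qed.

Lemma hyperbolic_displ : hyperbolic q m F -> forall x, displ x = 0 -> derive1 displ x != 0.
Proof. by move=> h x /displ_eq0/h; rewrite displ_derive subr_eq0. Qed.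

End Orbit.

(** ** Transverse zeros *)

Lemma derive_add1 u : (forall x, u (x + 1) = u x) -> (forall x, derivable u x 1) ->
  forall x, derive1 u (x + 1) = derive1 u x.
Proof.
move=> u1 du x; apply/esym/der_derive1.
apply: (der_ext (f := fun y => u (y + 1))) => [y|]; first by rewrite u1.
exact/der_shift/derivable_der.
Qed.

(** Compactness makes the transversality of the zeros of a periodic function quantitative. *)
Lemma transverse_gap u : (forall x, u (x + 1) = u x) -> (forall x, derivable u x 1) ->
  continuous (derive1 u) -> (forall x, u x = 0 -> derive1 u x != 0) ->
  exists2 kap : R, 0 < kap & exists2 r : R, 0 < r & forall x, `|u x| <= kap ->
    (forall y, `|y - x| < r -> kap <= derive1 u y) \/ (forall y, `|y - x| < r -> derive1 u y <= - kap).
Proof.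
move=> u1 du cu hu.
have cu0 : continuous u by move=> x; exact: derivable_continuous.
have u'1 := derive_add1 u1 du.
have [||x|c c0 H] := @periodic_min R (fun x => `|u x| + `|derive1 u x|).
- move=> x; apply: cvgD; apply: cvg_norm; [exact: cu0|exact: cu].
- by move=> x; rewrite u1 u'1.
- rewrite lt_neqAle addr_ge0// eq_sym paddr_eq0// !normr_eq0 andbT negb_and.
  by have [/hu ->|//] := eqVneq (u x) 0.
have c3 : 0 < c / 3 by rewrite divr_gt0.
have [r r0 Hr] := periodic_unif cu u'1 c3.
exists (c / 3) => //; exists r => // x ux; have hx := H x.
have [p|n] := leP 0 (derive1 u x).
  left=> y yx; have := Hr x y yx; rewrite ltr_norml => /andP[h1 h2].
  rewrite (ger0_norm p) in hx; lra.
right=> y yx; have := Hr x y yx; rewrite ltr_norml => /andP[h1 h2].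
rewrite (ltr0_norm n) in hx; lra.
Qed.

Lemma transverse_separated u : (forall x, u (x + 1) = u x) -> (forall x, derivable u x 1) ->
  continuous (derive1 u) -> (forall x, u x = 0 -> derive1 u x != 0) ->
  exists2 r : R, 0 < r & forall z z', u z = 0 -> u z' = 0 -> `|z - z'| < r -> z = z'.
Proof.
move=> u1 du cu hu; have [kap k0 [r r0 H]] := transverse_gap u1 du cu hu.
exists r => // z z' uz uz' zz.
have [c hc] := @mvt_between _ u (derive1 u) z' z (fun x _ => derivable_der (du x)).
rewrite uz uz' subrr => /esym/eqP; rewrite mulf_eq0 => /orP[/eqP d0|]; last by rewrite subr_eq0 => /eqP.
have cz : `|c - z'| < r by apply: le_lt_trans zz; exact: between_dist.
have [|h|h] := H z'; first by rewrite uz' normr0 ltW.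
  by have := h c cz; rewrite d0; lra.
by have := h c cz; rewrite d0; lra.
Qed.

(** A zero of v is close to a zero of u, by the size of u' there; the latter is also
    a zero of v, and v is strictly monotone in between. *)
Lemma transverse_persist u : (forall x, u (x + 1) = u x) -> (forall x, derivable u x 1) ->
  continuous (derive1 u) -> (forall x, u x = 0 -> derive1 u x != 0) ->
  exists2 d : R, 0 < d & forall v, (forall x, derivable v x 1) -> C1_close d u v ->
    (forall x, u x = 0 -> v x = 0) -> forall x, v x = 0 -> u x = 0 /\ derive1 v x != 0.
Proof.
move=> u1 du cu hu; have [kap k0 [r r0 H]] := transverse_gap u1 du cu hu.
have kr : 0 < kap * (r / 2) by rewrite mulr_gt0// divr_gt0.
exists (Num.min kap (kap * (r / 2))); first by rewrite lt_min k0.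
move=> v dv uv uv0 x vx.
have [h1 h2] := uv x; rewrite vx subr0 lt_min in h1; move/andP: h1 => [h1 h1'].
have v'0 y : `|y - x| < r -> derive1 v y != 0.
  move=> yx; have [_ h3] := uv y; move: h3; rewrite lt_min => /andP[+ _].
  rewrite ltr_norml => /andP[h3 h4]; apply/eqP => v0.
  have [h|h] := H x (ltW h1); have := h y yx; rewrite v0 in h3 h4; lra.
have v'x : derive1 v x != 0 by apply: v'0; rewrite subrr normr0.
split=> //.
pose s := r / 2; have s0 : 0 < s by rewrite divr_gt0. have sr : s < r by rewrite /s; lra.
have cu0 y : {for y, continuous u} by exact: derivable_continuous.
have D y : der u y (derive1 u y) by exact: derivable_der.
have [c1 hc1 E1] := @mvt _ u (derive1 u) x (x + s) ltac:(lra) (fun y _ => D y).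
have [c2 hc2 E2] := @mvt _ u (derive1 u) (x - s) x ltac:(lra) (fun y _ => D y).
have b1 : `|c1 - x| < r by rewrite ger0_norm; lra.
have b2 : `|c2 - x| < r by rewrite ler0_norm; lra.
move: h1'; rewrite -/s ltr_norml => /andP[h5 h6].
have [z hz uz] : exists2 z : R, x - s <= z <= x + s & u z = 0.
  have [h|h] := H x (ltW h1); have k1 := h _ b1; have k2 := h _ b2.
    apply: ivt => [|y _//|]; first by lra.
    have : kap * s <= derive1 u c1 * s by rewrite ler_pM2r.
    have : kap * s <= derive1 u c2 * s by rewrite ler_pM2r.
    by left; apply/andP; split; lra.
  apply: ivt => [|y _//|]; first by lra.
  have : derive1 u c1 * s <= - kap * s by rewrite ler_pM2r.
  have : derive1 u c2 * s <= - kap * s by rewrite ler_pM2r.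
  by right; apply/andP; split; lra.
have [c hc] := @mvt_between _ v (derive1 v) x z (fun x _ => derivable_der (dv x)).
rewrite vx (uv0 z uz) subrr => /esym/eqP; rewrite mulf_eq0 => /orP[/eqP d0|].
  have cz : `|c - x| < r.
    apply: le_lt_trans (between_dist hc) _; apply: le_lt_trans sr; rewrite ler_norml; lra.
  by have := v'0 c cz; rewrite d0 eqxx.
by rewrite subr_eq0 => /eqP zx; rewrite -zx.
Qed.

(** ** Iterates of close lifts are close *)

Lemma C1_close_iter e F n d : lift e F -> 0 < d -> exists2 d' : R, 0 < d' &
  forall G, lift e G -> C1_close d' F G -> C1_close d (iter n F) (iter n G).
Proof.
move=> hF; elim: n d => [|n IH] d d0.
  by exists 1 => // G _ _ x; rewrite !subrr normr0.
have [K K1 HK] := lift_derive_bounded hF; have K0 : 0 < K by lra.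
have [L L1 HL] := lift_derive_bounded (lift_iter n hF); have L0 : 0 < L by lra.
have om0 : 0 < d / (4 * L) by rewrite divr_gt0// mulr_gt0.
have [r r0 Hr] := periodic_unif (lift_derive_cont hF) (fun x => lift_derive_add1 x hF) om0.
pose d1 := Num.min (Num.min r (d / (4 * (K + 1)))) 1.
have d10 : 0 < d1 by rewrite !lt_min r0 ltr01 divr_gt0// mulr_gt0//; lra.
have d1r : d1 <= r by rewrite !ge_min lexx.
have d1K : d1 * (4 * (K + 1)) <= d.
  by rewrite -ler_pdivlMr ?mulr_gt0//; [rewrite !ge_min lexx orbT|lra].
have [d2 d20 H2] := IH d1 d10.
pose d3 := Num.min (Num.min d2 (d / (4 * (L + 1)))) 1.
have d30 : 0 < d3 by rewrite !lt_min d20 ltr01 divr_gt0// mulr_gt0//; lra.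
have d32 : d3 <= d2 by rewrite !ge_min lexx.
have d31 : d3 <= 1 by rewrite !ge_min lexx !orbT.
have d3L : d3 * (4 * (L + 1)) <= d.
  by rewrite -ler_pdivlMr ?mulr_gt0//; [rewrite !ge_min lexx orbT|lra].
exists d3 => // G hG FG x; have [a1 a2] := H2 G hG (C1_closeW d32 FG) x.
have [a3 a4] := FG (iter n G x).
have a5 : `|F (iter n F x) - F (iter n G x)| <= K * d1.
  by apply: le_trans (lift_lip hF HK _ _) _; rewrite ler_pM2l// ltW.
split.
  rewrite !iterS; apply: le_lt_trans (ler_distD (F (iter n G x)) _ _) _; nra.
rewrite (derive_iterS _ _ hF) (derive_iterS _ _ hG).
set f' := derive1 F _; set fn' := derive1 (iter n F) x; set gn' := derive1 (iter n G) x.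
set g' := derive1 G _; set f2 := derive1 F (iter n G x) in a4.
have -> : f' * fn' - g' * gn' = (f' - f2) * fn' + (f2 - g') * fn' + g' * (fn' - gn') by ring.
have b1 : `|f' - f2| <= d / (4 * L) by apply/ltW/Hr; exact: lt_le_trans a1 d1r.
have fnL : `|fn'| <= L by exact: HL.
have gK : `|g'| <= K + 1.
  have -> : g' = f2 - (f2 - g') by ring.
  by apply: le_trans (ler_normB _ _) _; apply: lerD; [exact: HK|rewrite ltW// (lt_le_trans a4)].
have e1 : `|(f' - f2) * fn'| <= d / 4.
  have -> : d / 4 = d / (4 * L) * L by field; rewrite gt_eqF.
  by rewrite normrM ler_pM.
have e2 : `|(f2 - g') * fn'| <= d / 4.
  by rewrite normrM; apply: le_trans (ler_pM _ _ (ltW a4) fnL) _ => //; lra.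
have e3 : `|g' * (fn' - gn')| <= d / 4.
  by rewrite normrM; apply: le_trans (ler_pM _ _ gK (ltW a2)) _ => //; lra.
by have := ler_normD ((f' - f2) * fn' + (f2 - g') * fn') (g' * (fn' - gn'));
   have := ler_normD ((f' - f2) * fn') ((f2 - g') * fn'); lra.
Qed.

(** [transverse_persist] for the displacement, whose dependence on F is controlled by
    [C1_close_iter]. *)
Lemma hyperbolic_persist e q m F : lift e F -> rotation_type e q m -> hyperbolic q m F ->
  exists2 d : R, 0 < d & forall G, lift e G -> C1_close d F G ->
    (forall x, per q m F x -> per q m G x) ->
    hyperbolic q m G /\ forall x, per q m G x -> per q m F x.
Proof.
move=> hF hr hyp.
have [d d0 H] := @transverse_persist (displ q m F) (displ_add1 hF hr)
  (fun x => der_derivable (displ_der hF hr x)) (displ_derive_cont hF hr) (hyperbolic_displ hF hr hyp).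
have [d' d'0 H'] := @C1_close_iter e F q d hF d0.
exists d' => // G hG FG perFG.
have Hx x : per q m G x -> per q m F x /\ derive1 (displ q m G) x != 0.
  move=> /displ_eq0 Gx; have [|||Fx Gx'] := H (displ q m G) _ _ _ x Gx.
  - by move=> y; exact: der_derivable (displ_der hG hr y).
  - move=> y; have [h1 h2] := H' G hG FG y.
    rewrite (displ_derive hF hr) (displ_derive hG hr) /displ.
    rewrite (_ : _ - (iter q G y - y - m%:~R) = iter q F y - iter q G y); last by ring.
    by rewrite (_ : _ - 1 - _ = derive1 (iter q F) y - derive1 (iter q G) y); last by ring.
  - by move=> y /displ_eq0/perFG/displ_eq0.
  - by split=> //; exact/displ_eq0.
split=> [x /Hx[_]|x /Hx[]//].
by rewrite (displ_derive hG hr) subr_eq0.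
Qed.

(** ** Closing *)

Lemma pigeonhole_mod1 (h : nat -> R) N : (0 < N)%N ->
  exists i j k, [/\ (i < j <= N)%N & `|h j - h i - k%:~R| < N%:R^-1].
Proof.
move=> N0; have NR : 0 < N%:R :> R by rewrite ltr0n.
pose fr y := y - (Num.floor y)%:~R.
have fr0 y : 0 <= fr y < 1.
  have := floor_itv y; rewrite intrD /fr => /andP[h1 h2]; apply/andP; split; lra.
pose cell (i : 'I_N.+1) := Num.truncn (N%:R * fr (h i)).
have cellE i : (cell i)%:R <= N%:R * fr (h i) < (cell i).+1%:R.
  by apply: truncn_itv; rewrite mulr_ge0//; case/andP: (fr0 (h i)).
have cellN i : (cell i < N)%N.
  rewrite -(ltr_nat R); case/andP: (cellE i) => h1 _; apply: le_lt_trans h1 _.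
  by rewrite gtr_pMr//; case/andP: (fr0 (h i)).
have : ~~ injectiveb (fun i => Ordinal (cellN i)).
  apply/negP => /injectiveP/leq_card; by rewrite !card_ord ltnn.
case/injectivePn => i [j ij /(congr1 val)/= ce].
wlog lij : i j ij ce / (i < j)%N.
  move=> W; case: (ltngtP i j) => lt; [exact: W ij ce lt| |by case/eqP: ij; exact: val_inj].
  by apply: (W j i) => //; rewrite eq_sym.
exists i, j, (Num.floor (h j) - Num.floor (h i)); split.
  by rewrite lij -ltnS ltn_ord.
have -> : h j - h i - (Num.floor (h j) - Num.floor (h i))%:~R = fr (h j) - fr (h i).
  by rewrite rmorphB /fr /=; ring.
have := cellE i; have := cellE j; rewrite ce -!natr1 => /andP[h1 h2] /andP[h3 h4].
rewrite -[ltRHS]mul1r ltr_pdivlMr// -{1}(gtr0_norm NR) -normrM ltr_norml; apply/andP; split; nra.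
Qed.

Lemma iter_le F G n x : lift 1 F -> (forall y, F y <= G y) -> iter n F x <= iter n G x.
Proof.
move=> hF FG; elim: n => //= n IH; apply: le_trans (FG _).
by rewrite (lift1_le _ _ hF).
Qed.

Lemma iter_fix F n x : lift 1 F -> (0 < n)%N -> iter n F x = x -> F x = x.
Proof.
move=> hF; case: n => // n _ h; case: (ltgtP (F x) x) => // lt.
  have : iter n.+1 F x < x; last by rewrite h ltxx.
  by elim: n {h} => //= n IH; apply: lt_trans lt; rewrite (lift1_lt _ _ hF).
have : x < iter n.+1 F x; last by rewrite h ltxx.
by elim: n {h} => //= n IH; apply: lt_trans lt _; rewrite (lift1_lt _ _ hF).
Qed.

Lemma iter_shift F (c : int) n x : lift 1 F -> iter n (fun y => F y + c%:~R) x = iter n F x + (c *+ n)%:~R.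
Proof.
move=> hF; elim: n => [|n IH]; first by rewrite mulr0n addr0.
by rewrite !iterS IH (lift_addint _ _ hF) mul1r mulrS intrD addrCA addrC.
Qed.

Lemma iter_mul F j n x : iter (j * n) F x = iter n (iter j F) x.
Proof. by elim: n => [|n IH]; rewrite ?muln0// mulnS iterD IH. Qed.

(** For g the gcd of q and m, the increasing map F^(q/g) - m/g has a point of period
    g, which is then fixed. *)
Lemma periodic_coprime F q m x : lift 1 F -> (0 < q)%N -> per q m F x ->
  exists q' m' x', (0 < q')%N /\ coprime q' `|m'|%N /\ per q' m' F x'.
Proof.
move=> hF q0 hx; pose g := gcdn q `|m|%N.
have g0 : (0 < g)%N by rewrite gcdn_gt0 q0.
have qE : q = (q %/ g * g)%N by rewrite divnK// dvdn_gcdl.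
have gm : (g%:Z %| m)%Z by apply: dvdn_gcdr.
pose m' := (m %/ g%:Z)%Z.
have mE : m = m' *+ g by rewrite -mulr_natr natz divzK.
have q'0 : (0 < q %/ g)%N by rewrite divn_gt0// dvdn_leq// dvdn_gcdl.
exists (q %/ g)%N, m', x; split=> //; split.
  have := mE; rewrite -mulr_natr natz => /(congr1 absz); rewrite abszM /= => mE'.
  rewrite /coprime -(eqn_pmul2r g0) mul1n muln_gcdl -mE' -qE//.
have hK : lift 1 (iter (q %/ g) F) by rewrite -(expr1n _ (q %/ g)); exact: lift_iter.
have := @iter_fix (fun y => iter (q %/ g) F y + (- m')%:~R) g x (lift_addc _ hK) g0.
have -> : iter g (fun y => iter (q %/ g) F y + (- m')%:~R) x = x.
  by rewrite (iter_shift _ _ _ hK) -iter_mul -qE hx mulNrn mulrNz -mE addrK.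
move=> /(_ erefl).
by rewrite /per mulrNz => {2}<-; rewrite subrK.
Qed.

(** A point returns near itself by the pigeonhole principle; a rotation of small angle,
    chosen by the intermediate value theorem, makes it come back exactly. *)
Lemma closing F d : lift 1 F -> 0 < d ->
  exists t q m x, `|t| < d /\ rotation_type 1 q m /\ per q m (fun y => F y + t) x.
Proof.
move=> hF d0; have ib := archi_boundP (ltW (_ : 0 < d^-1)).
have := ib; rewrite invr_gt0 => /(_ d0) {}ib; set N := Num.bound _ in ib.
have N0 : (0 < N)%N by rewrite -(ltr0n R) (lt_trans _ ib)// invr_gt0.
have NR : 0 < N%:R :> R by rewrite ltr0n.
have Nd : N%:R^-1 < d by rewrite invf_plt// posrE.
have [i [j [k [/andP[ij _] hk]]]] := @pigeonhole_mod1 (fun n => iter n F 0) N N0.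
set a := N%:R^-1 in Nd hk; have a0 : 0 < a by rewrite invr_gt0.
pose y := iter i F 0; pose q := (j - i)%N.
have q0 : (0 < q)%N by rewrite subn_gt0.
have yE : iter q F y = iter j F 0 by rewrite /y -iterD subnK// ltnW.
pose Q t := iter q (fun x => F x + t) y.
have Qc t : {for t, continuous Q}.
  rewrite /Q; elim: (q) => [|n IH] /=; first exact: cvg_cst.
  apply: cvgD; last exact: cvg_id.
  by apply: (continuous_comp IH); exact: lift_cont hF _.
have qE : q = q.-1.+1 by rewrite prednK.
have up : iter q F y + a <= Q a.
  rewrite /Q qE !iterS lerD2r (lift1_le _ _ hF); apply: iter_le => // x; lra.
have dn : Q (- a) <= iter q F y - a.
  rewrite /Q qE !iterS lerD2r (lift1_le _ _ hF); apply: iter_le => [|x]; [exact: lift_addc|lra].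
move: hk; rewrite -yE -/y ltr_norml => /andP[h1 h2].
have [t ht Qt] := @ivt _ Q (- a) a (y + k%:~R) ltac:(lra) (fun x _ => Qc x) ltac:(left; lra).
have [q' [m' [x' [q'0 [cop hx']]]]] := periodic_coprime (lift_addc t hF) q0 Qt.
exists t, q', m', x'; split; first by rewrite ltr_norml; lra.
by split=> //; split=> //; left.
Qed.

(** F - id decreases from 0 to -2 between a fixed point and its translate. *)
Lemma reversing_fixed F : lift (-1) F ->
  exists p p', p < p' < p + 1 /\ F p = p /\ F p' = p' - 1.
Proof.
move=> hF; have cG x : {for x, continuous (fun x => F x - x)}.
  by apply: cvgB; [exact: lift_cont hF _|exact: cvg_id].
have ib := archi_boundP (normr_ge0 (F 0)); set N := Num.bound _ in ib.
have NR : 0 <= N%:R :> R by rewrite ler0n.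
have FN : F N%:R = F 0 - N%:R.
  by have := lift_addint 0 N%:Z hF; rewrite add0r mulN1r.
have FM : F (- N%:R) = F 0 + N%:R.
  by have := lift_addint 0 (- N%:Z) hF; rewrite add0r mulN1r mulrNz opprK.
move: ib; rewrite ltr_norml => /andP[n1 n2].
have [p _ /eqP] := @ivt _ _ (- N%:R) N%:R 0 ltac:(lra) (fun x _ => cG x) ltac:(right; rewrite FN FM; lra).
rewrite subr_eq0 => /eqP Fp; have Fp1 := lift_add1 hF p.
have [p' hp' Fp'] := @ivt _ _ p (p + 1) (-1) ltac:(lra) (fun x _ => cG x) ltac:(right; rewrite Fp1 Fp; lra).
exists p, p'; split; last by split=> //; lra.
have [pp|n1'] := eqVneq p' p; first by rewrite pp in Fp'; lra.
have [pp|n2'] := eqVneq p' (p + 1); first by rewrite pp in Fp'; lra.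
by rewrite !lt_neqAle eq_sym n1' n2'.
Qed.

End PeriodicOrbits.
(** * Perturbation to a hyperbolic map with distinguished multiplier *)

Section Hyperbolic.
Context {R : realType}.
Implicit Types (F G u W : R -> R) (a b c d e r s t x y z : R) (m k : int).

(** All later adjustments of multipliers: a factor on the slopes that is constant
    along orbits appears n times in the chain rule for the n-th iterate. *)
Lemma rescale e F (W : R -> Prop) rho d : lift e F -> smooth F ->
  0 < rho -> (forall w w', W w -> W w' -> `|w - w'| < rho -> w = w') ->
  (forall x k, W x -> W (x + k%:~R)) -> (forall x, W x -> W (F x)) -> 0 < d ->
  exists2 eta : R, 0 < eta & forall sc : R -> R, (forall x k, sc (x + k%:~R) = sc x) ->
    (forall w, W w -> sc (F w) = sc w) -> (forall w, W w -> `|sc w - 1| < eta) ->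
    exists G, [/\ lift e G, smooth G, C1_close d F G,
      exists2 r : R, 0 < r & forall w x, W w -> `|x - w| < r -> G x = F w + sc w * derive1 F w * (x - w) &
      forall w, W w -> forall n, iter n G w = iter n F w /\
        derive1 (iter n G) w = sc w ^+ n * derive1 (iter n F) w].
Proof.
move=> hF sF rho0 sep WZ WF d0.
have [dl dl0 H] := affine_germs hF sF rho0 sep WZ d0.
have [K K1 HK] := lift_derive_bounded hF; have K0 : 0 < K by lra.
exists (dl / K) => [|sc sc1 scF hsc]; first exact: divr_gt0.
have F'1 x k : derive1 F (x + k%:~R) = derive1 F x.
  by apply: periodic_int => y; exact: lift_derive_add1 hF.
have [|w Ww|G [hG sG FG [r r0 Gr]]] := H (fun w => sc w * derive1 F w).
- by move=> w k; rewrite sc1 F'1.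
- rewrite -{2}[derive1 F w]mul1r -mulrBl normrM.
  apply: le_lt_trans (_ : _ <= `|sc w - 1| * K) _; first exact: ler_wpM2l.
  by rewrite -ltr_pdivlMr//; exact: hsc.
exists G; split=> //; first by exists r.
have GF w : W w -> G w = F w by move=> Ww; rewrite (Gr w)// subrr ?normr0// mulr0 addr0.
have G' w : W w -> derive1 G w = sc w * derive1 F w.
  move=> Ww; apply: der_derive1.
  apply: (@der_near _ (fun x => F w + sc w * derive1 F w * (x - w))); last exact: der_affine.
  by apply/near_ball; exists r => // y; exact: Gr.
have Wn w n : W w -> W (iter n F w) by move=> Ww; elim: n => //= n; exact: WF.
have scn w n : W w -> sc (iter n F w) = sc w.
  by move=> Ww; elim: n => //= n <-; apply: scF; exact: Wn.
move=> w Ww; elim=> [|n [IH1 IH2]]; first by split=> //; rewrite expr0 mul1r.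
rewrite !iterS IH1 GF ?(derive_iterS _ _ hG) ?(derive_iterS _ _ hF) ?IH1 ?IH2 ?G' ?scn//; try exact: Wn.
by split=> //; rewrite exprS; ring.
Qed.

(** ** Sets that are finite modulo the integers *)

Definition mod1 (l : seq R) x := exists2 a, a \in l & exists k : int, x = a + k%:~R.

Lemma mod1_int l x k : mod1 l x -> mod1 l (x + k%:~R).
Proof. by move=> [a al [j ->]]; exists a => //; exists (j + k); rewrite intrD addrA. Qed.

Lemma int_small k : `|k%:~R : R| < 1 -> k = 0.
Proof. by rewrite -intr_norm -[1]/(1%:~R) ltr_int => h; lia. Qed.

Lemma int_gap c : exists2 r : R, 0 < r & forall k, `|c + k%:~R| < r -> c + k%:~R = 0.
Proof.
have [n hn _] := floor_shift 0 c; rewrite add0r in hn; case/andP: hn.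
set f := c + n%:~R => n0 n1.
have E k : c + k%:~R = (k - n)%:~R + f by rewrite rmorphB /f /=; ring.
have [z|nz] := eqVneq f 0.
  by exists 1 => // k; rewrite E z addr0 => /int_small ->.
exists (Num.min f (1 - f)) => [|k]; first by rewrite lt_min lt_neqAle eq_sym nz n0 subr_gt0.
rewrite E lt_min !ltr_norml => /andP[/andP[h1 h2] /andP[h3 h4]].
have /int_small -> : `|(k - n)%:~R : R| < 1 by rewrite ltr_norml; apply/andP; split; lra.
have e0 : k - n = 0 by apply: int_small; rewrite ltr_norml; apply/andP; split; lra.
by move: h2; rewrite e0 add0r ltxx.
Qed.

Lemma finite_radius (T : eqType) (l : seq T) (P : T -> R -> Prop) :
  (forall (x : T) r r', r' <= r -> P x r -> P x r') ->
  (forall x : T, x \in l -> exists2 r : R, 0 < r & P x r) ->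
  exists2 r : R, 0 < r & forall x : T, x \in l -> P x r.
Proof.
move=> mono; elim: l => [|a l IH] h; first by exists 1.
have [|r r0 hr] := IH; first by move=> x xl; apply: h; rewrite inE xl orbT.
have [r' r'0 hr'] := h a (mem_head _ _).
exists (Num.min r r') => [|x]; first by rewrite lt_min r0.
by rewrite inE => /orP[/eqP->|xl]; [apply: mono hr'|apply: mono (hr x xl)]; rewrite ge_min lexx ?orbT.
Qed.

Lemma mod1_separated l : exists2 r : R, 0 < r &
  forall w w', mod1 l w -> mod1 l w' -> `|w - w'| < r -> w = w'.
Proof.
have [|p pl|r r0 H] := @finite_radius _ [seq (a, b) | a <- l, b <- l]
  (fun p r => forall k, `|p.1 - p.2 + k%:~R| < r -> p.1 - p.2 + k%:~R = 0).
- by move=> p r r' r'r h k pk; apply: h; exact: lt_le_trans r'r.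
- exact: int_gap.
exists r => // _ _ [a al [k ->]] [b bl [j ->]].
rewrite (_ : _ - _ = a - b + (k - j)%:~R); last by rewrite rmorphB /=; ring.
move=> /(H (a, b)); rewrite /= => h; apply/eqP; rewrite -subr_eq0; apply/eqP; rewrite -[RHS]h.
  by rewrite rmorphB /=; ring.
by apply/allpairsP; exists (a, b).
Qed.

(** A point of W at distance less than r from the infimum of the points above a is
    this infimum. *)
Lemma separated_next (W : R -> Prop) r a : 0 < r ->
  (forall w w', W w -> W w' -> `|w - w'| < r -> w = w') ->
  (exists2 w, W w & a < w) -> exists2 b, W b /\ a < b & forall w, W w -> a < w -> b <= w.
Proof.
move=> r0 sep [w0 W0 aw0]; pose S := [set w | W w /\ a < w].
have hS : has_inf S by split; [exists w0|exists a => w [_ /ltW]].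
have [b [Wb ab] hb] := inf_adherent r0 hS.
exists b => // w Ww aw; rewrite leNgt; apply/negP => wb.
have := ge_inf hS.2 (conj Ww aw) => iw.
have E : b = w by apply: sep => //; rewrite ger0_norm; lra.
by rewrite E ltxx in wb.
Qed.

Lemma separated_prev (W : R -> Prop) r x : 0 < r ->
  (forall w w', W w -> W w' -> `|w - w'| < r -> w = w') ->
  (exists2 w, W w & w <= x) -> exists2 w, W w /\ w <= x & forall w', W w' -> w' <= x -> w' <= w.
Proof.
move=> r0 sep [w0 W0 aw0]; pose S := [set w | W w /\ w <= x].
have hS : has_sup S by split; [exists w0|exists x => w [_]].
have [b [Wb ab] hb] := sup_adherent r0 hS.
exists b => // w Ww aw; rewrite leNgt; apply/negP => wb.
have := ub_le_sup hS.2 (conj Ww aw) => iw.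
have E : b = w by apply: sep => //; rewrite ler0_norm; lra.
by rewrite E ltxx in wb.
Qed.

(** ** Fundamental arcs *)

(** A fundamental domain for the dynamics: a perturbation supported in this arc acts
    once per period. *)
Record fundamental e (q : nat) m F a b : Prop := Fundamental {
  fund_lt : a < b ;
  fund_le : b <= a + 1 ;
  fund_a : per q m F a ;
  fund_b : per q m F b ;
  fund_out : forall c j k, c = a \/ c = b -> ~ (a < iter j F c + k%:~R < b) ;
  fund_once : forall x j k, a < x < b -> (0 < j < q)%N -> ~ (a < iter j F x + k%:~R < b) ;
  fund_cover : forall x, exists j k, a <= iter j F x + k%:~R <= b }.

Definition orbit1 F q a := mod1 [seq iter i F a | i <- iota 0 q].

Lemma orbit1P F q m a x : lift 1 F -> (0 < q)%N -> per q m F a ->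
  orbit1 F q a x <-> exists i k, x = iter i F a + k%:~R.
Proof.
move=> hF q0 ha; split=> [[_ /mapP[i _ ->] [k ->]]|[i [k ->]]]; first by exists i, k.
exists (iter (i %% q) F a); first by apply/mapP; exists (i %% q)%N => //; rewrite mem_iota ltn_pmod.
exists (m *+ (i %/ q) + k); rewrite {1}(divn_eq i q) addnC mulnC iterD (lift1_iter_mul _ hF ha).
by rewrite (lift1_iter_int _ _ _ hF) intrD addrA.
Qed.

(** The arc from a to the next point of its orbit: the iterates F^j, 0 < j < q, map it
    to the other gaps of the orbit, since a has no smaller period. *)
Lemma fundamental_preserving q m F a : lift 1 F -> @rotation_type R 1 q m -> per q m F a ->
  exists b, fundamental 1 q m F a b /\ orbit1 F q a b.
Proof.
move=> hF hr ha; have q0 : (0 < q)%N by case: hr.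
have cop : coprime q `|m|%N by case: hr => _ [[]//|[e1 _]]; exfalso; lra.
pose W := orbit1 F q a; have WP x := orbit1P x hF q0 ha.
have [r r0 sep] := mod1_separated [seq iter i F a | i <- iota 0 q].
have Wa : W a by apply/WP; exists 0%N, 0; rewrite addr0.
have WZ x k : W x -> W (x + k%:~R) by exact: mod1_int.
have Wn x j : W x -> W (iter j F x).
  by move=> /WP[i [k ->]]; apply/WP; exists (j + i)%N, k; rewrite (lift1_iter_int _ _ _ hF) iterD.
have Wper x : W x -> per q m F x.
  by move=> /WP[i [k ->]]; apply/(perE_int hF hr); exact: per_iter hF hr _ _ ha.
have Winv x j : (j <= q)%N -> W x -> exists2 w, W w & iter j F w = x.
  move=> jq Wx; exists (iter (q - j) F x + (- m)%:~R); first exact/WZ/Wn.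
  by rewrite (lift1_iter_int _ _ _ hF) -iterD subnKC// (Wper _ Wx) mulrNz addrK.
have lt j x y : (iter j F x < iter j F y) = (x < y).
  by apply: lift1_lt; rewrite -(expr1n _ j); exact: lift_iter.
have le j x y : (iter j F x <= iter j F y) = (x <= y) by rewrite !leNgt lt.
have W1 : W (a + 1) by exact: (WZ a 1).
have [b [Wb ab] hb] := separated_next r0 sep (ex_intro2 _ _ _ W1 (ltr_pwDr ltr01 (lexx a))).
have no w : W w -> ~ (a < w < b).
  by move=> Ww /andP[aw]; rewrite ltNge (hb w Ww aw).
exists b; split=> //; split=> //.
- by apply: hb => //; rewrite ltrDl.
- exact: Wper.
- by move=> c j k hc; apply: no; apply/WZ/Wn; case: hc => ->.
- move=> x j k /andP[ax xb] /andP[j0 jq] /andP[h1 h2].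
  have jq' := ltnW jq.
  have [] : iter j F a + k%:~R <= a /\ b <= iter j F b + k%:~R.
    split.
      rewrite leNgt; apply/negP => h; apply: (no (iter j F a + k%:~R)); first exact/WZ/Wn.
      by rewrite h (le_lt_trans _ h2)// lerD2r le ltW.
    apply: hb; first exact/WZ/Wn.
    by apply: lt_trans h1 _; rewrite ltrD2r lt.
  rewrite le_eqVlt => /orP[/eqP aE _|Aa bB].
    have : (q %| j)%N.
      apply: (lift1_period_dvd hF cop ha (k := - k)).
      by rewrite /per mulrNz -[in RHS]aE addrK.
    by move=> /(dvdn_leq j0); rewrite leqNgt jq.
  have [w Ww wE] := Winv _ j jq' (WZ a (- k) Wa).
  have aw : a < w by rewrite -(lt j) wE mulrNz ltrBrDr.
  have := hb w Ww aw; rewrite -(le j) wE mulrNz => h.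
  by move: bB ab; lra.
- move=> x.
  have [kx hx _] := floor_shift a x.
  have [|w [/WP Ww wx] hw] := @separated_prev W r x r0 sep.
    by exists (a + (- kx)%:~R); [exact: WZ|rewrite mulrNz; lra].
  have [i [k wE]] : exists i k, (i < q)%N /\ w = iter i F a + k%:~R.
    case/WP: Ww => _ /mapP[i iq ->] [k ->]; exists i, k; split=> //.
    by move: iq; rewrite mem_iota.
  case: wE => iq wE.
  exists (q - i)%N, (- k - m); rewrite rmorphB rmorphN /=.
  have iq' := ltnW iq.
  have E c : per q m F c -> iter (q - i) F (iter i F c + k%:~R) = c + m%:~R + k%:~R.
    by move=> hc; rewrite (lift1_iter_int _ _ _ hF) -iterD subnK// hc.
  have l1 : a + m%:~R + k%:~R <= iter (q - i) F x by rewrite -E// le -wE.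
  have l2 : iter (q - i) F x < b + m%:~R + k%:~R.
    rewrite -E ?lt; last exact: Wper.
    rewrite ltNge; apply/negP => /hw h; have := h (WZ _ _ (Wn _ _ Wb)).
    by rewrite wE lerD2r le leNgt ab.
  by apply/andP; split; lra.
Qed.

(** F exchanges the two arcs between its fixed points. *)
Lemma fundamental_reversing F p p' : lift (-1) F -> p < p' < p + 1 -> F p = p -> F p' = p' - 1 ->
  fundamental (-1) 2 0 F p p'.
Proof.
move=> hF /andP[pp p1] Fp Fp'.
have Fint x k : F (x + k%:~R) = F x - k%:~R by rewrite (lift_addint _ _ hF) mulN1r.
have out c j : c = p \/ c = p' -> exists k, iter j F c = c + k%:~R.
  move=> hc; elim: j => [|j [k IH]]; first by exists 0; rewrite addr0.
  rewrite iterS IH Fint; case: hc => ->; first by exists (- k); rewrite Fp mulrNz.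
  by exists (-1 - k); rewrite Fp' rmorphB /=; ring.
have dec x y : x < y -> F y < F x by move=> /(lift_lt hF); rewrite mulN1r opprB subr_gt0.
have nogap k : ~ (0 < (k%:~R : R) < 1).
  move=> /andP[k0 k1]; have : k = 0 by apply: int_small; rewrite gtr0_norm.
  by move=> kE; rewrite kE ltxx in k0.
split=> //.
- exact: ltW.
- by rewrite /per /= Fp addr0.
- by rewrite /per /= Fp' (Fint p' (-1)) Fp' addr0; ring.
- move=> c j k hc; have [i ->] := out c j hc; rewrite -addrA -intrD => /andP[h1 h2].
  case: hc h1 h2 => ->; first by move=> h1 h2; apply: (nogap (i + k)); lra.
  by move=> h1 h2; apply: (nogap (i + k + 1)); rewrite intrD; lra.
- move=> x j k /andP[px xp]; case: j => [|[|j]]//= _ /andP[h1 h2].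
  have d1 := dec _ _ px; have d2 := dec _ _ xp; rewrite Fp in d1; rewrite Fp' in d2.
  by apply: (nogap k); move: d1 d2 h1 h2 pp p1; lra.
- move=> x; have [k /andP[h1 h2] _] := floor_shift p x.
  have [h|h] := leP (x + k%:~R) p'; first by exists 0%N, k; rewrite h1.
  have d1 := dec _ _ h; have d2 := dec _ _ h2; rewrite Fp' Fint in d1.
  rewrite Fint (Fint p 1) Fp in d2.
  by exists 1%N, (1 - k); rewrite rmorphB /=; apply/andP; split; lra.
Qed.

(** ** Regular values *)

(** The values at nearly degenerate critical points are too few to fill an interval, since u moves by
    o(1/N) on each of N cells containing a critical point. *)
Lemma regular_value u c : (forall x, u (x + 1) = u x) -> (forall x, derivable u x 1) ->
  continuous (derive1 u) -> 0 < c ->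
  exists2 v : R, 0 < v < c & forall x, u x = v -> derive1 u x != 0.
Proof.
move=> u1 du cu c0; apply: contrapT => no.
have bad v : exists x, 0 < v < c -> u x = v /\ derive1 u x = 0.
  have [hv|hv] := pselect (0 < v < c); last by exists 0.
  apply: contrapT => h; apply: no; exists v => // x ux; apply/eqP => u'x.
  by apply: h; exists x.
have c4 : 0 < c / 4 by rewrite divr_gt0.
have [r r0 Hr] := periodic_unif cu (derive_add1 u1 du) c4.
have ib := archi_boundP (ltW (_ : 0 < r^-1)).
have := ib; rewrite invr_gt0 => /(_ r0) {}ib; set N := Num.bound _ in ib.
have N0 : (0 < N)%N by rewrite -(ltr0n R) (lt_trans _ ib)// invr_gt0.
have NR : 1 <= N%:R :> R by rewrite ler1n.
have Nr : N%:R^-1 < r by rewrite invf_plt// posrE// ltr0n.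
pose v (i : nat) : R := c * (i.+1%:R / (N%:R + 2)).
have N2 : 0 < N%:R + 2 :> R by lra.
pose h i := xget 0 [set x | 0 < v i < c -> u x = v i /\ derive1 u x = 0].
have hE i : 0 < v i < c -> u (h i) = v i /\ derive1 u (h i) = 0.
  by apply: (@xgetPex R 0 [set x | 0 < v i < c -> u x = v i /\ derive1 u x = 0]); exact: bad.
have vi i : (i <= N)%N -> 0 < v i < c.
  move=> iN; rewrite /v mulr_gt0 ?divr_gt0 ?ltr0Sn//= gtr_pMr// ltr_pdivrMr// mul1r -natr1.
  by have : i%:R <= N%:R :> R by [rewrite ler_nat]; lra.
have [i [j [k [/andP[ij jN] hk]]]] := @pigeonhole_mod1 R h N N0.
have [ui u'i] := hE i (vi i (leq_trans (ltnW ij) jN)).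
have [uj _] := hE j (vi j jN).
have uk : u (h j - k%:~R) = v j by rewrite -uj -mulrNz (periodic_int u1).
have [x hx E] := @mvt_between _ u (derive1 u) (h i) (h j - k%:~R) (fun x _ => derivable_der (du x)).
have dist : `|h j - k%:~R - h i| < N%:R^-1 by rewrite (_ : _ - h i = h j - h i - k%:~R)//; ring.
have u'x : `|derive1 u x| < c / 4.
  rewrite -[derive1 u x]subr0 -u'i; apply: Hr; apply: le_lt_trans (between_dist hx) _.
  exact: lt_trans Nr.
move: E; rewrite uk ui => /(congr1 (fun t : R => `|t|)); rewrite normrM => E.
have vij : c / (N%:R + 2) <= `|v j - v i|.
  have ijR : i%:R + 1 <= j%:R :> R by rewrite natr1 ler_nat.
  apply: le_trans (ler_norm _); have -> : v j - v i = c / (N%:R + 2) * (j%:R - i%:R).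
    by rewrite /v -!natr1; field; rewrite gt_eqF.
  by rewrite ler_peMr ?divr_ge0 ?(ltW c0) ?(ltW N2)//; lra.
have : `|derive1 u x| * `|h j - k%:~R - h i| <= c / 4 * N%:R^-1 by rewrite ler_pM// ltW.
rewrite -E => /(le_trans vij); rewrite -mulrA ler_pM2l// -invfM lef_pV2 ?posrE//; last by rewrite mulr_gt0//; lra.
by lra.
Qed.

(** ** Plateau functions on an arc *)

Definition periodize g a x : R := g (x - (Num.floor (x - a))%:~R).

Lemma periodize_add1 g a x : periodize g a (x + 1) = periodize g a x.
Proof.
rewrite /periodize (_ : x + 1 - a = x - a + 1%:~R); last by ring.
by rewrite floorDrz ?intr_int// intrKfloor rmorphD /=; congr g; ring.
Qed.

Lemma periodizeE g a x : a <= x < a + 1 -> periodize g a x = g x.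
Proof.
move=> /andP[h1 h2]; rewrite /periodize (@floor_def _ _ 0) ?subr0//.
by apply/andP; split; lra.
Qed.

Lemma periodize_smooth g a : smooth g -> (forall x, x <= a \/ a + 1 <= x -> g x = 0) ->
  smooth (periodize g a).
Proof.
move=> sg g0 x0; set n := Num.floor (x0 - a).
have fl x := floor_itv (x - a).
have /andP[f1 f2] := fl x0; rewrite -/n intrD in f1 f2.
apply: (@smooth_at_near _ (fun x => g (x - n%:~R) + g (x - n%:~R + 1))); last first.
  apply: smooth_atD; apply: smooth_at_comp => //.
    by apply: smooth_atB; [exact: smooth_at_id|exact: smooth_at_cst].
  by apply: smooth_atD; [apply: smooth_atB; [exact: smooth_at_id|]|]; exact: smooth_at_cst.
have b1 : n%:~R + a - 1 < x0 by lra.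
have b2 : x0 < n%:~R + a + 1 by lra.
near=> x.
have x1 : n%:~R + a - 1 < x by near: x; exact: near_gt.
have x2 : x < n%:~R + a + 1 by near: x; exact: near_lt.
have [h|h] := leP (n%:~R + a) x.
  rewrite /periodize (@floor_def _ _ n); last by rewrite intrD; apply/andP; split; lra.
  by rewrite [g (_ + 1)]g0 ?addr0//; right; lra.
rewrite /periodize (@floor_def _ _ (n - 1)); last by rewrite subrK rmorphB /=; apply/andP; split; lra.
rewrite [X in _ = X + _]g0 ?add0r; last by left; lra.
by rewrite rmorphB /=; congr g; ring.
Unshelve. all: by end_near. Qed.

Lemma extremal_derive (g : R -> R) x : (forall y, derivable g y 1) ->
  (forall y, g y <= g x) \/ (forall y, g x <= g y) -> derive1 g x = 0.
Proof.
move=> dg [h|h]; apply: der_derive1.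
  apply: (@derive1_at_max _ g (x - 1) (x + 1)); [lra|by []| |by []].
  by rewrite in_itv /=; apply/andP; split; lra.
apply: (@derive1_at_min _ g (x - 1) (x + 1)); [lra|by []| |by []].
by rewrite in_itv /=; apply/andP; split; lra.
Qed.

Lemma plateau a b eta : 0 < eta -> a <= b -> b <= a + 1 -> exists g,
  [/\ smooth g, forall x, g (x + 1) = g x & forall x, 0 <= g x <= 1] /\
  [/\ forall x, b - 1 <= x <= a -> g x = 0, forall x, g x != 0 -> exists k, a < x + k%:~R < b &
    forall x, a + eta <= x <= b - eta -> g x = 1].
Proof.
move=> eta0 ab ba.
pose g x := step (eta^-1 * (x - a)) * step (eta^-1 * (b - x)).
have ei : 0 < eta^-1 by rewrite invr_gt0.
have g0 x : x <= a \/ b <= x -> g x = 0.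
  rewrite /g => -[h|h].
    by rewrite [step (_ * (x - a))]step0 ?mul0r// pmulr_rle0// subr_le0.
  by rewrite [step (_ * (b - x))]step0 ?mulr0// pmulr_rle0// subr_le0.
have g01 x : 0 <= g x <= 1.
  have h1 := step_ge0 (eta^-1 * (x - a)); have h2 := step_ge0 (eta^-1 * (b - x)).
  by rewrite mulr_ge0//= -[1]mulr1 ler_pM// step_le1.
have sg : smooth g.
  move=> x; apply: smooth_atM; apply: smooth_at_comp; try exact: step_smooth.
    apply: smooth_atM; first exact: smooth_at_cst.
    by apply: smooth_atB; [exact: smooth_at_id|exact: smooth_at_cst].
  apply: smooth_atM; first exact: smooth_at_cst.
  by apply: smooth_atB; [exact: smooth_at_cst|exact: smooth_at_id].
have supp x : periodize g a x != 0 -> exists k, a < x + k%:~R < b.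
  rewrite /periodize => h; exists (- Num.floor (x - a)); rewrite mulrNz.
  by rewrite !ltNge -negb_or; apply: contra_neqN h => /orP[h|h]; apply: g0; [left|right].
exists (periodize g a); split; split=> //.
- apply: periodize_smooth => // x h; apply: g0; case: h => h; [by left|right; lra].
- exact: periodize_add1.
- by move=> x; exact: g01.
- move=> x /andP[h1]; rewrite le_eqVlt => /orP[/eqP->|xa].
    by rewrite periodizeE; [apply: g0; left; exact: lexx|rewrite lexx ltrDl ltr01].
  rewrite -periodize_add1 periodizeE ?g0//; first by right; lra.
  by apply/andP; split; lra.
- move=> x /andP[h1 h2]; rewrite periodizeE; last by apply/andP; split; lra.
  by rewrite /g !step1 ?mulr1// mulrC ler_pdivlMr// mul1r; lra.
Qed.

(** ** Making all periodic orbits hyperbolic *)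

Lemma isolated_zero u z : u z = 0 -> (forall x, derivable u x 1) -> continuous (derive1 u) ->
  derive1 u z != 0 -> exists2 r : R, 0 < r & forall x, 0 < `|x - z| < r -> u x != 0.
Proof.
move=> uz du cu u'z.
have /near_ball[r2 r20 hr] := continuous_near_neq (cu z) u'z.
exists r2 => // x /andP[xz x2].
have [c hc E] := @mvt_between _ u (derive1 u) z x (fun y _ => derivable_der (du y)).
rewrite uz subr0 in E; rewrite E mulf_neq0 -?normr_gt0 ?xz// normr_gt0 hr//.
by apply: le_lt_trans x2; exact: between_dist.
Qed.

Lemma segment_min_gt0 u a b : a <= b -> continuous u -> (forall x, a <= x <= b -> u x != 0) ->
  exists2 c : R, 0 < c & forall x, a <= x <= b -> c <= `|u x|.
Proof.
move=> ab cu nz.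
have [|c cab H] := @EVT_min R (fun x => `|u x|) a b ab.
  by apply: continuous_subspaceT => x; apply: cvg_norm; exact: cu.
rewrite in_itv /= in cab.
exists `|u c| => [|x hx]; first by rewrite normr_gt0 nz.
by apply: H; rewrite in_itv.
Qed.

(** Pushing F by c beta, with beta supported in the orbit of a fundamental arc, the periodic points in
    that arc become the points where the displacement of F takes the value -c beta. *)
Lemma push_hyperbolic e q m F a b (beta : R -> R) c :
  lift e F -> rotation_type e q m -> fundamental e q m F a b ->
  derive1 (iter q F) a != 1 -> derive1 (iter q F) b != 1 ->
  smooth beta -> (forall x, beta (x + 1) = beta x) -> (forall x, 0 <= beta x <= 1) ->
  (forall x, beta x != 0 -> exists k, a < x + k%:~R < b) ->
  lift e (fun x => F x + c * beta x) ->
  (forall z, a < z < b -> beta z != 1 -> displ q m F (F z + c * beta z) != - (c * beta z)) ->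
  (forall y, displ q m F y = - c -> derive1 (displ q m F) y != 0) ->
  [/\ hyperbolic q m (fun x => F x + c * beta x), per q m (fun x => F x + c * beta x) a & F a + c * beta a = F a].
Proof.
move=> hF hr hI ma mb sb b1 b01 supp; set G := fun x => F x + c * beta x => hG zone reg.
have beta0 x : (forall k, ~ (a < x + k%:~R < b)) -> beta x = 0.
  by move=> h; apply/eqP; apply: contrapT => /negP/supp[k /h].
have G'E x : beta x = 0 \/ beta x = 1 -> derive1 G x = derive1 F x.
  move=> h; have d0 : derive1 beta x = 0.
    apply: extremal_derive => [y|]; first exact: smooth_derivable.
    by case: h => ->; [right|left] => y; case/andP: (b01 y).
  apply: der_derive1; apply: der_eq.
    by apply: derD; [exact: lift_der hF|apply: derZ; apply: derivable_der; exact: smooth_derivable].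
  by rewrite d0 mulr0 addr0.
have agree n x : (forall j, (j < n)%N -> beta (iter j F x) = 0) ->
    iter n G x = iter n F x /\ derive1 (iter n G) x = derive1 (iter n F) x.
  elim: n => // n IH h; have [|E1 E2] := IH; first by move=> j jn; apply: h; exact: ltnW.
  have h0 := h n (ltnSn n).
  rewrite (derive_iterS _ _ hG) (derive_iterS _ _ hF) !iterS E1 E2 (G'E _ (or_introl h0)).
  by split=> //; rewrite /G h0 mulr0 addr0.
have ends x n : x = a \/ x = b -> iter n G x = iter n F x /\ derive1 (iter n G) x = derive1 (iter n F) x.
  by move=> hx; apply: agree => j _; apply: beta0 => k; exact: fund_out hI _ j k hx.
have q0 : (0 < q)%N by case: hr.
split; first last.
- exact: (ends a 1%N (or_introl erefl)).1.
- by rewrite /per (ends a q (or_introl erefl)).1; exact: fund_a hI.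
suff main z : a <= z <= b -> per q m G z -> derive1 (iter q G) z != 1.
  move=> x hx.
  have ex : exists j, `[< exists k, a <= iter j F x + k%:~R <= b >].
    by have [j [k h]] := fund_cover hI x; exists j; apply/asboolP; exists k.
  have [j /asboolP[k hk] jmin] := ex_minnP ex.
  have [E _] : iter j G x = iter j F x /\ derive1 (iter j G) x = derive1 (iter j F) x.
    apply: agree => i ij; apply: beta0 => k' /andP[h1 h2].
    suff : (j <= i)%N by rewrite leqNgt ij.
    by apply: jmin; apply/asboolP; exists k'; rewrite !ltW.
  rewrite -E in hk; have := main _ hk.
  rewrite (multiplier_int hG hr) (multiplier_iter hG hr _ hx); apply.
  by apply/(perE_int hG hr); exact: per_iter hG hr _ _ hx.
move=> /andP[az zb] hz.
have [zE|za] := eqVneq z a; first by rewrite zE (ends a q (or_introl erefl)).2.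
have [zE|zb'] := eqVneq z b; first by rewrite zE (ends b q (or_intror erefl)).2.
have {za az}az : a < z by rewrite lt_neqAle eq_sym za.
have {zb'}zb : z < b by rewrite lt_neqAle zb'.
pose y := G z; have [x' x'y] := lift_surj y hF.
have ax : a < x' < b.
  have Ea := (ends a 1%N (or_introl erefl)).1; have Eb := (ends b 1%N (or_intror erefl)).1.
  rewrite /= in Ea Eb; rewrite -(lift_ltE _ _ hF) -[x' < b](lift_ltE _ _ hF) x'y -Ea -Eb.
  by rewrite (lift_ltE _ _ hG) (lift_ltE _ _ hG) az.
have qE : q = q.-1.+1 by rewrite prednK.
have [E1 E2] : iter q.-1 G y = iter q.-1 F y /\ derive1 (iter q.-1 G) y = derive1 (iter q.-1 F) y.
  apply: agree => j jq; apply: beta0 => k; rewrite -x'y -iterSr.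
  by apply: (fund_once hI ax); rewrite /= qE ltnS.
have yz : iter q.-1 F y = z + m%:~R by rewrite -E1 -iterSr -qE.
have uy : displ q m F y = - (c * beta z).
  rewrite /displ qE iterS yz (lift_addint _ _ hF) (rotation_shift hr) /y /G; ring.
rewrite -(multiplier_succ hG hz) -/y.
have [bz|bz] := eqVneq (beta z) 1; last first.
  by have := zone z; rewrite az zb => /(_ isT bz)/eqP; rewrite -/(G z) -/y uy.
have betam : beta (z + m%:~R) = 1 by rewrite (periodic_int b1).
rewrite qE (derive_iterS _ _ hG) E1 E2 yz (G'E _ (or_intror betam)) -yz -(derive_iterS _ _ hF) -qE.
by rewrite bz mulr1 in uy; have := reg y uy; rewrite (displ_derive hF hr) subr_eq0.
Qed.

(** Where 0 < beta < 1 the displacement u of F is bounded away from zero, so that a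
    small push creates no periodic point there. *)
Lemma transition_bound u F (beta : R -> R) a b eta L : 0 < eta -> eta * 3 <= b - a ->
  (forall x, derivable u x 1) -> 0 < L -> (forall x, `|derive1 u x| <= L) -> continuous F ->
  (forall x, a < x <= a + eta \/ b - eta <= x < b -> u (F x) != 0) ->
  (forall x, a < x < b -> beta x != 0 -> a + eta / 2 < x < b - eta / 2) ->
  (forall x, a + eta <= x <= b - eta -> beta x = 1) -> (forall x, 0 <= beta x <= 1) ->
  exists2 v0 : R, 0 < v0 & forall c, `|c| < v0 -> forall z, a < z < b -> beta z != 1 ->
    u (F z + c * beta z) != - (c * beta z).
Proof.
move=> eta0 eab du L0 HL cF uF0 b0 b1 b01.
have cuF : continuous (fun x => u (F x)).
  by move=> x; apply: continuous_comp; [exact: cF|exact: derivable_continuous].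
have [ka ka0 hka] : exists2 k : R, 0 < k & forall x, a + eta / 2 <= x <= a + eta -> k <= `|u (F x)|.
  by apply: segment_min_gt0 => //; [lra|move=> x hx; apply: uF0; left; lra].
have [kb kb0 hkb] : exists2 k : R, 0 < k & forall x, b - eta <= x <= b - eta / 2 -> k <= `|u (F x)|.
  by apply: segment_min_gt0 => //; [lra|move=> x hx; apply: uF0; right; lra].
have L1 : 0 < L + 1 by lra.
exists (Num.min ka kb / (L + 1)) => [|c]; first by rewrite divr_gt0// lt_min ka0.
rewrite ltr_pdivlMr// => hc z zab bz.
have side : z < a + eta \/ b - eta < z.
  case: (ltP z (a + eta)) => h; [by left|right; rewrite ltNge; apply/negP => h'].
  by move: bz; rewrite b1 ?eqxx// h.
have [bz0|bz0] := eqVneq (beta z) 0.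
  rewrite bz0 mulr0 addr0 oppr0; case/andP: zab => h1 h2.
  by apply: uF0; case: side => h; [left|right]; rewrite ?h1 ?h2 ltW.
have /andP[az zb] := b0 z zab bz0.
have kz : Num.min ka kb <= `|u (F z)|.
  by rewrite ge_min; case: side => h; [rewrite hka|rewrite hkb ?orbT] => //; lra.
apply/eqP => E.
have [x _ Ex] := @mvt_between _ u (derive1 u) (F z + c * beta z) (F z) (fun x _ => derivable_der (du x)).
case/andP: (b01 z) => p0 p1.
have cb1 : `|c * beta z| <= `|c| by rewrite normrM (ger0_norm p0) ler_piMr.
have : `|u (F z)| <= L * `|c| + `|c|.
  rewrite -[u (F z)](subrK (u (F z + c * beta z))) Ex; apply: le_trans (ler_normD _ _) _.
  rewrite E normrN; apply: lerD => //; rewrite normrM; apply: ler_pM => //.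
  by rewrite opprD addrA subrr add0r normrN.
rewrite (_ : L * `|c| + `|c| = `|c| * (L + 1)); last by ring.
by move=> h; have := le_lt_trans (le_trans kz h) hc; rewrite ltxx.
Qed.

(** The map becomes hyperbolic at all its periodic points when pushed by a small regular value. *)
Lemma hyperbolic_dense e q m F a b d :
  lift e F -> smooth F -> rotation_type e q m -> fundamental e q m F a b ->
  derive1 (iter q F) a != 1 -> derive1 (iter q F) b != 1 -> 0 < d ->
  exists G, [/\ lift e G, smooth G, C1_close d F G, hyperbolic q m G & per q m G a /\ G a = F a].
Proof.
move=> hF sF hr hI ma mb d0.
have ab := fund_lt hI; have ba := fund_le hI.
set u := displ q m F.
have du x : derivable u x 1 := der_derivable (displ_der hF hr x).
have cu' := displ_derive_cont hF hr.
have u1 := displ_add1 hF hr.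
have uF x : u (F x) = 0 -> u x = 0.
  move=> /displ_eq0 h; apply/displ_eq0; apply: (lift_inj hF).
  by rewrite -iterS iterSr h (lift_addint _ _ hF) (rotation_shift hr).
have iso z : per q m F z -> derive1 (iter q F) z != 1 ->
    exists2 r : R, 0 < r & forall x, 0 < `|x - z| < r -> u (F x) != 0.
  move=> /displ_eq0 hz mz; have [|r r0 H] := @isolated_zero u z hz du cu'.
    by rewrite (displ_derive hF hr) subr_eq0.
  by exists r => // x hx; apply: contra_neq (@uF x) _; exact: H.
have [ra ra0 hra] := iso a (fund_a hI) ma; have [rb rb0 hrb] := iso b (fund_b hI) mb.
have [eta eta0 [ea eb eab]] : exists2 eta : R, 0 < eta & [/\ eta < ra, eta < rb & eta * 3 <= b - a].
  exists (Num.min (Num.min ra rb) (b - a) / 3).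
    by rewrite divr_gt0// !lt_min ra0 rb0 subr_gt0.
  rewrite !ltr_pdivrMr// divfK// !gt_min !ge_min lexx orbT; split=> //.
    by rewrite ltr_pMr// ltr1n.
  by rewrite ltr_pMr ?ltr1n// orbT.
have h2 : 0 < eta / 2 by rewrite divr_gt0.
have [beta [[sb b1 b01] [z0 supp z1]]] : exists g,
    [/\ smooth g, forall x, g (x + 1) = g x & forall x, 0 <= g x <= 1] /\
    [/\ forall x, b - eta / 2 - 1 <= x <= a + eta / 2 -> g x = 0,
      forall x, g x != 0 -> exists k, a + eta / 2 < x + k%:~R < b - eta / 2 &
      forall x, a + eta / 2 + eta / 2 <= x <= b - eta / 2 - eta / 2 -> g x = 1].
  by apply: plateau => //; clear -eta0 eab ba; lra.
have supp' x : beta x != 0 -> exists k, a < x + k%:~R < b.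
  by move=> /supp[k hk]; exists k; clear -eta0 hk; lra.
have sup' x : a < x < b -> beta x != 0 -> a + eta / 2 < x < b - eta / 2.
  move=> hx nz; rewrite !ltNge -negb_or; apply: contraNN nz => /orP[h|h]; apply/eqP.
    by apply: z0; clear -h hx ba eta0; lra.
  by rewrite -[x](subrK 1) b1 z0//; clear -h hx ba eta0; lra.
have [C C0 HC] := periodic_bounded (smooth_derive_cont sb)
  (derive_add1 b1 (fun x => @smooth_derivable _ beta x sb)).
have [d1 d10 Hlift] := lift_of_close hF.
have [L L0 HL] := periodic_bounded cu' (derive_add1 u1 du).
have [||c1 c10 zone] := @transition_bound u F beta a b eta L eta0 eab du L0 HL (lift_cont hF) _ sup' _ b01.
- move=> x [hx|hx]; [apply: hra|apply: hrb]; clear -hx ea eb eta0; [rewrite ger0_norm; lra|].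
  by rewrite ler0_norm; lra.
- by move=> x hx; apply: z1; clear -hx; lra.
have C1 : 0 < C + 1 by rewrite addr_gt0.
have c00 : 0 < Num.min c1 (Num.min d d1 / (C + 1)) by rewrite !lt_min c10 divr_gt0// lt_min d0.
have [v /andP[v0]] := regular_value u1 du cu' c00.
rewrite lt_min ltr_pdivlMr// lt_min => /andP[vc /andP[vd vd1]] hv.
pose c := - v; pose G x := F x + c * beta x.
have cv : `|c| = v by rewrite normrN gtr0_norm.
have sG : smooth G.
  by move=> x; apply: smooth_atD; [exact: sF|apply: smooth_atM; [exact: smooth_at_cst|exact: sb]].
have cG' x : `|derive1 F x - derive1 G x| <= v * C.
  have -> : derive1 G x = derive1 F x + c * derive1 beta x.
    apply: der_derive1; apply: derD; first exact: lift_der hF.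
    by apply: derZ; apply: derivable_der; exact: smooth_derivable.
  rewrite opprD addrA subrr add0r normrN normrM cv.
  by apply: ler_wpM2l; [exact: ltW|exact: HC].
have cG x : `|F x - G x| <= v.
  rewrite /G opprD addrA subrr add0r normrN normrM cv.
  by case/andP: (b01 x) => p0 p1; rewrite (ger0_norm p0) ler_piMr// ltW.
have lt1 : v * C < v * (C + 1) by rewrite ltr_pM2l// ltrDl.
have lt2 : v < v * (C + 1) by rewrite ltr_pMr// ltrDr.
have hG : lift e G.
  apply: Hlift => [x|x||x].
  - by rewrite /G (lift_add1 hF) b1; ring.
  - exact: smooth_derivable.
  - exact: smooth_derive_cont.
  - exact: le_lt_trans (cG' x) (lt_trans lt1 vd1).
have [||hyp perG Ga] := @push_hyperbolic e q m F a b beta c hF hr hI ma mb sb b1 b01 supp' hG.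
- by apply: zone; rewrite cv.
- by rewrite /c opprK; exact: hv.
exists G; split=> // x.
by split; [exact: le_lt_trans (cG x) (lt_trans lt2 vd)|exact: le_lt_trans (cG' x) (lt_trans lt1 vd)].
Qed.

(** ** Tame maps *)

(** The multiplier of p0 makes its orbit invariant under the centralizer; affine germs
    provide linear coordinates at the periodic points. *)
Record tame e (q : nat) m F p0 r : Prop := Tame {
  tame_lift : lift e F ;
  tame_smooth : smooth F ;
  tame_rotation : rotation_type e q m ;
  tame_r : 0 < r ;
  tame_hyperbolic : hyperbolic q m F ;
  tame_p0 : per q m F p0 /\ (e = -1 -> exists k, F p0 = p0 + k%:~R) ;
  tame_affine : forall z x, per q m F z -> `|x - z| < r -> F x = F z + derive1 F z * (x - z) ;
  tame_rigid : forall z, per q m F z -> (e = -1 -> exists k, F z = z + k%:~R) ->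
    derive1 (iter q F) z = derive1 (iter q F) p0 -> exists j k, z = iter j F p0 + k%:~R }.

Lemma per_separated e q m F : lift e F -> rotation_type e q m -> hyperbolic q m F ->
  exists2 r : R, 0 < r & forall z z', per q m F z -> per q m F z' -> `|z - z'| < r -> z = z'.
Proof.
move=> hF hr hyp; have [r r0 H] := transverse_separated (displ_add1 hF hr)
  (fun x => der_derivable (displ_der hF hr x)) (displ_derive_cont hF hr) (hyperbolic_displ hF hr hyp).
by exists r => // z z' /displ_eq0 hz /displ_eq0; exact: H.
Qed.

(** An invariant set of periodic points is made hyperbolic by raising the multipliers >= 1. *)
Lemma hyperbolic_on e q m F l d : lift e F -> smooth F -> rotation_type e q m ->
  (forall x, mod1 l x -> mod1 l (F x)) -> (forall x, mod1 l x -> per q m F x) -> 0 < d ->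
  exists G, [/\ lift e G, smooth G, C1_close d F G &
    forall x, mod1 l x -> [/\ G x = F x, per q m G x & derive1 (iter q G) x != 1]].
Proof.
move=> hF sF hr lF lper d0; have [r r0 sep] := mod1_separated l.
have [eta eta0 H] := rescale hF sF r0 sep (@mod1_int l) lF d0.
have [||w lw|G [hG sG FG _ Gn]] := H (fun w => if 1 <= derive1 (iter q F) w then 1 + eta / 2 else 1).
- by move=> x k; rewrite (multiplier_int hF hr).
- by move=> w /lper hw; rewrite (multiplier_succ hF hw).
- by case: ifP; rewrite ?subrr ?normr0// addrAC subrr add0r ger0_norm; lra.
exists G; split=> // x lx; have [_ E2] := Gn x lx q; have /= := (Gn x lx 1%N).1.
have q0 : (0 < q)%N by case: hr.
split=> //; first by rewrite /per (Gn x lx q).1; exact: lper.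
rewrite E2; case: ifP => [h1|/negbT]; last by rewrite expr1n mul1r -ltNge => /lt_eqF ->.
have gt1 : 1 < (1 + eta / 2) ^+ q by rewrite exprn_egt1 ?lt0n_neq0//; lra.
by rewrite gt_eqF//; nra.
Qed.

(** Scaling up an almost maximal multiplier singles it out. *)
Lemma hyperbolic_tame e q m F a d : lift e F -> smooth F -> rotation_type e q m -> hyperbolic q m F ->
  per q m F a -> (e = -1 -> exists k, F a = a + k%:~R) -> 0 < d ->
  exists G p0 r, tame e q m G p0 r /\ C1_close d F G.
Proof.
move=> hF sF hr hyp ha fa d0; have q0 : (0 < q)%N by case: hr.
have [d1 d10 Hp] := hyperbolic_persist hF hr hyp.
have [rho rho0 sep] := per_separated hF hr hyp.
have perZ x k : per q m F x -> per q m F (x + k%:~R) by move=> /(perE_int hF hr).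
have dm : 0 < Num.min d d1 by rewrite lt_min d0.
have [eta eta0 H] := rescale hF sF rho0 sep perZ (fun x => per_succ hF hr (x := x)) dm.
pose sp := (1 + eta / 2) ^+ q.
have sp1 : 1 < sp by rewrite exprn_egt1 ?lt0n_neq0//; lra.
pose cand z := per q m F z /\ (e = -1 -> exists k, F z = z + k%:~R).
pose S := [set t | exists2 z, cand z & t = derive1 (iter q F) z].
have [K _ HK] := lift_derive_bounded (lift_iterq hF hr).
have hS : has_sup S.
  split; first by exists (derive1 (iter q F) a), a.
  by exists K => _ [z _ ->]; apply: le_trans (ler_norm _) (HK z).
have s0 : 0 < sup S.
  by apply: lt_le_trans (multiplier_gt0 hF hr a) _; apply: ub_le_sup; [exact: hS.2|exists a].
have gap : 0 < sup S * (1 - sp^-1) by rewrite mulr_gt0// subr_gt0 invf_lt1//; lra.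
have [_ [p0 cp0 ->] hp0] := sup_adherent gap hS.
have big z : cand z -> derive1 (iter q F) z < sp * derive1 (iter q F) p0.
  move=> cz; have h : derive1 (iter q F) z <= sup S by apply: ub_le_sup; [exact: hS.2|exists z].
  apply: le_lt_trans h _; rewrite mulrC -ltr_pdivrMr; last by lra.
  by rewrite (_ : sup S / sp = sup S - sup S * (1 - sp^-1))//; ring.
pose orb z := `[< exists j k, z = iter j F p0 + k%:~R >].
have orbP z : reflect (exists j k, z = iter j F p0 + k%:~R) (orb z) by exact: asboolP.
have orbF z : per q m F z -> orb (F z) = orb z.
  move=> hz; apply/orbP/orbP => -[j [k E]]; last first.
    have [k' E'] : exists k', e * k%:~R = k'%:~R.
      by case: (lift_sgn hF) => ->; [exists k; rewrite mul1r|exists (- k); rewrite mulN1r mulrNz].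
    by exists j.+1, k'; rewrite E (lift_addint _ _ hF) E'.
  have qE : q = q.-1.+1 by rewrite prednK.
  have hq := hz; rewrite /per qE iterSr E (lift_addint _ _ (lift_iter _ hF)) -iterD in hq.
  have [k' E'] : exists k', e ^+ q.-1 * k%:~R = k'%:~R.
    by case: (lift_sgn (lift_iter q.-1 hF)) => ->; [exists k; rewrite mul1r|exists (- k); rewrite mulN1r mulrNz].
  exists (q.-1 + j)%N, (k' - m); rewrite rmorphB /=.
  by apply: (addIr m%:~R); rewrite -hq E'; ring.
have [||w hw|G [hG sG FG [r r0 Gr] Gn]] := H (fun w => if orb w then 1 + eta / 2 else 1).
- move=> x k; congr (if _ then _ else _); apply/orbP/orbP => -[j [i E]].
    by exists j, (i - k); rewrite rmorphB /= addrA -E addrK.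
  by exists j, (i + k); rewrite intrD addrA -E.
- by move=> w hw; rewrite orbF.
- by case: ifP; rewrite ?subrr ?normr0// addrAC subrr add0r ger0_norm; lra.
have GF w : per q m F w -> G w = F w by move=> hw; exact: (Gn w hw 1%N).1.
have FG1 : C1_close d1 F G by apply: C1_closeW FG; rewrite ge_min lexx orbT.
have [|hypG perG] := Hp G hG FG1; first by move=> x hx; rewrite /per (Gn x hx q).1.
have it z j : per q m F z -> iter j G z = iter j F z by move=> hz; exact: (Gn z hz j).1.
exists G, p0, r; split; last by apply: C1_closeW FG; rewrite ge_min lexx.
case: cp0 => perp0 fp0.
split=> //.
- split; first by rewrite /per it.
  by move=> /fp0[k E]; exists k; rewrite GF.
- move=> z x /perG hz hx; rewrite (Gr z x hz hx) (GF z hz); congr (_ + _ * _).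
  by have E := (Gn z hz 1%N).2; rewrite expr1 in E; exact: esym E.
- move=> z /perG hz fz; rewrite (Gn z hz q).2 (Gn p0 perp0 q).2.
  have -> : orb p0 by apply/orbP; exists 0%N, 0; rewrite addr0.
  case: ifP => [/orbP[j [k ->]] _|_]; first by exists j, k; rewrite it.
  rewrite expr1n mul1r -/sp => E; have := big z; rewrite E ltxx => h.
  exfalso; suff : false by []; apply: h; split=> // /fz[k Gz]; exists k; by rewrite -GF.
Qed.

(** In turn: smoothing, creation of a periodic orbit, hyperbolicity of this orbit, then
    of all periodic orbits, and finally the choice of p0. *)
Lemma tame_dense e F d : lift e F -> 0 < d ->
  exists q m G p0 r, tame e q m G p0 r /\ C1_close d F G.
Proof.
move=> hF d0; have d5 : 0 < d / 5 by rewrite divr_gt0.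
have dsum F1 F2 F3 F4 F5 : C1_close (d / 5) F F1 -> C1_close (d / 5) F1 F2 ->
    C1_close (d / 5) F2 F3 -> C1_close (d / 5) F3 F4 -> C1_close (d / 5) F4 F5 -> C1_close d F F5.
  move=> h1 h2 h3 h4 h5.
  apply: C1_closeW (C1_close_trans (C1_close_trans (C1_close_trans (C1_close_trans h1 h2) h3) h4) h5).
  lra.
have [F1 [hF1 sF1 c1]] := smooth_lifts_dense hF d5.
case: (lift_sgn hF) => eE; rewrite eE in hF hF1 *.
  have [t [q [m [a [td [hr ha]]]]]] := closing hF1 d5.
  pose F2 x := F1 x + t; have hF2 : lift 1 F2 := lift_addc t hF1.
  have sF2 : smooth F2.
    by move=> x; apply: smooth_atD; [exact: sF1|exact: smooth_at_cst].
  have c2 : C1_close (d / 5) F1 F2.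
    move=> x; rewrite (_ : derive1 F2 x = derive1 F1 x).
      by rewrite /F2 opprD addrA !subrr sub0r normrN normr0.
    apply: der_derive1; apply: der_eq.
      by apply: derD; [exact: lift_der hF1|exact: der_cst].
    by rewrite addr0.
  have q0 : (0 < q)%N by case: hr.
  have WP x := orbit1P x hF2 q0 ha.
  have [||F3 [hF3 sF3 c3 H3]] := @hyperbolic_on 1 q m F2 [seq iter i F2 a | i <- iota 0 q] (d / 5) hF2 sF2 hr _ _ d5.
  - move=> x /WP[i [k ->]]; apply/WP; exists i.+1, k; by rewrite (lift_addint _ _ hF2) mul1r.
  - by move=> x /WP[i [k ->]]; apply/(perE_int hF2 hr); exact: per_iter hF2 hr _ _ ha.
  have W0 : orbit1 F2 q a a by apply/WP; exists 0%N, 0; rewrite addr0.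
  have ito i : orbit1 F2 q a (iter i F2 a) by apply/WP; exists i, 0; rewrite addr0.
  have E i : iter i F3 a = iter i F2 a.
    by elim: i => //= i ->; case: (H3 _ (ito i)).
  have [_ ha3 ma3] := H3 a W0.
  have [b [hI Wb]] := fundamental_preserving hF3 hr ha3.
  have Wb2 : orbit1 F2 q a b.
    by move: Wb; rewrite /orbit1; under eq_map do rewrite E.
  have [_ _ mb3] := H3 b Wb2.
  have [F4 [hF4 sF4 c4 hyp4 [ha4 _]]] := hyperbolic_dense hF3 sF3 hr hI ma3 mb3 d5.
  have [|F5 [p0 [r [tm c5]]]] := hyperbolic_tame hF4 sF4 hr hyp4 ha4 _ d5.
    by move=> e1; exfalso; lra.
  by exists q, m, F5, p0, r; split=> //; exact: dsum c1 c2 c3 c4 c5.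
have [p [p' [pp [Fp Fp']]]] := reversing_fixed hF1.
have hr : @rotation_type R (-1) 2 0 by split=> //; right.
have mod1E x : mod1 [:: p; p'] x -> exists c k, (c = p \/ c = p') /\ x = c + k%:~R.
  by move=> [c]; rewrite !inE => /orP[/eqP->|/eqP->] [k ->]; [exists p, k|exists p', k]; split; auto.
have Wp : mod1 [:: p; p'] p by exists p; [rewrite mem_head|exists 0; rewrite addr0].
have Wp' : mod1 [:: p; p'] p' by exists p'; [rewrite !inE eqxx orbT|exists 0; rewrite addr0].
have FZ x k : F1 (x + k%:~R) = F1 x - k%:~R by rewrite (lift_addint _ _ hF1) mulN1r.
have hI1 := fundamental_reversing hF1 pp Fp Fp'.
have [||F3 [hF3 sF3 c3 H3]] := @hyperbolic_on (-1) 2 0 F1 [:: p; p'] (d / 5) hF1 sF1 hr _ _ d5.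
- move=> x /mod1E[c [k [hc ->]]]; rewrite FZ -mulrNz; apply: mod1_int.
  by case: hc => ->; [rewrite Fp|rewrite Fp' -[-1]/((-1)%:~R); exact: mod1_int].
- move=> x /mod1E[c [k [hc ->]]]; apply/(perE_int hF1 hr).
  by case: hc => ->; [exact: fund_a hI1|exact: fund_b hI1].
have [Ep hp mp] := H3 p Wp; have [Ep' hp' mp'] := H3 p' Wp'.
rewrite Fp in Ep; rewrite Fp' in Ep'.
have [F4 [hF4 sF4 c4 hyp4 [ha4 Ep4]]] :=
  hyperbolic_dense hF3 sF3 hr (fundamental_reversing hF3 pp Ep Ep') mp mp' d5.
have [|F5 [p0 [r [tm c5]]]] := hyperbolic_tame hF4 sF4 hr hyp4 ha4 _ d5.
  by move=> _; exists 0; rewrite addr0 Ep4.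
exists 2%N, 0, F5, p0, r; split=> //.
apply: C1_closeW (C1_close_trans (C1_close_trans (C1_close_trans c1 c3) c4) c5).
by clear -d0; lra.
Qed.

End Hyperbolic.
(** * A clock for a tame map, exact near the periodic points *)

Lemma half_le_double (R : realType) (x : R) : 0 < x -> x / 2 <= 2 * x.
Proof. lra. Qed.

Section ClockOfFunction.
Context {R : realType}.
Implicit Types (u T L : R -> R) (a b c l r s t x y z : R) (k : int).

Lemma der_ln_dist z x : x != z -> der (fun y => ln `|y - z|) x (x - z)^-1.
Proof.
move=> xz; have d1 : der (fun y => y - z) x 1.
  by apply: der_eq; [apply: derB; [exact: der_id|exact: der_cst]|rewrite subr0].
have [lt|gt|/eqP] := ltgtP x z; last by rewrite (negPf xz).
  apply: (der_near (f := fun y => ln (- (y - z)))).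
    by near=> y; rewrite ler0_norm// subr_le0 ltW//; near: y; exact: near_lt.
  apply: der_eq; first apply: (@der_comp _ (@ln R) (fun y => - (y - z)) x _ (-1)); [|exact: (derN d1)|].
    by apply: is_derive1_ln; rewrite oppr_gt0 subr_lt0.
  by rewrite invrN mulrNN mulr1.
apply: (der_near (f := fun y => ln (y - z))).
  by near=> y; rewrite ger0_norm// subr_ge0 ltW//; near: y; exact: near_gt.
apply: der_eq; first apply: (@der_comp _ (@ln R) (fun y => y - z)); [|exact: d1|].
  by apply: is_derive1_ln; rewrite subr_gt0.
by rewrite mulr1.
Unshelve. all: by end_near. Qed.

(** The local model of a clock at a zero of slope l. *)
Definition log_clock l c (jump : R -> R) z x := ln `|x - z| / l + c + (if z < x then jump l else 0).

Lemma log_clock_near l c jump z x : x != z ->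
  \forall y \near x, log_clock l c jump z y = l^-1 * ln `|y - z| + (c + (if z < x then jump l else 0)).
Proof.
move=> xz; rewrite /log_clock; have [lt|gt|/eqP] := ltgtP z x; last by rewrite eq_sym (negPf xz).
  near=> y; rewrite ifT ?addrA 1?[l^-1 * _]mulrC//.
  by near: y; exact: near_gt.
near=> y; rewrite ifF ?addrA 1?[l^-1 * _]mulrC//; apply/negbTE; rewrite -leNgt ltW//.
by near: y; exact: near_lt.
Unshelve. all: by end_near. Qed.

Lemma log_clock_der l c jump z x : x != z -> der (log_clock l c jump z) x (l * (x - z))^-1.
Proof.
move=> xz; apply: der_near (log_clock_near l c jump xz) _.
apply: der_eq; first by apply: derD; [apply: derZ; exact: der_ln_dist|exact: der_cst].
by rewrite addr0 invfM.
Qed.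

Lemma smooth_at_log_clock l c jump z x : x != z -> smooth_at (log_clock l c jump z) x.
Proof.
move=> xz; apply: smooth_at_near (log_clock_near l c jump xz) _.
apply: smooth_atD; last exact: smooth_at_cst.
apply: smooth_atM; first exact: smooth_at_cst.
apply: (@smooth_at_der _ _ (fun y => (y - z)^-1)).
  by near=> y; apply: der_ln_dist; near: y; exact: (continuous_near_neq (@cvg_id _ _)).
apply: smooth_atV; first by rewrite subr_eq0.
by apply: smooth_atB; [exact: smooth_at_id|exact: smooth_at_cst].
Unshelve. all: by end_near. Qed.

Definition clock_field u T x : R := if u x == 0 then 0 else (derive1 T x)^-1.

Lemma clock_field_eq0 u T x : (u x != 0 -> derive1 T x != 0) -> (clock_field u T x == 0) = (u x == 0).
Proof.
rewrite /clock_field; have [_|x0 h] := eqVneq (u x) 0; first by rewrite eqxx.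
by rewrite invr_eq0 (negPf (h isT)).
Qed.

(** Only the zeros of u need care: the derivative of a logarithmic singularity is the
    inverse of a linear function. *)
Lemma clock_of u T jump : continuous u -> (forall x, u (x + 1) = u x) -> (forall x, T (x + 1) = T x) ->
  (exists z, u z = 0) -> (forall x, u x != 0 -> smooth_at T x /\ derive1 T x != 0) ->
  (forall z, u z = 0 -> exists l c r, [/\ l != 0, 0 < r &
    forall x, 0 < `|x - z| < r -> u x != 0 /\ T x = log_clock l c jump z x]) ->
  clock jump (clock_field u T) T /\
  forall z l c r, u z = 0 -> 0 < r -> (forall x, 0 < `|x - z| < r -> T x = log_clock l c jump z x) ->
    derive1 (clock_field u T) z = l.
Proof.
move=> cu u1 T1 uz hT hg.
have T'E z l c r : 0 < r -> (forall x, 0 < `|x - z| < r -> T x = log_clock l c jump z x) ->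
    forall x, 0 < `|x - z| < r -> derive1 T x = (l * (x - z))^-1.
  move=> r0 H x /andP[xz xr]; have xz' : x != z by rewrite -subr_eq0 -normr_gt0.
  apply: der_derive1; apply: (der_near (f := log_clock l c jump z)); last exact: log_clock_der.
  near=> y; apply: H; rewrite normr_gt0 subr_eq0; apply/andP; split.
    by near: y; exact: (continuous_near_neq (@cvg_id _ _)).
  rewrite distrC; near: y.
  have c1 : {for x, continuous (fun y => `|z - y|)}.
    by apply: cvg_norm; apply: cvgB; [exact: cvg_cst|exact: cvg_id].
  by apply: (continuous_near_lt c1); rewrite distrC.
have XE z l c r : u z = 0 -> 0 < r -> (forall x, 0 < `|x - z| < r -> u x != 0 /\ T x = log_clock l c jump z x) ->
    forall x, `|x - z| < r -> clock_field u T x = l * (x - z).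
  move=> z0 r0 H x xr; have [->|xz] := eqVneq x z.
    by rewrite /clock_field z0 eqxx subrr mulr0.
  have hx : 0 < `|x - z| < r by rewrite normr_gt0 subr_eq0 xz.
  rewrite /clock_field (negPf (H x hx).1).
  by rewrite (T'E z l c r r0 (fun y hy => (H y hy).2) x hx) invrK.
have X0 x : (clock_field u T x == 0) = (u x == 0) by apply: clock_field_eq0 => /hT[].
have nu x : u x != 0 -> \forall y \near x, u y != 0.
  by move=> x0; exact: (continuous_near_neq (cu x) x0).
split; last first.
  move=> z l c r z0 r0 H; have [l' [c' [r' [_ r'0 H']]]] := hg z z0.
  pose r2 := Num.min r r'; have r20 : 0 < r2 by rewrite lt_min r0.
  apply: der_derive1; apply: (der_near (f := fun x => 0 + l * (x - z))); last exact: der_affine.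
  apply/near_ball; exists r2 => // y; rewrite add0r; apply: (XE _ _ c) => // x.
  rewrite lt_min andbA => /andP[h1 h2]; split; last exact: H.
  by case/andP: h1 => h1 _; case: (H' x) => //; rewrite h1.
split.
- move=> x; have [x0|x0] := eqVneq (u x) 0; last first.
    apply: smooth_at_near (_ : \forall y \near x, _ = (derive1 T y)^-1) _.
      by near=> y; rewrite /clock_field ifN//; near: y; exact: nu.
    by have [sT T'0] := hT x x0; apply: smooth_atV => //; exact: smooth_at_derive1.
  have [l [c [r [l0 r0 H]]]] := hg x x0.
  apply: (@smooth_at_near _ (fun y => 0 + l * (y - x))); last exact: smooth_at_affine.
  by apply/near_ball; exists r => // y yx; rewrite add0r; exact: (XE x l c r x0 r0 H).
- move=> x; rewrite /clock_field u1; case: eqP => // /eqP x0; congr (_^-1).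
  apply/esym/der_derive1; apply: (der_ext (f := fun y => T (y + 1))) => [y|]; first by rewrite T1.
  apply/der_shift/derivable_der/smooth_at_derivable.
  by case: (hT (x + 1)) => //; rewrite u1.
- exact: T1.
- by case: uz => z z0; exists z; rewrite /clock_field z0 eqxx.
- move=> x; rewrite X0 => x0; rewrite /clock_field (negPf x0) invrK.
  by apply: derivable_der; apply: smooth_at_derivable; case: (hT x x0).
- move=> z /eqP; rewrite X0 => /eqP z0; have [l [c [r [l0 r0 H]]]] := hg z z0.
  exists l, c, r; split=> // x hx; split; last by case: (H x hx).
  by apply: (XE z l c r z0 r0 H); case/andP: hx.
Unshelve. all: by end_near. Qed.

End ClockOfFunction.

Section TameClock.
Context {R : realType} (e : R) (q : nat) (m : int) (F : R -> R) (p0 r : R).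
Context (hT : tame e q m F p0 r).
Let hF := tame_lift hT.
Let hr := tame_rotation hT.
Let q0 : (0 < q)%N. Proof. by case: hr. Qed.
Let u := displ q m F.
Let mu z := derive1 (iter q F) z.

Definition exponent z := ln (mu z).
Local Notation lam := exponent.

(** A clock that F may fail to advance by 1/q away from the periodic points; the
    failure is removed by averaging. *)
Record adapted X T rad : Prop := Adapted {
  ad_clock : clock (side_jump e) X T ;
  ad_zero : forall x, (X x == 0) = (u x == 0) ;
  ad_sign : forall x, u x != 0 -> 0 < X x * u x ;
  ad_slope : forall z, u z = 0 -> derive1 X z = lam z ;
  ad_rad : 0 < rad ;
  ad_germ : forall z x, u z = 0 -> 0 < `|x - z| < rad -> u x != 0 /\ T (F x) = T x + q%:R^-1 }.

Let u1 x : u (x + 1) = u x. Proof. exact: displ_add1 hF hr x. Qed.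
Let du x : derivable u x 1. Proof. exact: der_derivable (displ_der hF hr x). Qed.
Let cu : continuous u. Proof. by move=> x; exact: derivable_continuous. Qed.
Let perE z : u z = 0 <-> per q m F z. Proof. exact: displ_eq0. Qed.

Let mu_gt0 z : 0 < mu z. Proof. exact: multiplier_gt0 hF hr z. Qed.

Lemma exponent_neq0 z : u z = 0 -> lam z != 0.
Proof. by move=> /perE hz; rewrite ln_eq0 ?mu_gt0//; exact: tame_hyperbolic hT z hz. Qed.

Lemma exponent_int z (k : int) : lam (z + k%:~R) = lam z.
Proof. by rewrite /lam /mu (multiplier_int hF hr). Qed.

Lemma exponent_succ z : u z = 0 -> lam (F z) = lam z.
Proof. by move=> /perE hz; rewrite /lam /mu (multiplier_succ hF hz). Qed.

Lemma displ_succ x : u (F x) = F (iter q F x) - F (x + m%:~R).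
Proof.
by rewrite /u /displ -iterSr iterS (lift_addint _ _ hF) (rotation_shift hr) opprD addrA.
Qed.

Lemma displ_succ_gt0 x : (0 < e * u (F x)) = (0 < u x).
Proof. by rewrite displ_succ (lift_ltE _ _ hF) /u /displ -addrA -opprD subr_gt0. Qed.

Lemma displ_succ_eq0 x : (u (F x) == 0) = (u x == 0).
Proof.
rewrite displ_succ subr_eq0 (inj_eq (lift_inj hF)) -subr_eq0.
by rewrite /u /displ -addrA -opprD.
Qed.

Lemma displ_succ_mul x : u x != 0 -> 0 < e * (u x * u (F x)).
Proof.
move=> x0; rewrite mulrCA; have [p|n|/eqP] := ltgtP 0 (u x); last by rewrite eq_sym (negPf x0).
  by rewrite mulr_gt0// displ_succ_gt0.
rewrite nmulr_rgt0// lt_neqAle mulf_eq0 negb_or displ_succ_eq0 x0 andbT leNgt displ_succ_gt0 -leNgt (ltW n) andbT.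
by case: (lift_sgn hF) => ->; rewrite ?oppr_eq0 oner_eq0.
Qed.

(** A radius that works at each zero of u works uniformly, the zeros being isolated. *)
Lemma zero_radius (P : R -> R -> Prop) :
  (forall s s' z, 0 < s' -> s' <= s -> P s z -> P s' z) ->
  (forall s z (k : int), P s (z + k%:~R) -> P s z) ->
  (forall z, u z = 0 -> exists2 s : R, 0 < s & P s z) ->
  exists2 s : R, 0 < s & forall z, u z = 0 -> P s z.
Proof.
move=> mono int loc.
have [rho rho0 sep] := per_separated hF hr (tame_hyperbolic hT).
apply: (@periodic_radius R (fun s z => u z = 0 -> P s z)).
- by move=> s s' z s'0 ss h /h; exact: mono.
- by move=> s z k h z0; apply: (int s z k); apply: h; rewrite (periodic_int u1).
move=> x; have [x0|x0] := eqVneq (u x) 0.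
  have [s s0 Ps] := loc x x0; exists (Num.min s rho) => [|y]; first by rewrite lt_min s0.
  rewrite lt_min => /andP[_ yx] y0; have -> : y = x by apply: sep => //; exact/perE.
  by apply: (mono s) => //; [rewrite lt_min s0|rewrite ge_min lexx].
have /near_ball[s s0 H] := continuous_near_neq (@cu x) x0.
by exists s => // y /H/eqP.
Qed.


(** ** The local clock at a periodic point *)

(** The mean of the logarithms of the derivatives along the orbit. *)
Definition phase z := (q%:R * lam z)^-1 * \sum_(j < q) ln `|derive1 (iter j F) z|.

Definition local_clock z := log_clock (lam z) (phase z) (side_jump e) z.

Lemma phase_int z (k : int) : phase (z + k%:~R) = phase z.
Proof.
rewrite /phase exponent_int; congr (_ * _); apply: eq_bigr => j _; congr (ln `|_|).
by apply: periodic_int => x; exact: lift_derive_add1 (lift_iter j hF).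
Qed.

(** The phases are the solutions of this cocycle equation. *)
Lemma phase_succ z : u z = 0 ->
  phase (F z) = phase z + q%:R^-1 - ln `|derive1 F z| / lam z.
Proof.
move=> z0; have l0 := exponent_neq0 z0; have qn : q%:R != 0 :> R by rewrite pnatr_eq0 -lt0n.
rewrite /phase exponent_succ//.
pose a j x := ln `|derive1 (iter j F) x|.
have aS j : a j (F z) = a j.+1 z - a 1%N z.
  rewrite /a (derive_iterSr j z hF) normrM lnM ?posrE ?normr_gt0; first last.
  - exact: lift_derive_neq0 hF.
  - exact: lift_derive_neq0 (lift_iter j hF).
  by rewrite addrK.
have aq : a q z = lam z by rewrite /a /lam gtr0_norm ?mu_gt0.
have a0 : a 0%N z = 0 by rewrite /a /= (der_derive1 (der_id z)) normr1 ln1.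
have -> : \sum_(j < q) ln `|derive1 (iter j F) (F z)| = \sum_(j < q) a j z + lam z - q%:R * a 1%N z.
  rewrite (eq_bigr (fun j : 'I_q => a j.+1 z - a 1%N z)) => [|j _]; last exact: aS.
  rewrite sumrB sumr_const card_ord mulr_natl; congr (_ - _).
  have tel n : \sum_(i < n) a i.+1 z = \sum_(i < n) a i z + a n z.
    by elim: n => [|n IH]; rewrite ?big_ord0 ?a0 ?addr0// !big_ord_recr /= IH.
  by rewrite -aq; exact: tel.
have -> : a 1%N z = ln `|derive1 F z| by [].
rewrite -[\sum_(j < q) ln _]/(\sum_(j < q) a j z); set S := \sum_(j < q) _; set B := ln _.
by clearbody S B; field; rewrite qn l0.
Qed.

Lemma local_clock_succ z x : u z = 0 -> x != z -> `|x - z| < r ->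
  local_clock (F z) (F x) = local_clock z x + q%:R^-1.
Proof.
move=> z0 xz xr; have l0 := exponent_neq0 z0.
have Fx : F x - F z = derive1 F z * (x - z).
  by rewrite (tame_affine hT ((perE z).1 z0) xr) addrAC subrr add0r.
have d0 := lift_derive_neq0 z hF.
rewrite /local_clock /log_clock exponent_succ// phase_succ// Fx normrM lnM ?posrE ?normr_gt0 ?subr_eq0//.
have -> : (if F z < F x then side_jump e (lam z) else 0) = (if z < x then side_jump e (lam z) else 0).
  rewrite /side_jump; case: (lift_sgn hF) => e1; last first.
    by have -> : (e == 1) = false; [apply/eqP; lra|rewrite /= !if_same].
  have hF1 : lift 1 F by rewrite -e1; exact: hF.
  rewrite (lift1_lt _ _ hF1); reflexivity.
by rewrite mulrDl; ring.
Qed.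

Lemma local_clock_int z x (k : int) : local_clock (z + k%:~R) (x + k%:~R) = local_clock z x.
Proof.
rewrite /local_clock /log_clock exponent_int phase_int ltrD2r.
by rewrite (_ : x + k%:~R - (z + k%:~R) = x - z)//; ring.
Qed.

(** ** The global clock *)

Let W z := u z = 0.

(** Near z the displacement has the sign of the linear part, and the local clock is so
    far from [-1, 1] that it lies on one side of the height. *)
Lemma good_radius : exists2 rho : R, 0 < rho & [/\ 2 * rho <= r,
  forall w w', W w -> W w' -> `|w - w'| < 2 * rho -> w = w' &
  forall z x, W z -> 0 < `|x - z| < rho -> 0 < lam z * (x - z) * u x /\
    forall v, `|v| <= 1 -> 0 <= lam z * (v - local_clock z x)].
Proof.
have [|||s s0 Hs] := @zero_radius (fun s z => forall x, 0 < `|x - z| < s -> 0 < lam z * (x - z) * u x /\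
    forall v, `|v| <= 1 -> 0 <= lam z * (v - local_clock z x)).
- by move=> s s' z s'0 ss H x /andP[h1 h2]; apply: H; rewrite h1 (lt_le_trans h2).
- move=> s z k H x hx; have := H (x + k%:~R).
  rewrite exponent_int (periodic_int u1) local_clock_int (_ : _ - _ = x - z); last by ring.
  exact.
- move=> z z0; have l0 := exponent_neq0 z0.
  have m0 : 0 < lam z * (mu z - 1).
    have [p|n|/eqP] := ltgtP (mu z) 1; first 2 last.
    + by move=> /eqP m1; move: l0; rewrite /lam m1 ln1 eqxx.
    + by rewrite nmulr_rgt0 ?subr_lt0// ln_lt0// mu_gt0 p.
    + by rewrite mulr_gt0 ?subr_gt0// ln_gt0.
  have u'z : 0 < lam z * derive1 u z by rewrite (displ_derive hF hr).
  have cu' : {for z, continuous (fun x => lam z * derive1 u x)}.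
    by apply: cvgM; [exact: cvg_cst|exact: displ_derive_cont hF hr z].
  have /near_ball[s1 s10 H1] := continuous_near_gt cu' u'z.
  pose s2 := expR (- (`|lam z| * (2 + `|phase z|))).
  exists (Num.min s1 s2) => [|x /andP[xz]]; first by rewrite lt_min s10 expR_gt0.
  rewrite lt_min => /andP[xs1 xs2]; split.
    have [c hc E] := @mvt_between _ u (derive1 u) z x (fun y _ => derivable_der (@du y)).
    rewrite z0 subr0 in E.
    have h := H1 c (le_lt_trans (between_dist hc) xs1).
    rewrite E (_ : _ * _ = (lam z * derive1 u c) * (x - z) ^+ 2); last by ring.
    by rewrite mulr_gt0// exprn_even_gt0//= -normr_gt0.
  move=> v v1; rewrite /local_clock /log_clock.
  have ls : ln `|x - z| <= - (`|lam z| * (2 + `|phase z|)).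
    by rewrite -[leRHS]expRK ler_ln ?posrE ?expR_gt0// ltW.
  set j := if _ then _ else _.
  have j1 : `|j| <= 1 by rewrite /j /side_jump; case: ifP => _; [case: ifP => _|]; rewrite ?normr1 ?normr0.
  have -> : lam z * (v - (ln `|x - z| / lam z + phase z + j)) = - ln `|x - z| + lam z * (v - phase z - j).
    by field.
  have : `|lam z * (v - phase z - j)| <= `|lam z| * (2 + `|phase z|).
    rewrite normrM ler_wpM2l//; have := ler_normB (v - phase z) j; have := ler_normB v (phase z); lra.
  by rewrite ler_norml => /andP[h1 h2]; lra.
have [rho rho0 sep] := per_separated hF hr (tame_hyperbolic hT).
pose t := Num.min (Num.min s (rho / 2)) (r / 2).
have ts : t <= s by rewrite !ge_min lexx.
have trho : t <= rho / 2 by rewrite !ge_min lexx orbT.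
have tr : t <= r / 2 by rewrite !ge_min lexx orbT.
exists t; first by rewrite !lt_min s0 !divr_gt0 ?(tame_r hT).
split; first by lra.
- by move=> w w' /perE w0 /perE w'0 ww; apply: sep => //; apply: lt_le_trans ww _; lra.
- by move=> z x z0 /andP[h1 h2]; apply: Hs => //; rewrite h1 (lt_le_trans h2).
Qed.

Let u_sg_near x : u x != 0 -> \forall y \near x, Num.sg (u y) = Num.sg (u x).
Proof.
move=> x0; have [p|n|/eqP] := ltgtP 0 (u x); last by rewrite eq_sym (negPf x0).
  near=> y; rewrite !gtr0_sg//; near: y; exact: (continuous_near_gt (@cu x)).
near=> y; rewrite !ltr0_sg//; near: y; exact: (continuous_near_lt (@cu x)).
Unshelve. all: by end_near. Qed.

(** A primitive of the direction of the displacement, periodic because p0 + Z consists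
    of zeros of u; it serves as the clock far from the periodic points. *)
Definition height x : R := Num.sg (u x) * (x - p0 - (Num.floor (x - p0))%:~R).

Lemma height_bound x : `|height x| <= 1.
Proof.
rewrite /height normrM normr_sg; have := floor_itv (x - p0); rewrite intrD => /andP[h1 h2].
have : `|x - p0 - (Num.floor (x - p0))%:~R| <= 1 by rewrite ger0_norm; lra.
by case: (u x != 0); rewrite ?mul1r ?mul0r.
Qed.

Lemma height_add1 x : height (x + 1) = height x.
Proof.
rewrite /height u1 (_ : x + 1 - p0 = x - p0 + 1%:~R); last by ring.
by rewrite floorDrz ?intr_int// intrKfloor rmorphD /=; congr (_ * _); ring.
Qed.

Let p00 : u p0 = 0. Proof. by apply/perE; case: (tame_p0 hT). Qed.

Lemma height_near x : u x != 0 ->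
  \forall y \near x, height y = 0 + Num.sg (u x) * (y - (p0 + (Num.floor (x - p0))%:~R)).
Proof.
move=> x0; set n := Num.floor _.
have := floor_itv (x - p0); rewrite -/n intrD => /andP[h1 h2].
have h3 : p0 + n%:~R < x.
  rewrite lt_neqAle; apply/andP; split; last by lra.
  by apply: contra_neq x0 => <-; rewrite (periodic_int u1).
have h4 : x < p0 + n%:~R + 1 by lra.
near=> y.
have y1 : p0 + n%:~R < y by near: y; exact: near_gt.
have y2 : y < p0 + n%:~R + 1 by near: y; exact: near_lt.
rewrite /height (@floor_def _ _ n); last by rewrite intrD; apply/andP; split; lra.
have -> : Num.sg (u y) = Num.sg (u x) by near: y; exact: u_sg_near.
by rewrite add0r opprD addrA.
Unshelve. all: by end_near. Qed.

Section Global.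
Context (rho : R) (rho0 : 0 < rho) (rho_r : 2 * rho <= r).
Context (sep : forall w w', W w -> W w' -> `|w - w'| < 2 * rho -> w = w').
Context (good : forall z x, W z -> 0 < `|x - z| < rho -> 0 < lam z * (x - z) * u x /\
    forall v, `|v| <= 1 -> 0 <= lam z * (v - local_clock z x)).

Definition global_clock := patch W rho height local_clock.

Lemma global_clock_add1 x : global_clock (x + 1) = global_clock x.
Proof.
have WZ w (k : int) : W w -> W (w + k%:~R) by rewrite /W (periodic_int u1).
rewrite /global_clock -[RHS]addr0; apply: (patch_add1 rho0 sep).
- by move=> w; rewrite /W u1.
- by move=> y; rewrite addr0 height_add1.
- by move=> w y _; rewrite addr0; exact: (local_clock_int w y 1).
Qed.

Lemma global_clock_core z x : W z -> `|x - z| < rho / 2 -> global_clock x = local_clock z x.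
Proof. exact: patch_core. Qed.

Lemma global_clock_smooth x : u x != 0 -> smooth_at global_clock x.
Proof.
move=> x0; apply: (patch_smooth_at rho0 sep).
  by apply: smooth_at_near (height_near x0) _; exact: smooth_at_affine.
move=> w Ww xw; apply: smooth_at_log_clock.
by apply: contra_neq x0 => ->.
Qed.

(** Both the height and the local clocks increase along the displacement of F, and the local clock is
    on the side of the height on which interpolating does not spoil this. *)
Lemma global_clock_sign x : u x != 0 -> 0 < Num.sg (u x) * derive1 global_clock x.
Proof.
move=> x0; set s := Num.sg (u x).
have ss : s * s = 1 by rewrite /s -expr2 sqr_sg x0.
have us : u x = s * `|u x| by exact: numEsg.
have dK : der height x s by apply: der_near (height_near x0) _; exact: der_affine.
case: (patch_near rho0 sep height local_clock x) => [[w Ww [xw _]]|[_ h]]; last first.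
  have -> : derive1 global_clock x = s by apply/der_derive1; exact: der_near h dK.
  by rewrite ss.
have xw' : x != w by apply: contra_neq x0 => ->.
have hx : 0 < `|x - w| < rho by rewrite normr_gt0 subr_eq0 xw'.
have [h1 h2] := good Ww hx.
have l0 := exponent_neq0 Ww.
have dL := log_clock_der (lam w) (phase w) (side_jump e) xw'.
have D := @patch_der R W rho rho0 sep height local_clock w x _ _ Ww xw dK dL.
rewrite (der_derive1 (D : der global_clock x _)) {D}.
set v := _ / rho ^+ 2; have b0 := bump_ge0 v; have b1 := bump_le1 v; have b' := bump_derive_le0 v.
rewrite -/(local_clock w) in dL *.
have h3 := h2 _ (height_bound x).
set D := height x - local_clock w x in h3.
have -> : local_clock w x - height x = - D by rewrite /D opprB.
have xs : 0 < lam w * (x - w) * s.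
  by move: h1; rewrite {1}us mulrA pmulr_lgt0 ?normr_gt0.
have a1 : 0 < s / (lam w * (x - w)).
  rewrite -(pmulr_rgt0 _ xs) (_ : _ * _ = s * s); first by rewrite ss.
  have : lam w * (x - w) != 0 by rewrite mulf_neq0// subr_eq0.
  by move: (lam w * (x - w)) => c c0; field.
have a2 : 0 <= s * (x - w) * D.
  rewrite -(pmulr_lge0 _ (_ : 0 < lam w ^+ 2)); last by rewrite exprn_even_gt0//= l0.
  rewrite (_ : _ * _ = (lam w * (x - w) * s) * (lam w * D)); last by ring.
  exact: mulr_ge0 (ltW xs) h3.
have -> : s * (s + (derive1 bump v * (2 * (x - w) / rho ^+ 2) * - D + bump v * ((lam w * (x - w))^-1 - s))) =
  (1 - bump v) * (s * s) + bump v * (s / (lam w * (x - w))) + (- derive1 bump v) * (2 / rho ^+ 2) * (s * (x - w) * D).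
  by ring.
rewrite ss mulr1; apply: ltr_wpDr.
  apply: mulr_ge0 a2; apply: mulr_ge0; first by rewrite oppr_ge0.
  by apply: divr_ge0 => //; apply: exprn_ge0; exact: ltW.
have [->|bn] := eqVneq (bump v) 0; first by rewrite subr0 mul0r addr0.
by apply: ltr_wpDl; [rewrite subr_ge0|rewrite mulr_gt0// lt_neqAle eq_sym bn].
Qed.

Lemma global_adapted : exists X T rad, adapted X T rad.
Proof.
have T'0 x : u x != 0 -> derive1 global_clock x != 0.
  by move=> /global_clock_sign; apply: contraTneq => ->; rewrite mulr0 ltxx.
have core z x : u z = 0 -> 0 < `|x - z| < rho / 2 ->
    u x != 0 /\ global_clock x = log_clock (lam z) (phase z) (side_jump e) z x.
  move=> z0 /andP[h1 h2]; split; last exact: global_clock_core.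
  have h3 : `|x - z| < rho by apply: lt_trans h2 _; rewrite ltr_pdivrMr// ltr_pMr// ltr1n.
  have hx : 0 < `|x - z| < rho by rewrite h1.
  have [+ _] := good z0 hx.
  by apply: contraTneq => ->; rewrite mulr0 ltxx.
have rho20 : 0 < rho / 2 by rewrite divr_gt0.
have [hC hS] := @clock_of R u global_clock (side_jump e) cu u1 global_clock_add1
  (ex_intro _ p0 p00) (fun x x0 => conj (global_clock_smooth x0) (T'0 x x0))
  (fun z z0 => ex_intro _ _ (ex_intro _ _ (ex_intro _ _ (And3 (exponent_neq0 z0) rho20 (fun x hx => core z x z0 hx))))).
have [K K1 HK] := lift_derive_bounded hF; have K0 : 0 < K by apply: lt_le_trans K1.
exists (clock_field u global_clock), global_clock, (rho / 2 / K); split=> //.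
- by move=> x; apply: clock_field_eq0 => /T'0.
- move=> x x0; have := global_clock_sign x0; rewrite /clock_field (negPf x0) => h.
  have us : u x = Num.sg (u x) * `|u x| by exact: numEsg.
  rewrite {1}us mulrA pmulr_lgt0 ?normr_gt0//.
  rewrite -(pmulr_rgt0 _ (_ : 0 < derive1 global_clock x ^+ 2)); last by rewrite exprn_even_gt0//= T'0.
  by rewrite (_ : _ * _ = Num.sg (u x) * derive1 global_clock x)//; field; exact: T'0.
- move=> z z0; apply: (hS z (lam z) (phase z) (rho / 2) z0 rho20) => x hx.
  by case: (core z x z0 hx).
- by rewrite divr_gt0.
- move=> z x z0 /andP[h1]; rewrite ltr_pdivlMr// => h2.
  have xz : x != z by rewrite -subr_eq0 -normr_gt0.
  have h3 : `|x - z| < rho / 2 by apply: le_lt_trans h2; rewrite ler_peMr.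
  have h4 : `|F x - F z| < rho / 2.
    by apply: le_lt_trans h2; rewrite mulrC; exact: lift_lip hF HK z x.
  have Fz : u (F z) = 0 by apply/eqP; rewrite displ_succ_eq0 z0.
  split; first by case: (core z x z0); rewrite ?h1.
  rewrite (global_clock_core Fz h4) (global_clock_core z0 h3) local_clock_succ//.
  exact: lt_le_trans h3 (le_trans (half_le_double rho0) rho_r).
Qed.

End Global.

Lemma adapted_clock : exists X T rad, adapted X T rad.
Proof. by have [rho rho0 [h1 h2 h3]] := good_radius; exact: global_adapted rho0 h1 h2 h3. Qed.

End TameClock.
(** * Averaging the clock along orbits *)

Section Estimates.
Context {R : realType}.

Lemma expR_dist (t : R) : `|t| <= 2^-1 -> `|expR t - 1| <= 2 * `|t|.
Proof.
move=> ht; have h1 := expR_ge1Dx t; have h2 := expR_ge1Dx (- t).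
have e0 := expR_gt0 t; have eN : expR t * expR (- t) = 1 by rewrite expRN divff// gt_eqF.
move: ht; rewrite ler_norml => /andP[h3 h4]; rewrite ler_norml.
have : expR t * (1 - t) <= expR t * expR (- t) by rewrite ler_pM2l.
rewrite eN.
by case: (ger0P t) => t0 h5; apply/andP; split; nra.
Qed.

(** The form in which two derivatives are compared below: b differs from a by a factor
    that is close to 1. *)
Lemma distortion (d K B c t : R) : 0 < K -> `|t| <= B -> `|B| <= 2^-1 -> `|c| <= 2^-1 -> 0 < d ->
  K * (4 * B + 2 * `|c|) < d ->
  forall a b : R, `|a| <= K -> b * (1 + c) = expR t * a -> `|a - b| < d.
Proof.
move=> K0 tB Bh ch d0 small a b aK hb.
have B0 : 0 <= B := le_trans (normr_ge0 t) tB.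
have Bh' : B <= 2^-1 by rewrite -[B]ger0_norm.
have h1 : `|expR t - 1| <= 2 * `|t| by apply: expR_dist; apply: le_trans tB Bh'.
have c2 : 2^-1 <= 1 + c by move: ch; rewrite ler_norml => /andP[]; lra.
have E : (a - b) * (1 + c) = a * (c - (expR t - 1)) by rewrite mulrBl hb; ring.
have n1 : `|a - b| * 2^-1 <= `|a - b| * (1 + c) by rewrite ler_wpM2l.
have n2 : `|a - b| * (1 + c) = `|a| * `|c - (expR t - 1)|.
  by rewrite -normrM -E normrM [`|1 + c|]ger0_norm//; lra.
have n3 : `|a| * `|c - (expR t - 1)| <= K * (`|c| + 2 * B).
  apply: ler_pM => //; apply: le_trans (ler_normB _ _) _; lra.
move: n1 n2 n3 small; set w := `|a - b|; set v := `|c|; set y := `|a| * _.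
by move=> n1 n2 n3; nra.
Qed.

Lemma small_ratio (a b : R) : 0 < a -> exists N : nat, forall n, (N <= n)%N -> b / n%:R < a.
Proof.
move=> a0; have ib := archi_boundP (normr_ge0 (b / a)); set N := Num.bound _ in ib.
exists N.+1 => n Nn; have n0 : 0 < n%:R :> R by rewrite ltr0n (leq_trans _ Nn).
rewrite ltr_pdivrMr// mulrC -ltr_pdivrMr//; apply: le_lt_trans (ler_norm _) _.
by apply: lt_le_trans ib _; rewrite ler_nat ltnW.
Qed.

End Estimates.

Section Averaging.
Context {R : realType} (e : R) (q : nat) (m : int) (F : R -> R) (p0 r : R).
Context (hT : tame e q m F p0 r).
Context (X T : R -> R) (rad : R) (hA : adapted e q m F X T rad).
Let hF := tame_lift hT.
Let hr := tame_rotation hT.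
Let hC := ad_clock hA.
Local Notation u := (displ q m F).

Lemma orbit_eq0 j x : (u (iter j F x) == 0) = (u x == 0).
Proof. by elim: j => //= j <-; exact: displ_succ_eq0 hT _. Qed.

Lemma orbit_X0 j x : (X (iter j F x) == 0) = (X x == 0).
Proof. by rewrite !(ad_zero hA) orbit_eq0. Qed.

Lemma displ_cont : continuous u.
Proof. by move=> x; apply: derivable_continuous; exact: der_derivable (displ_der hF hr x). Qed.

Lemma orbit_radius n (s : R) : 0 < s -> exists2 s' : R, 0 < s' <= s & forall j z x, (j <= n)%N ->
  `|x - z| < s' -> `|iter j F x - iter j F z| < s.
Proof.
move=> s0; have [K K1 HK] := lift_derive_bounded hF; have K0 : 0 < K by apply: lt_le_trans K1.
have Kn : 1 <= K ^+ n by apply: exprn_ege1.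
exists (s / K ^+ n).
  by rewrite divr_gt0 ?exprn_gt0//= ler_piMr ?(ltW s0)// invf_le1// exprn_gt0.
move=> j z x jn; rewrite ltr_pdivlMr ?exprn_gt0// => h.
apply: le_lt_trans h; apply: le_trans (lift_iter_lip j hF K1 HK z x) _.
by rewrite mulrC ler_wpM2l// ler_weXn2l.
Qed.

Lemma orbit_germ n : exists2 s : R, 0 < s & forall z x, u z = 0 -> 0 < `|x - z| < s -> forall j, (j <= n)%N ->
  u x != 0 /\ T (iter j F x) = T x + j%:R / q%:R.
Proof.
have [s /andP[s0 srad] H] := orbit_radius n (ad_rad hA).
exists s => // z x z0 /andP[h1 h2].
have [x0 _] : u x != 0 /\ T (F x) = T x + q%:R^-1.
  by apply: (ad_germ hA z0); rewrite h1 (lt_le_trans h2).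
elim=> [|j IH] jn; first by rewrite mul0r addr0.
have [_ E] := IH (ltnW jn); split=> //.
have zj : u (iter j F z) = 0 by apply/eqP; rewrite orbit_eq0 z0.
have [|_ E'] := ad_germ hA zj (x := iter j F x).
  rewrite (H j z x (ltnW jn) h2) andbT normr_gt0 subr_eq0.
  by apply: contra_neq x0 => xz; apply/eqP; rewrite -(orbit_eq0 j) xz zj.
by rewrite iterS E' E -natr1 mulrDl mul1r addrA.
Qed.

(** ** Sums along orbits *)

(** F^q moves x by its displacement without leaving the arc, nor the period, of x. *)
Lemma height_iterq x : height q m F p0 (iter q F x) - height q m F p0 x = `|u x|.
Proof.
have l1 := lift_iterq hF hr; have hp : per q m F p0 by case: (tame_p0 hT).
have E : u (iter q F x) = iter q F (iter q F x) - iter q F (x + m%:~R).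
  by rewrite (iterq_int hF hr) /displ opprD addrA.
have sgE : Num.sg (u (iter q F x)) = Num.sg (u x).
  have xE : u x = iter q F x - (x + m%:~R) by rewrite /displ opprD addrA.
  rewrite E xE; have [lt|gt|->] := ltgtP (iter q F x) (x + m%:~R); last by rewrite !subrr.
    by rewrite !ltr0_sg// subr_lt0// (lift1_lt _ _ l1).
  by rewrite !gtr0_sg// subr_gt0// (lift1_lt _ _ l1).
rewrite /height sgE; set n := Num.floor (x - p0).
have := floor_itv (x - p0); rewrite -/n => /andP[h1 h2].
have h3 : iter q F (p0 + n%:~R) <= iter q F x by rewrite (lift1_le _ _ l1); lra.
have h4 : iter q F x < iter q F (p0 + (n + 1)%:~R) by rewrite (lift1_lt _ _ l1); lra.
rewrite !(iterq_int hF hr) hp in h3 h4.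
rewrite (@floor_def _ _ (n + m)); last by rewrite !intrD in h2 h3 h4 *; apply/andP; split; lra.
rewrite -mulrBr [RHS]normrEsg; congr (_ * _).
by rewrite /displ rmorphD /=; ring.
Qed.

(** The displacement is summable along orbits: it is a coboundary over the q-th iterate, of a bounded function. *)
Lemma orbit_displ_sum N x : \sum_(j < N) `|u (iter j F x)| <= 2 * q%:R.
Proof.
pose V x := \sum_(i < q) height q m F p0 (iter i F x).
have VF y : V (F y) - V y = `|u y|.
  rewrite -height_iterq /V.
  have tel n : \sum_(i < n) height q m F p0 (iter i F (F y)) - \sum_(i < n) height q m F p0 (iter i F y) =
      height q m F p0 (iter n F y) - height q m F p0 y.
    elim: n => [|n IH]; first by rewrite !big_ord0 !subrr.
    by rewrite !big_ord_recr /= -iterSr opprD addrACA IH iterS; ring.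
  exact: tel.
have -> : \sum_(j < N) `|u (iter j F x)| = V (iter N F x) - V x.
  elim: N => [|N IH]; first by rewrite big_ord0 subrr.
  by rewrite big_ord_recr /= IH -VF; ring.
have bV y : `|V y| <= q%:R.
  apply: le_trans (ler_norm_sum _ _ _) _.
  apply: le_trans (ler_sum _ (fun i _ => height_bound q m F p0 _)) _.
  by rewrite sumr_const card_ord.
apply: le_trans (ler_norm _) _; apply: le_trans (ler_normB _ _) _.
by rewrite mulr_natl mulr2n lerD.
Qed.

(** By compactness h is bounded by a multiple of the displacement. *)
Lemma vanishing_bound (h : R -> R) (s : R) : continuous h -> (forall x, h (x + 1) = h x) -> 0 < s ->
  (forall z x, u z = 0 -> `|x - z| < s -> h x = 0) ->
  exists2 C : R, 0 < C & forall N x, \sum_(j < N) `|h (iter j F x)| <= C.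
Proof.
move=> ch h1 s0 hs.
have [|t x k|x|t t0 H] := @periodic_radius R (fun t x => t * `|h x| <= `|u x|).
- move=> t t' x t'0 tt; apply: le_trans; exact: ler_wpM2r.
- by rewrite !periodic_int// => y; exact: displ_add1 hF hr y.
- have [x0|x0] := eqVneq (u x) 0.
    by exists s => // y ys; rewrite (hs x y x0 ys) normr0 mulr0.
  have [C C0 HC] := periodic_bounded ch h1.
  have x0' : `|u x| / 2 < `|u x| by rewrite ltr_pdivrMr// ltr_pMr ?ltr1n// normr_gt0.
  have cn : {for x, continuous (fun y => `|u y|)} by apply: cvg_norm; exact: displ_cont.
  have /near_ball[t t0 ht] := continuous_near_gt cn x0'.
  pose t' := Num.min t (`|u x| / 2 / C).
  have t'0 : 0 < t' by rewrite lt_min t0 !divr_gt0// normr_gt0.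
  exists t' => // y yt.
  apply: le_trans (_ : `|u x| / 2 / C * C <= _).
    by apply: ler_pM => //; [exact: ltW|rewrite ge_min lexx orbT].
  rewrite divfK ?gt_eqF//; apply/ltW/ht; apply: lt_le_trans yt _.
  by rewrite ge_min lexx.
have q0 : (0 < q)%N by case: hr.
exists (t^-1 * (2 * q%:R)) => [|N x]; first by rewrite !mulr_gt0 ?invr_gt0// ltr0n.
apply: le_trans (_ : \sum_(j < N) t^-1 * `|u (iter j F x)| <= _).
  by apply: ler_sum => j _; rewrite mulrC ler_pdivlMr// mulrC.
by rewrite -mulr_sumr ler_wpM2l ?invr_ge0 ?(ltW t0)//; exact: orbit_displ_sum.
Qed.

(** ** The rate of the clock under F *)

(** X times the derivative of T \o F. *)
Definition rate x : R := if u x == 0 then 1 else derive1 F x * X x / X (F x).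

Lemma rate_neq0 x : u x != 0 -> X (F x) != 0 /\ X x != 0.
Proof. by move=> x0; rewrite !(ad_zero hA) (displ_succ_eq0 hT) x0. Qed.

Lemma derive_F_rate x : derive1 F x * X x = rate x * X (F x).
Proof.
rewrite /rate; case: eqVneq => [x0|x0]; last by rewrite divfK//; case: (rate_neq0 x0).
have -> : X x = 0 by apply/eqP; rewrite (ad_zero hA) x0.
have -> : X (F x) = 0 by apply/eqP; rewrite (ad_zero hA) (displ_succ_eq0 hT) x0.
by rewrite !mulr0.
Qed.

(** Differentiate T (F y) = T y + 1/q. *)
Lemma rate_near z x : u z = 0 -> `|x - z| < rad -> rate x = 1.
Proof.
move=> z0 xr; rewrite /rate; case: eqVneq => // x0.
have [FX0 X0] := rate_neq0 x0.
have xz : x != z by apply: contra_neq x0 => ->.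
have dT := clock_der hC X0; have dTF := der_comp (clock_der hC FX0) (lift_der x hF).
have /near_ball[s s0 hs] : \forall y \near x, T (F y) = T y + q%:R^-1.
  near=> y; case: (ad_germ hA z0 (x := y)) => [|_ ->//].
  rewrite normr_gt0 subr_eq0; apply/andP; split.
    by near: y; exact: (continuous_near_neq (@cvg_id _ _)).
  near: y; have c1 : {for x, continuous (fun y => `|y - z|)}.
    by apply: cvg_norm; apply: cvgB; [exact: cvg_id|exact: cvg_cst].
  exact: (continuous_near_lt c1).
have E : (X (F x))^-1 * derive1 F x = (X x)^-1 + 0.
  rewrite -(der_derive1 dTF); apply: der_derive1.
  apply: der_near (derD dT (der_cst q%:R^-1 x)).
  by apply/near_ball; exists s.
by rewrite mulrAC [derive1 F x / _]mulrC E addr0 mulVf.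
Unshelve. all: by end_near. Qed.

Lemma rate_gt0 x : 0 < rate x.
Proof.
rewrite /rate; case: eqVneq => // x0; have [FX0 X0] := rate_neq0 x0.
have Fx0 : u (F x) != 0 by rewrite (displ_succ_eq0 hT).
have h1 := ad_sign hA x0; have h2 := ad_sign hA Fx0.
have h3 := displ_succ_mul hT x0; have h4 := lift_derive_gt0 hF x.
have h5 : 0 < e * (X x * X (F x)).
  rewrite -(pmulr_lgt0 _ h3) mulrACA (lift_sgn_sq hF) mul1r mulrACA; exact: mulr_gt0.
rewrite -(pmulr_lgt0 _ (_ : 0 < X (F x) ^+ 2)); last by rewrite exprn_even_gt0//= FX0.
have -> : derive1 F x * X x / X (F x) * X (F x) ^+ 2 = derive1 F x * (X x * X (F x)) by field.
by have := mulr_gt0 h4 h5; rewrite mulrACA (lift_sgn_sq hF) mul1r.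
Qed.

Lemma rate_smooth : smooth rate.
Proof.
move=> x; have [x0|x0] := eqVneq (u x) 0.
  apply: smooth_at_near (_ : \forall y \near x, rate y = 1) (smooth_at_cst 1 x).
  by apply/near_ball; exists rad => [|y]; [exact: ad_rad hA|exact: rate_near].
apply: (@smooth_at_near _ (fun y => derive1 F y * X y * (X (F y))^-1)).
  have := continuous_near_neq (@displ_cont x) x0; apply: filterS => y y0.
  by rewrite /rate (negPf y0).
have sX := clock_smooth hC; have sF := tame_smooth hT.
apply: smooth_atM; first by apply: smooth_atM; [exact: smooth_at_derive1|exact: sX].
by apply: smooth_atV; [case: (rate_neq0 x0)|apply: smooth_at_comp; [exact: sX|exact: sF]].
Qed.

Lemma clock_XF x : X (F (x + 1)) = X (F x).
Proof.
rewrite (lift_add1 hF); case: (lift_sgn hF) => ->; first exact: clock_X1 hC _.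
by rewrite -[RHS](X_int hC _ (-1)) mulrNz.
Qed.

Lemma rate_add1 x : rate (x + 1) = rate x.
Proof.
by rewrite /rate (displ_add1 hF hr) (lift_derive_add1 x hF) (clock_X1 hC) clock_XF.
Qed.

Definition rates n x := \prod_(i < n) rate (iter i F x).

Lemma rates_gt0 n x : 0 < rates n x.
Proof. by apply: prodr_gt0 => i _; exact: rate_gt0. Qed.

Lemma derive_iter_rates n x : derive1 (iter n F) x * X x = rates n x * X (iter n F x).
Proof.
elim: n => [|n IH]; first by rewrite /rates big_ord0 (der_derive1 (der_id x)).
rewrite (derive_iterS n x hF) -mulrA IH /rates big_ord_recr /= -/(rates n x).
by rewrite -[RHS]mulrA -derive_F_rate; ring.
Qed.

Lemma iter_smooth n : smooth (iter n F).
Proof.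
elim: n => [|n IH] x; first exact: smooth_at_id.
by apply: (@smooth_at_comp _ F (iter n F)); [exact: tame_smooth hT _|exact: IH].
Qed.

Lemma rates_smooth n : smooth (rates n).
Proof.
elim: n => [|n IH] x.
  by apply: smooth_at_near (_ : \forall y \near x, _ = 1) (smooth_at_cst 1 x); near=> y; rewrite /rates big_ord0.
apply: (@smooth_at_near _ (fun y => rates n y * rate (iter n F y))).
  by near=> y; rewrite /rates big_ord_recr.
apply: smooth_atM; first exact: IH.
by apply: (@smooth_at_comp _ rate (iter n F)); [exact: rate_smooth|exact: iter_smooth].
Unshelve. all: by end_near. Qed.

Lemma rates_succ n x : rate x * rates n (F x) = rates n.+1 x.
Proof.
rewrite /rates big_ord_recl /=; congr (_ * _); apply: eq_bigr => i _.
by rewrite -iterSr.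
Qed.

(** Logarithmic derivative of the rate along the flow of X. *)
Definition rate_slope x := X x * derive1 rate x / rate x.

Lemma derive_rates n x : X x * derive1 (rates n) x =
  rates n x * \sum_(i < n) rates i x * rate_slope (iter i F x).
Proof.
elim: n => [|n IH].
  rewrite big_ord0 mulr0 (_ : derive1 (rates 0) x = 0) ?mulr0//.
  by apply: der_derive1; apply: der_ext (der_cst 1 x) => y; rewrite /rates big_ord0.
have D : der (rates n.+1) x (derive1 (rates n) x * rate (iter n F x) +
    rates n x * (derive1 rate (iter n F x) * derive1 (iter n F) x)).
  apply: (der_ext (f := fun y => rates n y * rate (iter n F y))).
    by move=> y; rewrite /rates big_ord_recr.
  apply: derM; first by apply/derivable_der/smooth_derivable; exact: rates_smooth.
  apply: (@der_comp _ rate (iter n F)); last exact: lift_der (lift_iter n hF).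
  by apply/derivable_der/smooth_derivable; exact: rate_smooth.
rewrite (der_derive1 D) big_ord_recr /= mulrDr [X x * (derive1 (rates n) x * _)]mulrA IH.
rewrite (_ : X x * (rates n x * (derive1 rate (iter n F x) * derive1 (iter n F) x)) =
  rates n x * derive1 rate (iter n F x) * (derive1 (iter n F) x * X x)); last by ring.
rewrite derive_iter_rates /rate_slope.
have := rate_gt0 (iter n F x).
have -> : rates n.+1 x = rates n x * rate (iter n F x) by rewrite /rates big_ord_recr.
by move=> h; field; rewrite gt_eqF.
Qed.

(** ** Bounds independent of the time of averaging *)

(** The logarithm of the rate is summable along orbits, as it vanishes near the periodic
    points. *)
Lemma rates_bound : exists2 M : R, 1 <= M & forall n x, M^-1 <= rates n x <= M.
Proof.
have cl : continuous (fun x => ln (rate x)).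
  move=> x; apply: continuous_comp.
    by apply: smooth_at_continuous; exact: rate_smooth.
  by apply: continuous_ln; exact: rate_gt0.
have [||C C0 HC] := vanishing_bound cl _ (ad_rad hA).
- by move=> x; rewrite rate_add1.
- by move=> z x z0 xr; rewrite (rate_near z0 xr) ln1.
exists (expR C) => [|n x]; first by rewrite -expR0 ler_expR ltW.
have lE : ln (rates n x) = \sum_(i < n) ln (rate (iter i F x)).
  rewrite /rates; elim: n => [|n IH]; first by rewrite !big_ord0 ln1.
  rewrite !big_ord_recr /= -IH lnM// posrE; last exact: rate_gt0.
  exact: (rates_gt0 n x).
have : `|ln (rates n x)| <= C.
  by rewrite lE; apply: le_trans (ler_norm_sum _ _ _) _; exact: HC.
rewrite ler_norml => /andP[h1 h2].
rewrite -(@lnK _ (rates n x)) ?posrE ?rates_gt0// -expRN !ler_expR.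
by rewrite h1 h2.
Qed.

(** So is the logarithmic derivative of the rate along X, by [derive_rates]. *)
Lemma rates_slope_bound : exists2 B : R, 0 < B & forall n x, `|X x * derive1 (rates n) x| <= B.
Proof.
have [M M1 HM] := rates_bound; have M0 : 0 < M by apply: lt_le_trans M1.
have cs : continuous rate_slope.
  move=> x; apply: cvgM; last first.
    apply: cvgV; first by rewrite gt_eqF// rate_gt0.
    by apply: smooth_at_continuous; exact: rate_smooth.
  apply: cvgM; first by apply: smooth_at_continuous; exact: clock_smooth hC _.
  exact: smooth_derive_cont rate_smooth x.
have [||C C0 HC] := vanishing_bound cs _ (ad_rad hA).
- by move=> x; rewrite /rate_slope (clock_X1 hC) rate_add1 (derive_add1 rate_add1 (fun x => @smooth_derivable _ rate x rate_smooth)).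
- move=> z x z0 xr; rewrite /rate_slope (_ : derive1 rate x = 0) ?mulr0 ?mul0r//.
  apply: der_derive1; apply: der_near (der_cst 1 x).
  have c1 : {for x, continuous (fun y => `|y - z|)}.
    by apply: cvg_norm; apply: cvgB; [exact: cvg_id|exact: cvg_cst].
  by have := continuous_near_lt c1 xr; apply: filterS => y; exact: rate_near.
exists (M * (M * C)) => [|n x]; first by rewrite !mulr_gt0.
have absr i : `|rates i x| <= M by rewrite gtr0_norm ?rates_gt0//; case/andP: (HM i x).
rewrite derive_rates normrM; apply: ler_pM => //.
apply: le_trans (ler_norm_sum _ _ _) _.
apply: le_trans (_ : \sum_(i < n) M * `|rate_slope (iter i F x)| <= _).
  by apply: ler_sum => i _; rewrite normrM ler_wpM2r.
by rewrite -mulr_sumr ler_wpM2l ?(ltW M0).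
Qed.

(** The failure of the clock to be advanced by exactly 1/q. *)
Definition defect x : R := if u x == 0 then 0 else T (F x) - T x - q%:R^-1.

Lemma defect_sum_bound : exists2 C : R, 0 < C & forall n x, \sum_(j < n) `|defect (iter j F x)| <= C.
Proof.
have near0 z x : u z = 0 -> `|x - z| < rad -> defect x = 0.
  move=> z0 xr; rewrite /defect; case: eqVneq => // x0.
  have [|_ ->] := ad_germ hA z0 (x := x); last by rewrite addrAC addrK subrr.
  by rewrite xr normr_gt0 subr_eq0 andbT; apply: contra_neq x0 => ->.
apply: (@vanishing_bound _ rad) => //; last exact: ad_rad hA.
  move=> x; have [x0|x0] := eqVneq (u x) 0.
    apply: smooth_at_continuous; apply: smooth_at_near (_ : \forall y \near x, _ = 0) (smooth_at_cst 0 x).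
    by apply/near_ball; exists rad => [|y]; [exact: ad_rad hA|exact: near0].
  have [FX0 X0] := rate_neq0 x0.
  apply: der_continuous; apply: der_near (_ : \forall y \near x, _ = T (F y) - T y - q%:R^-1) _.
    have := continuous_near_neq (@displ_cont x) x0; apply: filterS => y y0.
    by rewrite /defect (negPf y0).
  apply: derB; last exact: der_cst.
  exact: (derB (der_comp (clock_der hC FX0) (lift_der x hF)) (clock_der hC X0)).
move=> x; rewrite /defect (displ_add1 hF hr) (clock_T1 hC) (lift_add1 hF).
have -> : T (F x + e) = T (F x); last by [].
case: (lift_sgn hF) => ->; first exact: clock_T1 hC _.
by rewrite -[RHS](T_int hC _ (-1)) mulrNz.
Qed.

(** ** The averaged clock *)

Section Average.
Context (N : nat) (N0 : (0 < N)%N).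
Let NR : 0 < N%:R :> R. Proof. by rewrite ltr0n. Qed.

Definition mean_rate x : R := N%:R^-1 * \sum_(j < N) rates j x.
Definition mean_field x : R := X x / mean_rate x.
(** Each T \o F^j - j / q would be T itself if F advanced T by 1/q. The derivative of the
    average is the inverse of [mean_field]. *)
Definition mean_clock x : R := N%:R^-1 * \sum_(j < N) (T (iter j F x) - j%:R / q%:R).

Lemma sum_const_mean (c : R) : N%:R^-1 * \sum_(j < N) c = c.
Proof. by rewrite sumr_const card_ord -[c *+ N]mulr_natl mulKf// gt_eqF. Qed.

Lemma mean_bound M : (forall n x, M^-1 <= rates n x <= M) -> forall x, M^-1 <= mean_rate x <= M.
Proof.
move=> HM x; rewrite -[M^-1](sum_const_mean) -[X in _ <= _ <= X](sum_const_mean M).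
rewrite /mean_rate !ler_pM2l ?invr_gt0//; apply/andP; split.
  by apply: ler_sum => i _; case/andP: (HM i x).
by apply: ler_sum => i _; case/andP: (HM i x).
Qed.

Lemma mean_rate_gt0 x : 0 < mean_rate x.
Proof.
have [M M1 HM] := rates_bound; have /andP[h _] := mean_bound HM x.
by apply: lt_le_trans h; rewrite invr_gt0; apply: lt_le_trans M1.
Qed.

Lemma mean_rate_smooth : smooth mean_rate.
Proof.
move=> x; apply: smooth_atM; first exact: smooth_at_cst.
have -> : (fun y => \sum_(j < N) rates j y) = (fun y => \sum_(j <- index_enum 'I_N) rates j y) by [].
elim: (index_enum _) => [|j l IH].
  by apply: smooth_at_near (_ : \forall y \near x, _ = 0) (smooth_at_cst 0 x); near=> y; rewrite big_nil.
apply: (@smooth_at_near _ (fun y => rates j y + \sum_(j <- l) rates j y)).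
  by near=> y; rewrite big_cons.
by apply: smooth_atD; [exact: rates_smooth|exact: IH].
Unshelve. all: by end_near. Qed.

Lemma mean_rate_der x : der mean_rate x (N%:R^-1 * \sum_(j < N) derive1 (rates j) x).
Proof.
apply: derZ; elim: N => [|n IH].
  by rewrite big_ord0; apply: der_ext (der_cst 0 x) => y; rewrite big_ord0.
rewrite big_ord_recr /=; apply: (der_ext (f := fun y => \sum_(j < n) rates j y + rates n y)).
  by move=> y; rewrite big_ord_recr.
by apply: derD => //; apply/derivable_der/smooth_derivable; exact: rates_smooth.
Qed.

Lemma rates_add1 n x : rates n (x + 1) = rates n x.
Proof.
elim: n x => [|n IH] x; first by rewrite /rates !big_ord0.
rewrite -!rates_succ rate_add1 (lift_add1 hF); congr (_ * _).
case: (lift_sgn hF) => ->; first exact: IH.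
by rewrite -IH subrK.
Qed.

Lemma mean_rate_add1 x : mean_rate (x + 1) = mean_rate x.
Proof. by rewrite /mean_rate; congr (_ * _); apply: eq_bigr => j _; exact: rates_add1. Qed.

Lemma mean_field_eq0 x : (mean_field x == 0) = (u x == 0).
Proof. by rewrite /mean_field mulf_eq0 invr_eq0 (gt_eqF (mean_rate_gt0 x)) orbF (ad_zero hA). Qed.

Lemma clock_iter_add1 j x : T (iter j F (x + 1)) = T (iter j F x).
Proof.
elim: j x => [|j IH] x; first exact: clock_T1 hC _.
rewrite !iterSr (lift_add1 hF); case: (lift_sgn hF) => ->; first exact: IH.
by rewrite -IH subrK.
Qed.

Lemma mean_clock_der x : u x != 0 -> der mean_clock x (mean_field x)^-1.
Proof.
move=> x0; have [_ X0] := rate_neq0 x0.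
have dj j : der (fun y => T (iter j F y) - j%:R / q%:R) x (rates j x / X x).
  have Xj : X (iter j F x) != 0 by rewrite orbit_X0.
  apply: der_eq.
    apply: derB; last exact: der_cst.
    exact: (der_comp (clock_der hC Xj) (lift_der x (lift_iter j hF))).
  rewrite subr0; apply: (mulIf X0); rewrite divfK// -mulrA derive_iter_rates mulrCA mulVf ?mulr1//.
rewrite /mean_field invf_div /mean_rate -mulrA mulr_suml; apply: derZ.
elim: N => [|n IH].
  by rewrite big_ord0; apply: der_ext (der_cst 0 x) => y; rewrite big_ord0.
rewrite big_ord_recr /=.
apply: (der_ext (f := fun y => \sum_(j < n) (T (iter j F y) - j%:R / q%:R) + (T (iter n F y) - n%:R / q%:R))).
  by move=> y; rewrite big_ord_recr.
by apply: derD.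
Qed.

(** The clock being exact near the periodic points, averaging changes nothing there. *)
Lemma mean_germ : exists2 s : R, 0 < s & forall z x, u z = 0 -> `|x - z| < s ->
  mean_rate x = 1 /\ (x != z -> u x != 0 /\ mean_clock x = T x /\ mean_clock (F x) = mean_clock x + q%:R^-1).
Proof.
have [s s0 Hs] := orbit_germ N; have [s' /andP[s'0 _] Hs'] := orbit_radius N (ad_rad hA).
exists (Num.min s s') => [|z x z0]; first by rewrite lt_min s0.
rewrite lt_min => /andP[xs xs']; split.
  rewrite /mean_rate -[RHS](sum_const_mean 1); congr (_ * _); apply: eq_bigr => j _.
  rewrite /rates big1// => i _; apply: (@rate_near (iter i F z)); last first.
    by apply: Hs' => //; apply: ltnW; exact: ltn_trans (ltn_ord i) (ltn_ord j).
  by apply/eqP; rewrite orbit_eq0 z0.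
move=> xz; have xs2 : 0 < `|x - z| < s by rewrite normr_gt0 subr_eq0 xz.
have H j (jN : (j <= N)%N) := Hs z x z0 xs2 j jN.
split; first by case: (H 0%N).
have E : mean_clock x = T x.
  rewrite /mean_clock -[RHS](sum_const_mean (T x)); congr (_ * _); apply: eq_bigr => j _.
  by have [_ ->] := H j (ltnW (ltn_ord j)); rewrite addrK.
split=> //; rewrite E /mean_clock -[RHS](sum_const_mean); congr (_ * _); apply: eq_bigr => j _.
have [_] := H j.+1 (ltn_ord j); rewrite iterSr => ->.
by rewrite -natr1 mulrDl mul1r; ring.
Qed.

Lemma mean_clockP : clock (side_jump e) mean_field mean_clock /\
  forall z, u z = 0 -> derive1 mean_field z = exponent q F z.
Proof.
have [s s0 Hs] := mean_germ.
have Xs z x : u z = 0 -> `|x - z| < s -> mean_field x = X x.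
  by move=> z0 xs; rewrite /mean_field; have [-> _] := Hs z x z0 xs; rewrite divr1.
split; last first.
  move=> z z0; rewrite -(ad_slope hA z0); apply: der_derive1.
  apply: (der_near (f := X)).
    by apply/near_ball; exists s => // y ys; exact: Xs ys.
  by apply/derivable_der/smooth_derivable; exact: clock_smooth hC.
split.
- move=> x; apply: smooth_atM; first exact: clock_smooth hC _.
  by apply: smooth_atV; [rewrite gt_eqF// mean_rate_gt0|exact: mean_rate_smooth].
- by move=> x; rewrite /mean_field (clock_X1 hC) mean_rate_add1.
- by move=> x; rewrite /mean_clock; congr (_ * _); apply: eq_bigr => j _; rewrite clock_iter_add1.
- by have [z z0] := clock_zero hC; exists z; rewrite /mean_field z0 mul0r.
- by move=> x; rewrite mean_field_eq0; exact: mean_clock_der.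
- move=> z /eqP; rewrite mean_field_eq0 => /eqP z0.
  have Xz : X z = 0 by apply/eqP; rewrite (ad_zero hA) z0.
  have [l [c [t [l0 t0 H]]]] := clock_germ hC Xz.
  exists l, c, (Num.min s t); split=> //; first by rewrite lt_min s0.
  move=> x; rewrite lt_min => /andP[h1 /andP[h2 h3]].
  have [] := H x; first by rewrite h1.
  have xz : x != z by rewrite -subr_eq0 -normr_gt0.
  have [_ /(_ xz)[_ [-> _]]] := Hs z x z0 h2.
  by rewrite (Xs z x z0 h2).
Qed.

(** The defect of the averaged clock is the averaged defect, hence O(1/N). *)
Lemma mean_defect x : u x != 0 ->
  mean_clock (F x) - mean_clock x - q%:R^-1 = N%:R^-1 * \sum_(j < N) defect (iter j F x).
Proof.
move=> x0; rewrite -[q%:R^-1](sum_const_mean) /mean_clock -!mulrBr -!sumrB; congr (_ * _).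
apply: eq_bigr => j _; rewrite /defect orbit_eq0 (negPf x0) -iterSr /=; ring.
Qed.

(** Under F the averaged field is multiplied by the derivative of F, up to a factor 1 + O(1/N). *)
Lemma mean_field_F x : u x != 0 -> derive1 F x * mean_field x =
  mean_field (F x) * (1 + N%:R^-1 * (rates N x - 1) / mean_rate x).
Proof.
move=> x0; have A0 := mean_rate_gt0 x; have A1 := mean_rate_gt0 (F x).
have E : rate x * mean_rate (F x) = mean_rate x + N%:R^-1 * (rates N x - 1).
  rewrite /mean_rate mulrCA -mulrDr; congr (_ * _); rewrite mulr_sumr.
  under eq_bigr do rewrite rates_succ.
  have r0 : rates 0 x = 1 by rewrite /rates big_ord0.
  have -> : \sum_(i < N) rates i.+1 x = \sum_(i < N.+1) rates i x - 1.
    by rewrite big_ord_recl r0 addrAC subrr add0r.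
  by rewrite big_ord_recr /=; ring.
rewrite /mean_field mulrA derive_F_rate.
have -> : N%:R^-1 * (rates N x - 1) = rate x * mean_rate (F x) - mean_rate x by rewrite E addrAC subrr add0r.
by field; rewrite !gt_eqF.
Qed.

(** The averaged fields are Lipschitz uniformly in N, since X R_j' is bounded although
    R_j' is not. *)
Lemma mean_field_slope M B C : (forall n x, M^-1 <= rates n x <= M) -> 0 < M ->
  (forall n x, `|X x * derive1 (rates n) x| <= B) -> (forall x, `|derive1 X x| <= C) ->
  forall x, `|derive1 mean_field x| <= C * M + B * M ^+ 2.
Proof.
move=> HM M0 HB HC x; have A0 := mean_rate_gt0 x.
have iA : 0 < (mean_rate x)^-1 <= M.
  rewrite invr_gt0 A0 -[M]invrK lef_pV2 ?posrE ?invr_gt0//.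
  by case/andP: (mean_bound HM x).
case/andP: iA => iA0 iA1.
have dX : der X x (derive1 X x) by apply/derivable_der/smooth_derivable; exact: clock_smooth hC.
have D := derM dX (derV (lt0r_neq0 A0) (mean_rate_der x)).
rewrite (der_derive1 (D : der mean_field x _)).
set A' := N%:R^-1 * _.
have -> : derive1 X x / mean_rate x + X x * (- A' / mean_rate x ^+ 2) =
   derive1 X x * (mean_rate x)^-1 - (X x * A') * (mean_rate x)^-1 ^+ 2.
  by rewrite exprVn; ring.
have bA : `|X x * A'| <= B.
  rewrite /A' mulrCA mulr_sumr normrM gtr0_norm ?invr_gt0// -[B](sum_const_mean).
  rewrite ler_pM2l ?invr_gt0//; apply: le_trans (ler_norm_sum _ _ _) _.
  by apply: ler_sum => j _; exact: HB.
apply: le_trans (ler_normB _ _) _; apply: lerD; rewrite normrM.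
  by apply: ler_pM => //; rewrite gtr0_norm.
apply: ler_pM => //; rewrite ger0_norm ?exprn_ge0 ?(ltW iA0)//.
by rewrite ler_pXn2r ?nnegrE ?(ltW iA0) ?(ltW M0).
Qed.

End Average.

(** ** The corrected map *)

Section Correction.
Context (N : nat) (N0 : (0 < N)%N).
Local Notation XN := (mean_field N).
Local Notation TN := (mean_clock N).
Let hN : clock (side_jump e) XN TN. Proof. by case: (mean_clockP N0). Qed.

(** The correction moves F x along the flow of the averaged field, back by the defect. *)
Definition correction x : R := flow XN TN (- (TN (F x) - TN x - q%:R^-1)) (F x).

Let XN0 x : (XN x == 0) = (u x == 0). Proof. exact: mean_field_eq0 N0 x. Qed.

Let XNF x : u x != 0 -> XN (F x) != 0.
Proof. by move=> x0; rewrite XN0 (displ_succ_eq0 hT). Qed.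

Lemma correction_near : exists2 s : R, 0 < s &
  forall z x, u z = 0 -> `|x - z| < s -> correction x = F x.
Proof.
have [s s0 Hs] := mean_germ N0; exists s => // z x z0 xs.
have [->|xz] := eqVneq x z.
  by apply: flow_zero; apply/eqP; rewrite XN0 (displ_succ_eq0 hT) z0.
have [_ /(_ xz)[_ [_ E]]] := Hs z x z0 xs.
by rewrite /correction E addrAC addrK subrr oppr0 (flow0 hN).
Qed.

Lemma correctionP x : u x != 0 -> same_arc XN (F x) (correction x) /\ TN (correction x) = TN x + q%:R^-1.
Proof.
move=> x0; have [h1 h2] := flowP hN (- (TN (F x) - TN x - q%:R^-1)) (XNF x0).
by split=> //; rewrite h2; ring.
Qed.

(** Near x the corrected map is the flow line of its value at x, run for a time that is
    a function of the averaged clock. *)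
Lemma correction_der x : u x != 0 -> der correction x (XN (correction x) / XN x).
Proof.
move=> x0; have [a0 t0] := correctionP x0; set y0 := correction x in a0 t0 *.
have X0 : XN x != 0 by rewrite XN0.
have y00 : XN y0 != 0 := same_arcr a0.
apply: (der_near (f := fun y => flow XN TN (TN y + (q%:R^-1 - TN y0)) y0)).
  have [s s0 Hs] := same_arc_near hN X0.
  apply/near_ball; exists s => // y /Hs ay.
  have x0y : u y != 0 by rewrite -XN0; exact: same_arcr ay.
  have [b1 b2] := correctionP x0y.
  apply: esym; apply: (flow_unique hN); last by rewrite b2; ring.
  apply: same_arc_trans (same_arc_sym a0) _; apply: same_arc_trans b1.
  apply: lift_same_arc ay; first exact: hF.
  by move=> w; rewrite !XN0 (displ_succ_eq0 hT).
apply: der_eq.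
  apply: (@der_comp _ (fun s => flow XN TN s y0) (fun y => TN y + (q%:R^-1 - TN y0))).
    exact: flow_der_time hN y0 _.
  exact: (derD (clock_der hN X0) (der_cst _ _)).
rewrite addr0 (_ : TN x + (q%:R^-1 - TN y0) = 0); first by rewrite (flow0 hN).
by rewrite t0; ring.
Qed.

(** The correction is small together with its derivative, since moving along the flow of the
    averaged field for a short time changes this field by a factor close to 1. *)
Lemma correction_close K B C tau delta d : 0 < K -> 0 < d ->
  (forall x, `|derive1 F x| <= K) -> (forall x, `|derive1 XN x| <= B) -> (forall x, `|XN x| <= C) ->
  (forall x, u x != 0 -> `|TN (F x) - TN x - q%:R^-1| <= tau) ->
  (forall x, `|N%:R^-1 * (rates N x - 1) / mean_rate N x| <= delta) ->
  0 <= tau -> B * tau <= 2^-1 -> delta <= 2^-1 -> C * tau < d -> K * (4 * (B * tau) + 2 * delta) < d ->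
  forall x, `|F x - correction x| < d /\ `|derive1 F x - derive1 correction x| < d.
Proof.
move=> K0 d0 HK HB HC Ht Hd tau0 s1 s2 s3 s4 x.
have [x0|x0] := eqVneq (u x) 0.
  have [s s0 Hs] := correction_near; have E : correction x = F x.
    by apply: Hs x0 _; rewrite subrr normr0.
  have -> : derive1 correction x = derive1 F x.
    apply: der_derive1; apply: der_near (lift_der x hF).
    by apply/near_ball; exists s => // y; exact: Hs.
  by rewrite E !subrr normr0.
set t := - (TN (F x) - TN x - q%:R^-1).
have tt : `|t| <= tau by rewrite normrN; exact: Ht.
have FX := XNF x0; set y := F x in FX *.
have yt : correction x = flow XN TN t y by [].
pose g s := flow XN TN s y.
have dg s : der g s (XN (g s)) := flow_der_time hN y s.
have B0 : 0 <= B := le_trans (normr_ge0 _) (HB 0).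
split.
  have [c _] := @mvt_between _ g (fun s => XN (g s)) 0 t (fun s _ => dg s).
  rewrite /g (flow0 hN) subr0 -yt distrC => ->.
  apply: le_lt_trans s3; rewrite normrM; exact: ler_pM.
pose h s := ln (XN (g s) / XN y).
have gpos s : 0 < XN (g s) / XN y.
  have [a _] := flowP hN s FX; have := same_arc_sgn hN a.
  move=> h0; have -> : XN (g s) / XN y = XN y * XN (g s) / XN y ^+ 2 by field.
  by rewrite divr_gt0// exprn_even_gt0//= FX.
have dX z : der XN z (derive1 XN z).
  by apply/derivable_der/smooth_derivable; exact: clock_smooth hN.
have dh s : der h s (derive1 XN (g s)).
  have D := derM (@der_comp _ XN g s _ _ (dX _) (dg s)) (der_cst (XN y)^-1 s).
  apply: der_eq; first exact: (@der_comp _ (@ln R) (fun s => XN (g s) / XN y) s _ _ (is_derive1_ln (gpos s)) D).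
  have gs0 : XN (g s) != 0 by have := gpos s; apply: contraTneq => ->; rewrite mul0r ltxx.
  by field; rewrite FX gs0.
have [c _ Eh] := @mvt_between _ h (fun s => derive1 XN (g s)) 0 t (fun s _ => dh s).
have h0 : h 0 = 0 by rewrite /h /g (flow0 hN) divff ?ln1.
rewrite h0 !subr0 in Eh.
have ht : `|h t| <= B * tau by rewrite Eh normrM; exact: ler_pM.
pose dl := N%:R^-1 * (rates N x - 1) / mean_rate N x.
have dld : `|dl| <= delta := Hd x.
rewrite (der_derive1 (correction_der x0)) yt -/(g t).
apply: (@distortion R d K (B * tau) dl (h t)) => //.
- by rewrite ger0_norm// mulr_ge0.
- exact: le_trans s2.
- apply: le_lt_trans s4; rewrite ler_pM2l// lerD2l ler_pM2l//.
have X0 : XN x != 0 by rewrite XN0.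
have -> : derive1 F x = XN y * (1 + dl) / XN x by rewrite -(mean_field_F N0 x0) mulfK.
by rewrite /h lnK ?posrE//; field; rewrite FX X0.
Qed.

Lemma correction_lift (d : R) : (forall G : R -> R, (forall x, G (x + 1) = G x + e) -> (forall x, derivable G x 1) ->
    continuous (derive1 G) -> (forall x, `|derive1 F x - derive1 G x| < d) -> lift e G) ->
  C1_close d F correction -> lift e correction.
Proof.
move=> H cl; have [s s0 Hs] := correction_near.
have near z : u z = 0 -> \forall y \near z, correction y = F y.
  by move=> z0; apply/near_ball; exists s => // y; exact: Hs.
apply: H => [x|x|x|x]; last by case: (cl x).
- rewrite /correction (clock_T1 hN) (lift_add1 hF).
  have [k ek] : exists k : int, e = k%:~R.
    by case: (lift_sgn hF) => ->; [exists 1|exists (-1)].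
  by rewrite ek (T_int hN) (flow_int hN).
- have [x0|x0] := eqVneq (u x) 0.
    by apply: (der_derivable (der_near (near x x0) (lift_der x hF))).
  exact: der_derivable (correction_der x0).
- have [x0|x0] := eqVneq (u x) 0.
    have E := near_derive1 (near x x0).
    have c1 := @lift_derive_cont _ _ _ hF x.
    rewrite /continuous_at (nbhs_singleton E); apply: cvg_trans c1.
    by apply: near_eq_cvg; near do apply/esym.
  have X0 : XN x != 0 by rewrite XN0.
  have cX : continuous XN := clock_cont hN.
  have c1 : {for x, continuous (fun y => XN (correction y) / XN y)}.
    apply: cvgM; last by apply: cvgV => //; exact: cX.
    apply: continuous_comp; last exact: cX.
    exact: der_continuous (correction_der x0).
  have E : \forall y \near x, derive1 correction y = XN (correction y) / XN y.
    have := continuous_near_neq (@displ_cont x) x0; apply: filterS => y y0.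
    exact: der_derive1 (correction_der y0).
  rewrite /continuous_at (nbhs_singleton E); apply: cvg_trans c1.
  by apply: near_eq_cvg; near do apply/esym.
Unshelve. all: by end_near. Qed.

Lemma correction_iter z j : u z = 0 -> iter j correction z = iter j F z.
Proof.
move=> z0; elim: j => //= j ->.
have zj : u (iter j F z) = 0 by apply/eqP; rewrite orbit_eq0 z0.
by have [s s0 Hs] := correction_near; apply: Hs zj _; rewrite subrr normr0.
Qed.

Lemma correction_model : lift e correction -> model e q m correction XN TN p0.
Proof.
move=> hG; have [_ slope] := mean_clockP N0.
have perE z : XN z = 0 -> u z = 0 by move=> /eqP; rewrite XN0 => /eqP.
have c1 z : XN z = 0 -> correction z = F z by move=> /perE/(correction_iter 1).
have mu0 z := multiplier_gt0 hF hr z.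
have Xp0 : u p0 = 0 by apply/displ_eq0; case: (tame_p0 hT).
split=> //.
- by case: hr.
- move=> x; rewrite (flow_neq0 hN); by rewrite !XN0 (displ_succ_eq0 hT).
- by move=> x; rewrite XN0 => /correctionP[].
- by move=> z /perE z0; rewrite correction_iter//; apply/displ_eq0.
- by case: hr.
- have Xp : XN p0 = 0 by apply/eqP; rewrite XN0 Xp0.
  by split=> // /((tame_p0 hT).2)[k E]; exists k; rewrite c1.
- move=> z zX fz; have z0 := perE z zX; rewrite !slope// => /ln_inj E.
  have hz : per q m F z by exact/displ_eq0.
  have fz' : e = -1 -> exists k : int, F z = z + k%:~R.
    by move=> /fz[k Ek]; exists k; rewrite -c1.
  have Em : derive1 (iter q F) z = derive1 (iter q F) p0 by apply: E; rewrite posrE.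
  have [j [k ->]] := tame_rigid hT hz fz' Em.
  by exists j, k; rewrite correction_iter.
Qed.

End Correction.

(** The defect is O(1/N) while the averaged fields are bounded in C^1 uniformly in N, so
    that the corrected map is C^1 close to F for N large. *)
Lemma adapted_dense d : 0 < d -> exists G X' T', model e q m G X' T' p0 /\ C1_close d F G.
Proof.
move=> d0; have [d1 d10 H1] := lift_of_close hF.
have dm : 0 < Num.min d d1 by rewrite lt_min d0.
have [K K1 HK] := lift_derive_bounded hF; have K0 : 0 < K by apply: lt_le_trans K1.
have [M M1 HM] := rates_bound; have M0 : 0 < M by apply: lt_le_trans M1.
have [B B0 HB] := rates_slope_bound.
have [C C0 HC] := periodic_bounded (clock_cont hC) (clock_X1 hC).
have cX' := smooth_derive_cont (clock_smooth hC).
have [C' C'0 HC'] := periodic_bounded cX' (derive_add1 (clock_X1 hC) (fun x => @smooth_derivable _ X x (clock_smooth hC))).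
have [S S0 HS] := defect_sum_bound.
pose B' := C' * M + B * M ^+ 2; have B'0 : 0 <= B' by rewrite addr_ge0// mulr_ge0 ?exprn_ge0// ltW.
pose C2 := C * M; pose D := (M + 1) * M.
have h2 : 0 < 2^-1 :> R by rewrite invr_gt0.
have [N1 H11] := small_ratio (B' * S) h2; have [N2 H22] := small_ratio D h2.
have [N3 H33] := small_ratio (C2 * S) dm.
have [N4 H44] := small_ratio (K * (4 * (B' * S) + 2 * D)) dm.
pose N := (maxn (maxn N1 N2) (maxn N3 N4)).+1.
have N0 : (0 < N)%N by [].
have iN : 0 < N%:R^-1 :> R by rewrite invr_gt0 ltr0n.
have L1 : (N1 <= N)%N by rewrite leqW// !leq_max leqnn ?orbT.
have L2 : (N2 <= N)%N by rewrite leqW// !leq_max leqnn ?orbT.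
have L3 : (N3 <= N)%N by rewrite leqW// !leq_max leqnn ?orbT.
have L4 : (N4 <= N)%N by rewrite leqW// !leq_max leqnn ?orbT.
have {}H11 := H11 N L1. have {}H22 := H22 N L2. have {}H33 := H33 N L3. have {}H44 := H44 N L4.
have iA x : 0 < (mean_rate N x)^-1 <= M.
  rewrite invr_gt0 mean_rate_gt0//= -[M]invrK lef_pV2 ?posrE ?invr_gt0// ?mean_rate_gt0//.
  by case/andP: (mean_bound N0 HM x).
have cl : C1_close (Num.min d d1) F (correction N).
  apply: (@correction_close N N0 K B' C2 (S / N%:R) (D / N%:R)) => //.
  - by have := mean_field_slope N0 HM M0 HB HC'.
  - move=> x; case/andP: (iA x) => a1 a2.
    by rewrite normrM; apply: ler_pM => //; rewrite gtr0_norm.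
  - move=> x x0; rewrite (mean_defect N0 x0) normrM gtr0_norm// mulrC ler_pM2r//.
    by apply: le_trans (ler_norm_sum _ _ _) _.
  - move=> x; case/andP: (iA x) => a1 a2.
    rewrite (_ : D / N%:R = N%:R^-1 * (M + 1) * M); last by rewrite /D; ring.
    rewrite 2!normrM [`|N%:R^-1|]gtr0_norm//; apply: ler_pM => //.
    + rewrite ler_pM2l//; apply: le_trans (ler_normB _ _) _.
      by rewrite normr1 lerD2r gtr0_norm ?rates_gt0//; case/andP: (HM N x).
    + by rewrite gtr0_norm.
  - by rewrite divr_ge0// ltW.
  - by rewrite mulrA; exact: ltW.
  - exact: ltW.
  - by rewrite mulrA.
  - by rewrite (_ : K * _ = K * (4 * (B' * S) + 2 * D) / N%:R)//; ring.
have hG : lift e (correction N).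
  apply: (correction_lift N0 H1); apply: C1_closeW cl; by rewrite ge_min lexx orbT.
exists (correction N), (mean_field N), (mean_clock N); split; first exact: correction_model.
by apply: C1_closeW cl; rewrite ge_min lexx.
Qed.

End Averaging.

(** * Density of the models *)

Lemma models_dense (R : realType) (e : R) F d : lift e F -> 0 < d ->
  exists q m G X T p0, model e q m G X T p0 /\ C1_close d F G.
Proof.
move=> hF d0; have d2 : 0 < d / 2 by rewrite divr_gt0.
have [q [m [G [p0 [r [hT c1]]]]]] := tame_dense hF d2.
have [X [T [rad hA]]] := adapted_clock hT.
have [H [X' [T' [hM c2]]]] := adapted_dense hT hA d2.
exists q, m, H, X', T', p0; split=> //.
by rewrite [d]splitr; exact: C1_close_trans c1 c2.
Qed.
Theorem theorem1 (R : realType) :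
  exists D : set (diff1 R), dense D /\
    forall f : diff1 R, D f ->
      exists (X : circle R -> R) (phi : R -> circle R -> circle R) (q : nat),
        [/\ smooth_field X, is_flow X phi & morse_smale_field X phi] /\
        (forall (t : R) (x : circle R), f (phi t x) = phi t (f x)) /\
        morse_smale f /\
        ((orientation_preserving f /\ common_period f q) \/
         (orientation_reversing f /\ q = 2%N)) /\
        (forall x : circle R, iter q f x = phi 1 x) /\
        centralizer_isog f q.
Proof.
exists [set f : diff1 R | exists e q m F X T p0, model e q m F X T p0 /\ is_C1_lift f F].
split=> [U [f Uf] oU|f [e [q [m [F [X [T [p0 [hM hf]]]]]]]]].
  have /nbhs_ballP[d d0 fU] := open_nbhs_nbhs (conj oU Uf).
  have [e [F [hF fF]]] := lift_of_diff f.
  have [q [m [G [X [T [p0 [hM FG]]]]]]] := models_dense hF d0.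
  have [g gG] := diff_of_lift (model_lift hM).
  exists g; split; last by exists e, q, m, G, X, T, p0.
  by apply: fU; exact: diff_ball_lifts fF gG FG.
exists (circle_field X), (circle_flow X T), q; split.
  by split; [exact: model_smooth_field hM|exact: model_is_flow hM|exact: flow_morse_smale hM].
split; first exact (model_flow_commute hM hf).
split; first exact (model_morse_smale hM hf).
split; first exact (model_orientation hM hf).
split; first exact (model_time_one hM hf).
exact (model_centralizer hM hf).
Qed.
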